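(* Let $F$ be a holomorphic quadratic form on $\mathbf{C}^{2n}_{x,\xi}$ such that the fundamental matrix $\mathcal{F}$ of $F$ does not have the eigenvalues $\pm 2$, and let $\ell$ be a complex linear form on $\mathbf{C}^{2n}$. Let $\Phi_0$ be a strictly plurisubharmonic quadratic form on $\mathbf{C}^n$. Let $a(x,\xi) = \exp(i(F(x,\xi) + \ell(x,\xi)))$ and assume that $a \in L^{\infty}(\Lambda_{\Phi_0})$. Then the operator $a^w(x,D_x): H_{\Phi_0}(\mathbf{C}^n) \rightarrow H_{\Phi_0}(\mathbf{C}^n)$ is bounded.
   Context: The fundamental matrix of $F$ is $\mathcal{F}= \begin{pmatrix}F''_{\xi x} &F''_{\xi \xi }\\ -F''_{xx} &-F''_{x\xi }\end{pmatrix}$, so that the Hamilton vector field of $F$ is $H_F(\rho)=\mathcal{F}\rho$. $\Lambda_{\Phi_0} = \{(x,\frac{2}{i}\frac{\partial \Phi_0}{\partial x}(x)) : x\in \mathbf{C}^n\}$ and $H_{\Phi_0}(\mathbf{C}^n) = L^2(\mathbf{C}^n, e^{-2\Phi_0} L(dx)) \cap \mathrm{Hol}(\mathbf{C}^n)$. The Weyl quantization acting on $H_{\Phi_0}$ is $a^w(x,D_x)u(x) = (2\pi)^{-n}\iint e^{i(x-y)\cdot\theta} a(\frac{x+y}{2},\theta)u(y)\,dy\,d\theta$, the integration taken over the contour $\theta=\frac{2}{i}\frac{\partial\Phi_0}{\partial x}(\frac{x+y}{2})$ (so the operator is a metaplectic Fourier integral operator in the complex domain); boundedness means it extends from its natural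 dense domain to a bounded operator on $H_{\Phi_0}(\mathbf{C}^n)$. *)

(* Defs.v *)
From HB Require Import structures.
From mathcomp Require Import all_boot all_order all_algebra.
From mathcomp Require Import complex.
From mathcomp Require Import all_classical all_reals all_analysis.
Import Order.TTheory GRing.Theory Num.Theory.
Import numFieldNormedType.Exports.

Set Implicit Arguments.
Unset Strict Implicit.
Unset Printing Implicit Defensive.

Local Open Scope ring_scope.

Definition cexp (R : realType) (z : R[i]) : R[i] :=
  Complex (expR (complex.Re z) * cos (complex.Im z))
          (expR (complex.Re z) * sin (complex.Im z)).

Definition sqmod (R : realType) (z : R[i]) : R :=
  complex.Re z ^+ 2 + complex.Im z ^+ 2.

Definition iC (R : realType) : R[i] := Complex 0 1.

Definition cconjmx {R : realType} {m p : nat} (M : 'M[R[i]]_(m, p)) : 'M[R[i]]_(m, p) :=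
  map_mx (fun z : R[i] => (complex.conjc z)) M.

Definition qform (R : realType) (n : nat) (Q : 'M[R[i]]_(n + n))
  (z : 'cV[R[i]]_(n + n)) : R[i] := (z^T *m Q *m z) 0 0.

Definition lform (R : realType) (n : nat) (L : 'rV[R[i]]_(n + n))
  (z : 'cV[R[i]]_(n + n)) : R[i] := (L *m z) 0 0.

Definition hessQ (R : realType) (n : nat) (Q : 'M[R[i]]_(n + n)) : 'M[R[i]]_(n + n) :=
  Q + Q^T.

(* fundamental matrix  [[F''_{xi x}, F''_{xi xi}], [-F''_{xx}, -F''_{x xi}]],
   where (F''_{xi x})_{jk} = d^2F / dxi_j dx_k etc. *)
Definition fundmx (R : realType) (n : nat) (Q : 'M[R[i]]_(n + n)) : 'M[R[i]]_(n + n) :=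
  let H := hessQ Q in
  block_mx (dlsubmx H) (drsubmx H) (- ulsubmx H) (- ursubmx H).

Definition symb (R : realType) (n : nat) (Q : 'M[R[i]]_(n + n))
  (L : 'rV[R[i]]_(n + n)) (z : 'cV[R[i]]_(n + n)) : R[i] :=
  cexp (iC R * (qform Q z + lform L z)).

(* A real quadratic form on C^n: Phi_0(x) = Re(x^T A x) + x^* B x,
   with A complex symmetric and B Hermitian; it is strictly plurisubharmonic
   iff its Levi matrix B is positive definite. *)
Definition Phi0 (R : realType) (n : nat) (A B : 'M[R[i]]_n) (x : 'cV[R[i]]_n) : R :=
  complex.Re ((x^T *m A *m x) 0 0) + complex.Re (((cconjmx x)^T *m B *m x) 0 0).

(* holomorphic gradient dPhi_0/dx (x) = A x + B^T conj(x) *)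
Definition dPhi0 (R : realType) (n : nat) (A B : 'M[R[i]]_n) (x : 'cV[R[i]]_n)
  : 'cV[R[i]]_n := A *m x + B^T *m cconjmx x.

Definition LamPt (R : realType) (n : nat) (A B : 'M[R[i]]_n) (x : 'cV[R[i]]_n)
  : 'cV[R[i]]_(n + n) := col_mx x ((2 / iC R) *: dPhi0 A B x).

Definition upd (R : realType) (v : nat -> R[i]) (j : nat) (c : R[i]) : nat -> R[i] :=
  fun m => if m == j then c else v m.

Fixpoint iint (R : realType) (k : nat) (f : (nat -> R[i]) -> \bar R)
  (v : nat -> R[i]) {struct k} : \bar R :=
  match k with
  | 0 => f v
  | k'.+1 => (\int[@lebesgue_measure R]_s \int[@lebesgue_measure R]_t
               iint k' f (upd v k' (Complex s t)))%E
  end.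

Definition intCn (R : realType) (n : nat) (f : 'cV[R[i]]_n -> \bar R) : \bar R :=
  iint n (fun v => f (\col_(j < n) v j)) (fun _ => 0).

Definition cintCn (R : realType) (n : nat) (g : 'cV[R[i]]_n -> R[i]) : R[i] :=
  Complex (fine (intCn (fun y => (complex.Re (g y))%:E)))
          (fine (intCn (fun y => (complex.Im (g y))%:E))).

Definition holomorphic (R : realType) (n : nat) (u : 'cV[R[i]]_n -> R[i]) : Prop :=
  forall x : 'cV[(R[i] : numFieldType)]_n,
    differentiable (u : 'cV[(R[i] : numFieldType)]_n -> (R[i] : numFieldType)^o) x.

Definition wnorm2 (R : realType) (n : nat) (A B : 'M[R[i]]_n)
  (u : 'cV[R[i]]_n -> R[i]) : \bar R :=
  intCn (fun x => (sqmod (u x) * expR (- (2 * Phi0 A B x)))%:E).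

(* natural dense domain of a^w: holomorphic u with u e^{-Phi_0} rapidly
   decreasing *)
Definition weyl_dom (R : realType) (n : nat) (A B : 'M[R[i]]_n)
  (u : 'cV[R[i]]_n -> R[i]) : Prop :=
  holomorphic u /\
  forall N : nat, exists K : R, forall x : 'cV[R[i]]_n,
    Num.sqrt (sqmod (u x)) * expR (- Phi0 A B x) *
      (1 + \sum_(j < n) sqmod (x j 0)) ^+ N <= K.

(* Weyl quantization on H_{Phi_0}: integration over the contour
   theta = (2/i) dPhi_0/dx((x+y)/2), parametrised by y in C^n;
   on this contour dy /\ dtheta = +- 2^n det(B) L(dy). *)
Definition weyl (R : realType) (n : nat) (A B : 'M[R[i]]_n)
  (a : 'cV[R[i]]_(n + n) -> R[i]) (u : 'cV[R[i]]_n -> R[i]) (x : 'cV[R[i]]_n)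
  : R[i] :=
  ((2 : R[i]) ^+ n * \det B / (Complex (2 * pi) 0) ^+ n) *
  cintCn (fun y : 'cV[R[i]]_n =>
    let m := (1 / 2 : R[i]) *: (x + y) in
    let th := (2 / iC R) *: dPhi0 A B m in
    cexp (iC R * ((x - y)^T *m th) 0 0) * a (col_mx m th) * u y).

(* Main.v *)
Require Import Defs.
From HB Require Import structures.
From mathcomp Require Import all_boot all_order all_algebra.
From mathcomp Require Import complex.
From mathcomp Require Import all_classical all_reals all_analysis.
From mathcomp Require Import measurable_realfun.
From mathcomp Require Import ring lra.
Import Order.TTheory GRing.Theory Num.Theory.
Import numFieldNormedType.Exports.
Import ComplexField.Normc.
Local Open Scope classical_set_scope.
Local Open Scope ring_scope.

Set Implicit Arguments.
Unset Strict Implicit.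
Unset Printing Implicit Defensive.

Local Notation re := complex.Re.
Local Notation im := complex.Im.

(** In the variable [v = e^{- y^T A y} u], the contour integral defining the
Weyl operator involves only the Hermitian form of [B].  Inserting the
reproducing formula for [v] writes the operator with a kernel
[K(x,s) e^{- 2 h(s,s)}], [h(p,q) = p^* B q], where [K] is a Gaussian integral,
hence the exponential of a quadratic polynomial in [x] and the conjugate of
[s].  Boundedness of the symbol on Lambda bounds [|K|] by a multiple of
[exp(h(x,x) + h(s,s))], so the phase of the reduced kernel is a concave
quadratic polynomial bounded above.  A degenerate direction of that polynomial
lying in only one of the two variables would give an eigenvector of the
fundamental matrix for the eigenvalue -2; hence the reduced kernel decays like
a Gaussian in each variable separately, uniformly in the other, and Schur's
test applies. *)

(** Along the contour the modulus of the conjugated kernel, weighted on both sides, is exactly the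
    modulus of the symbol at the midpoint. This is only bounded, so no size estimate on that kernel
    can succeed; decay has to come from the holomorphy of [u], and the reproducing formula is what
    brings it in. That formula rests on means over circles, obtained from Goursat's theorem in
    logarithmic coordinates. The Gaussian integral is never evaluated: only its dependence on the
    linear source is needed, and this follows from real translations of the integration variable,
    extended to complex sources by analyticity. Its remaining factor [kernel_cst] is thus an unknown
    constant: if it is zero the operator vanishes, and otherwise dividing by it turns the bound on
    the kernel into a bound on the phase. The number -2 arises because a null vector of the mixed
    block, transported to the complexification of Lambda, satisfies [H z = 2 J z], where [J^2 = -1]
    and the fundamental matrix is [J H]. Integrals over C^n are nested one-variable integrals; one
    abstract measure space realizes them. *)

(** * Components, modulus and exponential of complex numbers *)

Section ComplexBasics.
Context {R : realType}.
Implicit Types z w : R[i].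

Lemma reD z w : re (z + w) = re z + re w. Proof. by case: z w => [a b] [c d]. Qed.
Lemma imD z w : im (z + w) = im z + im w. Proof. by case: z w => [a b] [c d]. Qed.
Lemma reN z : re (- z) = - re z. Proof. by case: z. Qed.
Lemma imN z : im (- z) = - im z. Proof. by case: z. Qed.
Lemma reB z w : re (z - w) = re z - re w. Proof. by rewrite reD reN. Qed.
Lemma imB z w : im (z - w) = im z - im w. Proof. by rewrite imD imN. Qed.
Lemma reM z w : re (z * w) = re z * re w - im z * im w.
Proof. by case: z w => [a b] [c d]. Qed.
Lemma imM z w : im (z * w) = re z * im w + im z * re w.
Proof. by case: z w => [a b] [c d]. Qed.
Lemma reJ z : re (complex.conjc z) = re z. Proof. by case: z. Qed.
Lemma imJ z : im (complex.conjc z) = - im z. Proof. by case: z. Qed.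
Definition reimE := (reD, imD, reB, imB, reN, imN, reM, imM, reJ, imJ).

Lemma complex_ext z w : re z = re w -> im z = im w -> z = w.
Proof. by case: z w => [a b] [c d] /= -> ->. Qed.

Lemma re_natr n : re (n%:R : R[i]) = n%:R.
Proof. by elim: n => // n IH; rewrite -!natr1 reD IH. Qed.
Lemma im_natr n : im (n%:R : R[i]) = 0.
Proof. by elim: n => // n IH; rewrite -!natr1 imD IH addr0. Qed.

Lemma re_sum (I : Type) (s : seq I) (P : pred I) (F : I -> R[i]) :
  re (\sum_(i <- s | P i) F i) = \sum_(i <- s | P i) re (F i).
Proof. by elim/big_ind2 : _ => // a b c d <- <-; rewrite reD. Qed.
Lemma im_sum (I : Type) (s : seq I) (P : pred I) (F : I -> R[i]) :
  im (\sum_(i <- s | P i) F i) = \sum_(i <- s | P i) im (F i).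
Proof. by elim/big_ind2 : _ => // a b c d <- <-; rewrite imD. Qed.

Lemma sqmod_ge0 z : 0 <= sqmod z.
Proof. by rewrite addr_ge0 ?sqr_ge0. Qed.

Lemma normc_sqrt z : normc z = Num.sqrt (sqmod z).
Proof. by case: z. Qed.

Lemma normc_sqr z : normc z ^+ 2 = sqmod z.
Proof. by rewrite normc_sqrt sqr_sqrtr ?sqmod_ge0. Qed.

Lemma normc_ge0 z : 0 <= normc z.
Proof. by rewrite normc_sqrt sqrtr_ge0. Qed.

Lemma normr_normc z : `|z| = Complex (normc z) 0.
Proof. by rewrite normc_def normc_sqrt. Qed.

Lemma normcD z w : normc (z + w) <= normc z + normc w.
Proof. exact: le_normcD. Qed.

Lemma normc_opp z : normc (- z) = normc z.
Proof. exact: normcN. Qed.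

Lemma normcB z w : normc (z - w) = normc (w - z).
Proof. by rewrite -normc_opp opprB. Qed.

Lemma normc_conj z : normc (complex.conjc z) = normc z.
Proof. by rewrite !normc_sqrt /sqmod reJ imJ sqrrN. Qed.

Lemma normc_sum (I : Type) (s : seq I) (P : pred I) (F : I -> R[i]) :
  normc (\sum_(i <- s | P i) F i) <= \sum_(i <- s | P i) normc (F i).
Proof.
elim/big_ind2 : _ => //; first by rewrite normc0.
by move=> a b c d h1 h2; apply: le_trans (normcD _ _) (lerD _ _).
Qed.

Lemma abs_re_le z : `|re z| <= normc z.
Proof.
rewrite normc_sqrt -sqrtr_sqr ler_wsqrtr// lerDl; exact: sqr_ge0.
Qed.
Lemma abs_im_le z : `|im z| <= normc z.
Proof.
rewrite normc_sqrt -sqrtr_sqr ler_wsqrtr// lerDr; exact: sqr_ge0.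
Qed.

Lemma normc_le_reim z : normc z <= `|re z| + `|im z|.
Proof.
have h : 0 <= `|re z| + `|im z| by rewrite addr_ge0.
rewrite -(ler_pXn2r (_ : 0 < 2)%N) ?nnegrE ?normc_ge0//.
rewrite normc_sqr /sqmod -(real_normK (num_real (re z))) -(real_normK (num_real (im z))).
by rewrite sqrrD addrAC lerDl mulrn_wge0 ?mulr_ge0.
Qed.

Lemma normcR (x : R) : normc (Complex x 0) = `|x|.
Proof. by rewrite normc_sqrt /sqmod /= expr0n addr0 sqrtr_sqr. Qed.

Lemma normc_eq0 z : (normc z == 0) = (z == 0).
Proof. by apply/eqP/eqP => [/eq0_normc//|->]; rewrite normc0. Qed.

Lemma normc_gt0 z : (0 < normc z) = (z != 0).
Proof. by rewrite lt_def normc_ge0 andbT normc_eq0. Qed.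

Lemma iC_sqr : iC R * iC R = -1.
Proof. by apply: complex_ext; rewrite /iC !reimE /=; ring. Qed.

Lemma cexpD z w : cexp (z + w) = cexp z * cexp w.
Proof.
apply: complex_ext; rewrite /cexp !reimE /= expRD ?cosD ?sinD; ring.
Qed.

Lemma cexp0 : cexp (0 : R[i]) = 1.
Proof. by apply: complex_ext; rewrite /cexp /= expR0 ?cos0 ?sin0; ring. Qed.

Lemma normc_cexp z : normc (cexp z) = expR (re z).
Proof.
rewrite normc_sqrt /sqmod /cexp /= !exprMn -mulrDr cos2Dsin2 mulr1 sqrtr_sqr.
by rewrite ger0_norm ?expR_ge0.
Qed.

(** Mean value theorem twice: [cos x - 1 = - x sin c] and [|sin c| <= c <= x]. Only the quadratic
    order matters later, not the constant. *)
Lemma cos_sub1_le (b : R) : `|cos b - 1| <= b ^+ 2.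
Proof.
suff h : forall x : R, 0 <= x -> `|cos x - 1| <= x ^+ 2.
  have [/h//|/ltW b0] := leP 0 b.
  by have := h (- b); rewrite cosN sqrrN oppr_ge0; apply.
move=> x; rewrite le_eqVlt => /orP[/eqP <-|x0]; first by rewrite cos0 subrr normr0 expr0n.
have [c cx] := @MVT R cos (fun y => - sin y) 0 x x0
  (fun y _ => is_derive_cos y) (continuous_subspaceT (@continuous_cos R)).
rewrite cos0 subr0 => ->; rewrite normrM (gtr0_norm x0) normrN expr2 ler_pM2r//.
have /andP[c0 cx'] : 0 < c < x by move: cx; rewrite in_itv.
have [d dx] := @MVT R sin cos 0 c c0
  (fun y _ => is_derive_sin y) (continuous_subspaceT (@continuous_sin R)).
rewrite sin0 !subr0 => ->; rewrite normrM (gtr0_norm c0).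
rewrite -[leRHS]mul1r ler_pM ?(ltW cx') ?(ltW c0)//.
by rewrite ler_norml cos_geN1 cos_le1.
Qed.

Lemma sin_sub_le (b : R) : `|sin b - b| <= b ^+ 2.
Proof.
suff h : forall x : R, 0 <= x -> `|sin x - x| <= x ^+ 2.
  have [/h//|/ltW b0] := leP 0 b.
  by have := h (- b); rewrite sinN -opprD normrN sqrrN oppr_ge0; apply.
move=> x; rewrite le_eqVlt => /orP[/eqP <-|x0]; first by rewrite sin0 subrr normr0 expr0n.
have hd (y : R) : is_derive y (1 : R) (fun t => sin t - t) (cos y - 1).
  by have := @is_deriveB _ _ _ sin id y 1 _ _ (is_derive_sin y) (is_derive_id y 1).
have [c cx] := @MVT R (fun t => sin t - t) (fun y => cos y - 1) 0 x x0
  (fun y _ => hd y) (derivable_within_continuous (fun y _ => @ex_derive _ _ _ _ _ _ _ (hd y))).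
rewrite sin0 !subr0 => ->; rewrite normrM (gtr0_norm x0) expr2 ler_pM2r//.
have /andP[c0 cx'] : 0 < c < x by move: cx; rewrite in_itv.
have [d dx] := @MVT R cos (fun y => - sin y) 0 c c0
  (fun y _ => is_derive_cos y) (continuous_subspaceT (@continuous_cos R)).
rewrite cos0 subr0 => ->; rewrite normrM normrN (gtr0_norm c0).
rewrite -[leRHS]mul1r ler_pM ?(ltW cx') ?(ltW c0)//.
by rewrite ler_norml sin_geN1 sin_le1.
Qed.

(** The inequality [1 + t <= exp t] at [t = - a], multiplied by [exp a], gives
    [exp a - 1 <= a exp a]. *)
Lemma expR_sub1_le (a : R) : `|expR a - 1| <= `|a| * expR `|a|.
Proof.
have h1 := expR_ge1Dx a; have h2 := expR_ge1Dx (- a).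
have e0 := expR_gt0 a.
have h3 : 1 - expR (- a) = (expR a - 1) * expR (- a).
  by rewrite mulrBl -expRD subrr expR0 mul1r.
have h4 : (expR a - 1) * expR (- a) <= a by lra.
have h5 : expR a - 1 <= a * expR a.
  have := ler_wpM2r (ltW e0) h4; rewrite -mulrA -expRD addNr expR0; lra.
have [a0|/ltW a0] := leP 0 a.
  by rewrite (ger0_norm a0) ger0_norm; lra.
have h6 : 1 <= expR (- a) by lra.
rewrite (ler0_norm a0) ler0_norm; first by nra.
by have := expR_ge0 a; nra.
Qed.

Lemma expR_sub1B_le (a : R) : `|expR a - 1 - a| <= a ^+ 2 * expR `|a|.
Proof.
have h1 := expR_ge1Dx a; have h2 := expR_ge1Dx (- a).
have e0 := expR_gt0 a.
have h3 : 1 - expR (- a) = (expR a - 1) * expR (- a).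
  by rewrite mulrBl -expRD subrr expR0 mul1r.
have h4 : (expR a - 1) * expR (- a) <= a by lra.
have h5 : expR a - 1 <= a * expR a.
  have := ler_wpM2r (ltW e0) h4; rewrite -mulrA -expRD addNr expR0; lra.
rewrite ger0_norm; last lra.
have [a0|/ltW a0] := leP 0 a; first by rewrite ger0_norm //; nra.
have h6 : 1 <= expR (- a) by lra.
rewrite ler0_norm //; nra.
Qed.

(** Second-order remainder of the exponential, behind both its complex differentiability and
    differentiation under the integral sign. Real and imaginary parts each cost [2 r^2 exp r]; the
    constant 5 leaves slack. *)
Lemma cexp_sub1B_le z : normc (cexp z - 1 - z) <= 5 * normc z ^+ 2 * expR (normc z).
Proof.
apply: le_trans (normc_le_reim _) _; rewrite !reimE /=.
have ha := abs_re_le z; have hb := abs_im_le z.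
move: (re z) (im z) (normc z) (normc_ge0 z) ha hb => a b r r0 ha hb.
have e1 : expR a <= expR r by rewrite ler_expR (le_trans (ler_norm _)).
have e2 : expR `|a| <= expR r by rewrite ler_expR.
have er := expR_gt0 r; have ea := expR_gt0 a; have ea' := expR_gt0 `|a|.
have b2 : b ^+ 2 <= r ^+ 2 by rewrite -(real_normK (num_real b)) ler_pXn2r.
have a2 : a ^+ 2 <= r ^+ 2 by rewrite -(real_normK (num_real a)) ler_pXn2r.
have r2 := sqr_ge0 r; have sa := sqr_ge0 a; have sb := sqr_ge0 b.
have A : `|expR a * cos b - 1 - a| <= 2 * r ^+ 2 * expR r.
  rewrite (_ : _ - a = expR a * (cos b - 1) + (expR a - 1 - a)); last ring.
  apply: le_trans (ler_normD _ _) _; rewrite normrM (gtr0_norm ea).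
  have h1 := cos_sub1_le b; have h2 := expR_sub1B_le a.
  have h3 : expR a * `|cos b - 1| <= expR r * r ^+ 2.
    by apply: ler_pM => //; first [exact: le_trans h1 b2 | lra].
  have h4 : a ^+ 2 * expR `|a| <= r ^+ 2 * expR r by apply: ler_pM => //; lra.
  lra.
have B : `|expR a * sin b - 0 - b| <= 2 * r ^+ 2 * expR r.
  rewrite (_ : _ - b = expR a * (sin b - b) + (expR a - 1) * b); last ring.
  apply: le_trans (ler_normD _ _) _; rewrite !normrM (gtr0_norm ea).
  have h1 := sin_sub_le b; have h2 := expR_sub1_le a.
  have h3 : expR a * `|sin b - b| <= expR r * r ^+ 2.
    by apply: ler_pM => //; first [exact: le_trans h1 b2 | lra].
  have h5 : `|a| * expR `|a| <= r * expR r by apply: ler_pM => //; lra.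
  have h4 : `|expR a - 1| * `|b| <= r * expR r * r.
    by apply: ler_pM => //; exact: le_trans h2 h5.
  have -> : 2 * r ^+ 2 * expR r = expR r * r ^+ 2 + r * expR r * r by ring.
  exact: lerD.
have := mulr_ge0 r2 (ltW er); lra.
Qed.

End ComplexBasics.

(** * Measurability of complex-valued and matrix-valued functions *)

Section ComplexMeasurable.
Context {R : realType} {d} {T : measurableType d}.
Implicit Types f g : T -> R[i].

(** Imposed on the two real components, so that [R[i]] needs no sigma-algebra of its own. *)
Definition cmeas f :=
  measurable_fun setT (fun t => re (f t)) /\ measurable_fun setT (fun t => im (f t)).

Lemma cmeas_cst z : cmeas (fun _ => z).
Proof. by split; exact: measurable_cst. Qed.

Lemma cmeas_ext f g : f =1 g -> cmeas f -> cmeas g.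
Proof. by move=> /funext ->. Qed.

Lemma cmeasD f g : cmeas f -> cmeas g -> cmeas (fun t => f t + g t).
Proof.
move=> [f1 f2] [g1 g2]; split; under eq_fun do rewrite !reimE; exact: measurable_funD.
Qed.

Lemma cmeasN f : cmeas f -> cmeas (fun t => - f t).
Proof.
by move=> [f1 f2]; split; under eq_fun do rewrite !reimE; exact: measurableT_comp.
Qed.

Lemma cmeasM f g : cmeas f -> cmeas g -> cmeas (fun t => f t * g t).
Proof.
move=> [f1 f2] [g1 g2]; split; under eq_fun do rewrite !reimE.
  by apply: measurable_funB; exact: measurable_funM.
by apply: measurable_funD; exact: measurable_funM.
Qed.

Lemma cmeasJ f : cmeas f -> cmeas (fun t => complex.conjc (f t)).
Proof.
move=> [f1 f2]; split; under eq_fun do rewrite !reimE; first exact: f1.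
exact: measurableT_comp.
Qed.

Lemma cmeas_sum (I : Type) (s : seq I) (F : I -> T -> R[i]) :
  (forall i, cmeas (F i)) -> cmeas (fun t => \sum_(i <- s) F i t).
Proof.
move=> h; elim: s => [|i s IH].
  by apply: (cmeas_ext _ (cmeas_cst 0)) => t; rewrite big_nil.
by apply: (cmeas_ext _ (cmeasD (h i) IH)) => t; rewrite big_cons.
Qed.

Lemma cmeas_cexp f : cmeas f -> cmeas (fun t => cexp (f t)).
Proof.
move=> [f1 f2]; split; rewrite /cexp /=; apply: measurable_funM.
- exact: measurableT_comp.
- by apply: measurableT_comp f2; apply: continuous_measurable_fun; exact: continuous_cos.
- exact: measurableT_comp.
- by apply: measurableT_comp f2; apply: continuous_measurable_fun; exact: continuous_sin.
Qed.

Lemma cmeas_sqmod f : cmeas f -> measurable_fun setT (fun t => sqmod (f t)).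
Proof.
by move=> [f1 f2]; apply: measurable_funD; apply: measurable_funX.
Qed.

Lemma cmeas_normc f : cmeas f -> measurable_fun setT (fun t => normc (f t)).
Proof.
move=> mf; under eq_fun do rewrite normc_sqrt.
by apply: measurableT_comp (cmeas_sqmod mf) => //; apply: continuous_measurable_fun; exact: sqrt_continuous.
Qed.

Lemma cmeas_real (f : T -> R) : measurable_fun setT f -> cmeas (fun t => Complex (f t) 0).
Proof. by split => //=; exact: measurable_cst. Qed.

Lemma cmeas_normc_EFin f : cmeas f -> measurable_fun setT (fun t => (normc (f t))%:E).
Proof. by move=> /cmeas_normc/measurable_EFinP. Qed.

Definition mxmeas m p (A : T -> 'M[R[i]]_(m, p)) := forall i j, cmeas (fun t => A t i j).

Lemma mxmeas_cst m p (A : 'M[R[i]]_(m, p)) : mxmeas (fun _ => A).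
Proof. by move=> i j; exact: cmeas_cst. Qed.

Lemma mxmeasD m p (A B : T -> 'M[R[i]]_(m, p)) :
  mxmeas A -> mxmeas B -> mxmeas (fun t => A t + B t).
Proof.
by move=> hA hB i j; apply: cmeas_ext (cmeasD (hA i j) (hB i j)) => t; rewrite mxE.
Qed.

Lemma mxmeasN m p (A : T -> 'M[R[i]]_(m, p)) : mxmeas A -> mxmeas (fun t => - A t).
Proof. by move=> hA i j; apply: cmeas_ext (cmeasN (hA i j)) => t; rewrite mxE. Qed.

Lemma mxmeasZ m p (c : T -> R[i]) (A : T -> 'M[R[i]]_(m, p)) :
  cmeas c -> mxmeas A -> mxmeas (fun t => c t *: A t).
Proof. by move=> hc hA i j; apply: cmeas_ext (cmeasM hc (hA i j)) => t; rewrite mxE. Qed.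

Lemma mxmeasM m p q (A : T -> 'M[R[i]]_(m, p)) (B : T -> 'M[R[i]]_(p, q)) :
  mxmeas A -> mxmeas B -> mxmeas (fun t => A t *m B t).
Proof.
move=> hA hB i j; apply: (@cmeas_ext (fun t => \sum_k A t i k * B t k j)).
  by move=> t; rewrite mxE.
by apply: cmeas_sum => k; exact: cmeasM.
Qed.

Lemma mxmeas_tr m p (A : T -> 'M[R[i]]_(m, p)) : mxmeas A -> mxmeas (fun t => (A t)^T).
Proof. by move=> hA i j; apply: cmeas_ext (hA j i) => t; rewrite mxE. Qed.

Lemma mxmeas_conj m p (A : T -> 'M[R[i]]_(m, p)) : mxmeas A -> mxmeas (fun t => cconjmx (A t)).
Proof. by move=> hA i j; apply: cmeas_ext (cmeasJ (hA i j)) => t; rewrite mxE. Qed.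

Lemma mxmeas_col m1 m2 p (A : T -> 'M[R[i]]_(m1, p)) (B : T -> 'M[R[i]]_(m2, p)) :
  mxmeas A -> mxmeas B -> mxmeas (fun t => col_mx (A t) (B t)).
Proof.
move=> hA hB i j; case: (split_ordP i) => k ->.
  by apply: cmeas_ext (hA k j) => t; rewrite col_mxEu.
by apply: cmeas_ext (hB k j) => t; rewrite col_mxEd.
Qed.

Definition ccont n (u : 'cV[R[i]]_n -> R[i]) := forall (x : 'cV[R[i]]_n) (eps : R), 0 < eps ->
  exists2 del : R, 0 < del & forall y : 'cV[R[i]]_n, (forall i, normc (y i 0 - x i 0) < del) ->
    normc (u y - u x) < eps.

(** The integer vectors are countable, so every preimage is a countable union of finite
    intersections of level sets; hence [g] may be arbitrary. *)
Lemma measurable_discrete n (k : T -> 'cV[int]_n) (g : 'cV[int]_n -> R) :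
  (forall i c, measurable [set t | k t i 0 = c]) -> measurable_fun setT (fun t => g (k t)).
Proof.
move=> hk _ Y mY; rewrite setTI.
have -> : (fun t => g (k t)) @^-1` Y =
   \bigcup_(c in [set c | Y (g c)]) \bigcap_(i in [set: 'I_n]) [set t | k t i 0 = c i 0].
  apply/seteqP; split => t /=.
    by move=> Yt; exists (k t) => // i _.
  move=> [c Yc h]; rewrite (_ : k t = c) //.
  by apply/matrixP => i j; rewrite !ord1; exact: h.
rewrite bigcup_mkcond; apply: countable_bigcupT_measurable; first exact: countableP.
move=> c; case: ifP => // _; apply: fin_bigcap_measurable => [|i _]; [exact: finite_finset|exact: hk].

Qed.

Lemma measurable_floorE (f : T -> R) (c : int) :
  measurable_fun setT f -> measurable [set t | Num.floor (f t) = c].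
Proof.
move=> mf.
have -> : [set t | Num.floor (f t) = c] = f @^-1` `[c%:~R, (c + 1)%:~R[%classic.
  apply/seteqP; split => t /=; rewrite in_itv /=.
    by move=> <-; rewrite floor_le floorD1_gt.
  by move=> h; apply/eqP; rewrite floor_eq.
by rewrite -[X in measurable X]setTI; apply: mf => //; exact: measurable_itv.
Qed.

Lemma round_dist (r : R) (m : nat) : `|(Num.floor (r * m.+1%:R))%:~R / m.+1%:R - r| <= m.+1%:R^-1.
Proof.
have m0 : 0 < (m.+1%:R : R) by [].
have h1 := floor_le (r * m.+1%:R); have h2 := floorD1_gt (r * m.+1%:R).
have -> : (Num.floor (r * m.+1%:R))%:~R / m.+1%:R - r =
    ((Num.floor (r * m.+1%:R))%:~R - r * m.+1%:R) / m.+1%:R.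
  by rewrite mulrBl mulfK// gt_eqF.
rewrite normrM (gtr0_norm (_ : 0 < m.+1%:R^-1)) ?invr_gt0// ler_piMl ?invr_ge0 ?ler0n//.
rewrite ler_norml; move: h2; rewrite intrD; lra.
Qed.

(** Real and imaginary parts of each coordinate are rounded down to the grid of mesh [1 / (m + 1)]:
    [k m] is the integer label and [q m] the grid point. The rounded composites are measurable
    because the labels are discrete, and they converge pointwise because [u] is continuous. *)
Lemma cmeas_continuous n (u : 'cV[R[i]]_n -> R[i]) (p : T -> 'cV[R[i]]_n) :
  ccont u -> mxmeas p -> cmeas (fun t => u (p t)).
Proof.
move=> cu mp.
pose k m (t : T) : 'cV[int]_(n + n) :=
  col_mx (\col_i Num.floor (re (p t i 0) * m.+1%:R)) (\col_i Num.floor (im (p t i 0) * m.+1%:R)).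
pose q m (c : 'cV[int]_(n + n)) : 'cV[R[i]]_n :=
  \col_i Complex ((usubmx c i 0)%:~R / m.+1%:R) ((dsubmx c i 0)%:~R / m.+1%:R).
have hq m t i : normc (q m (k m t) i 0 - p t i 0) <= 2 / m.+1%:R.
  rewrite mxE col_mxKu col_mxKd !mxE; apply: le_trans (normc_le_reim _) _.
  rewrite !reimE /= mulrDl mul1r; apply: lerD; exact: round_dist.
have mk m (i : 'I_(n + n)) c : measurable [set t | k m t i 0 = c].
  case: (split_ordP i) => j ->; rewrite /k.
    under eq_set do rewrite col_mxEu mxE.
    by apply: measurable_floorE; apply: measurable_funM => //; exact: (mp j 0).1.
  under eq_set do rewrite col_mxEd mxE.
  by apply: measurable_floorE; apply: measurable_funM => //; exact: (mp j 0).2.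
have hcv t (eps : R) : 0 < eps -> \forall m \near \oo, normc (u (q m (k m t)) - u (p t)) < eps.
  move=> e0; have [del d0 hd] := cu (p t) eps e0.
  near=> m; apply: hd => i; apply: le_lt_trans (hq m t i) _.
  rewrite ltr_pdivrMr// -ltr_pdivrMl// mulrC.
  apply: lt_le_trans (_ : m%:R <= _); last by rewrite ler_nat.
  by near: m; exact: nbhs_infty_gtr.
split.
  apply: (@measurable_fun_cvg _ _ _ _ (fun m t => re (u (q m (k m t))))) => //.
    by move=> m; exact: (measurable_discrete (fun c => re (u (q m c))) (mk m)).
  move=> t _; apply/cvgrPdist_lt => eps e0; near=> m.
  rewrite distrC -reB; apply: le_lt_trans (abs_re_le _) _; near: m; exact: hcv.
apply: (@measurable_fun_cvg _ _ _ _ (fun m t => im (u (q m (k m t))))) => //.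
  by move=> m; exact: (measurable_discrete (fun c => im (u (q m c))) (mk m)).
move=> t _; apply/cvgrPdist_lt => eps e0; near=> m.
rewrite distrC -imB; apply: le_lt_trans (abs_im_le _) _; near: m; exact: hcv.
Unshelve. all: by end_near.
Qed.

End ComplexMeasurable.

Lemma cmeas_comp {R : realType} d1 d2 (T1 : measurableType d1) (T2 : measurableType d2)
  (p : T1 -> T2) (f : T2 -> R[i]) :
  measurable_fun setT p -> cmeas f -> cmeas (fun t => f (p t)).
Proof. by move=> mp [f1 f2]; split; [exact: measurableT_comp f1 mp|exact: measurableT_comp f2 mp]. Qed.

Lemma mxmeas_comp {R : realType} d1 d2 (T1 : measurableType d1) (T2 : measurableType d2)
  m q (p : T1 -> T2) (f : T2 -> 'M[R[i]]_(m, q)) :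
  measurable_fun setT p -> mxmeas f -> mxmeas (fun t => f (p t)).
Proof. by move=> mp hf i j; exact: (cmeas_comp mp (hf i j)). Qed.

(** * Complex-valued integrals and Fubini's theorem *)

Section ComplexIntegral.
Context {R : realType} {d} {T : measurableType d} (mu : {measure set T -> \bar R}).
Implicit Types (f g : T -> R[i]) (D : set T).

Definition cintegrable D f :=
  mu.-integrable D (fun t => (re (f t))%:E) /\ mu.-integrable D (fun t => (im (f t))%:E).

Definition cint D f : R[i] :=
  Complex (Rintegral mu D (fun t => re (f t))) (Rintegral mu D (fun t => im (f t))).

Lemma eq_cint D f g : (forall t, D t -> f t = g t) -> cint D f = cint D g.
Proof.
by move=> h; congr Complex; apply: eq_Rintegral => t /set_mem Dt; rewrite h.
Qed.

Lemma eq_cintegrable D f g : measurable D -> (forall t, D t -> f t = g t) ->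
  cintegrable D f -> cintegrable D g.
Proof.
move=> mD h [h1 h2]; split.
  by apply: eq_integrable h1 => // t /set_mem Dt; rewrite h.
by apply: eq_integrable h2 => // t /set_mem Dt; rewrite h.
Qed.

Lemma cintegrable_le D f (g : T -> R) : measurable D -> cmeas f ->
  mu.-integrable D (EFin \o g) -> (forall t, D t -> normc (f t) <= g t) -> cintegrable D f.
Proof.
move=> mD [f1 f2] ig h; split; apply: le_integrable ig => //=.
- by apply/measurable_EFinP; apply: measurable_funTS.
- move=> t Dt; rewrite lee_fin; apply: le_trans (abs_re_le _) _.
  by apply: le_trans (h t Dt) (ler_norm _).
- by apply/measurable_EFinP; apply: measurable_funTS.
- move=> t Dt; rewrite lee_fin; apply: le_trans (abs_im_le _) _.
  by apply: le_trans (h t Dt) (ler_norm _).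
Qed.

Lemma cintD D f g : measurable D -> cintegrable D f -> cintegrable D g ->
  cint D (fun t => f t + g t) = cint D f + cint D g.
Proof.
move=> mD [f1 f2] [g1 g2]; apply: complex_ext; rewrite /cint !reimE /=.
  by rewrite -RintegralD//; apply: eq_Rintegral => t _; rewrite reimE.
by rewrite -RintegralD//; apply: eq_Rintegral => t _; rewrite reimE.
Qed.

Lemma cintegrableZ D (c : R[i]) f : measurable D -> cintegrable D f ->
  cintegrable D (fun t => c * f t).
Proof.
move=> mD [f1 f2]; split.
  apply: eq_integrable (integrableB mD (integrableZl mD (re c) f1) (integrableZl mD (im c) f2)) => //.
  by move=> t _ /=; rewrite -!EFinM -EFinB reimE.
apply: eq_integrable (integrableD mD (integrableZl mD (re c) f2) (integrableZl mD (im c) f1)) => //.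
by move=> t _ /=; rewrite -!EFinM -EFinD reimE.
Qed.

Lemma cintZ D (c : R[i]) f : measurable D -> cintegrable D f ->
  cint D (fun t => c * f t) = c * cint D f.
Proof.
move=> mD [f1 f2]; apply: complex_ext; rewrite /cint !reimE /=.
  rewrite -!RintegralZl// -RintegralB//; first by apply: eq_Rintegral => t _; rewrite reimE.
  - by apply: eq_integrable (integrableZl mD (re c) f1) => // t _ /=; rewrite EFinM.
  - by apply: eq_integrable (integrableZl mD (im c) f2) => // t _ /=; rewrite EFinM.
rewrite -!RintegralZl// -RintegralD//; first by apply: eq_Rintegral => t _; rewrite reimE.
- by apply: eq_integrable (integrableZl mD (re c) f2) => // t _ /=; rewrite EFinM.
- by apply: eq_integrable (integrableZl mD (im c) f1) => // t _ /=; rewrite EFinM.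
Qed.

Lemma cintegrableD D f g : measurable D -> cintegrable D f -> cintegrable D g ->
  cintegrable D (fun t => f t + g t).
Proof.
move=> mD [f1 f2] [g1 g2]; split.
  by apply: eq_integrable (integrableD mD f1 g1) => // t _ /=; rewrite reimE.
by apply: eq_integrable (integrableD mD f2 g2) => // t _ /=; rewrite reimE.
Qed.

Lemma cintegrableN D f : measurable D -> cintegrable D f -> cintegrable D (fun t => - f t).
Proof.
move=> mD h; apply: eq_cintegrable (cintegrableZ (-1) mD h) => // t _.
by rewrite mulN1r.
Qed.

Lemma cintN D f : measurable D -> cintegrable D f -> cint D (fun t => - f t) = - cint D f.
Proof.
move=> mD h; rewrite -mulN1r -cintZ//; apply: eq_cint => t _; by rewrite mulN1r.
Qed.

Lemma cintB D f g : measurable D -> cintegrable D f -> cintegrable D g ->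
  cint D (fun t => f t - g t) = cint D f - cint D g.
Proof. by move=> mD hf hg; rewrite cintD ?cintN//; exact: cintegrableN. Qed.

Lemma normc_cint D f (g : T -> R) : measurable D -> cintegrable D f ->
  mu.-integrable D (EFin \o g) -> (forall t, D t -> normc (f t) <= g t) ->
  normc (cint D f) <= 2 * Rintegral mu D g.
Proof.
move=> mD [f1 f2] ig h; apply: le_trans (normc_le_reim _) _; rewrite mulr_natl mulr2n.
apply: lerD; rewrite /cint /=.
  apply: le_trans (le_normr_Rintegral mD f1) _; apply: le_Rintegral => //.
    exact: integrable_norm.
  by move=> t Dt; apply: le_trans (abs_re_le _) (h t Dt).
apply: le_trans (le_normr_Rintegral mD f2) _; apply: le_Rintegral => //.
  exact: integrable_norm.
by move=> t Dt; apply: le_trans (abs_im_le _) (h t Dt).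
Qed.

End ComplexIntegral.

(** Fubini is applied to real and imaginary parts, both dominated by the modulus. Integrability of
    every slice makes the inner integrals finite everywhere, so that taking [fine] inside loses
    nothing. *)
Lemma cfubini {R : realType} d1 d2 (T1 : measurableType d1) (T2 : measurableType d2)
  (m1 : {sigma_finite_measure set T1 -> \bar R}) (m2 : {sigma_finite_measure set T2 -> \bar R})
  (f : T1 -> T2 -> R[i]) :
  cmeas (fun p : T1 * T2 => f p.1 p.2) ->
  (\int[m1]_x \int[m2]_y (normc (f x y))%:E < +oo)%E ->
  (forall x, cintegrable m2 setT (f x)) -> (forall y, cintegrable m1 setT (f^~ y)) ->
  cint m1 setT (fun x => cint m2 setT (f x)) = cint m2 setT (fun y => cint m1 setT (f^~ y)).
Proof.
move=> mf foo ix iy.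
have key (h : R[i] -> R) : (forall z, `|h z| <= normc z) ->
    measurable_fun setT (fun p : T1 * T2 => h (f p.1 p.2)) ->
    (forall x, m2.-integrable setT (fun y => (h (f x y))%:E)) ->
    (forall y, m1.-integrable setT (fun x => (h (f x y))%:E)) ->
    Rintegral m1 setT (fun x => Rintegral m2 setT (fun y => h (f x y))) =
    Rintegral m2 setT (fun y => Rintegral m1 setT (fun x => h (f x y))).
  move=> hn mh hx hy; rewrite /Rintegral; congr fine.
  under eq_integral => x _ do rewrite fineK ?integrable_fin_num//.
  under [RHS]eq_integral => y _ do rewrite fineK ?integrable_fin_num//.
  apply: (@Fubini _ _ _ _ _ m1 m2 (fun p => (h (f p.1 p.2))%:E)).
  have mh' : measurable_fun setT (fun p : T1 * T2 => (h (f p.1 p.2))%:E) by exact/measurable_EFinP.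
  apply/(integrable12ltyP _ _ mh'); apply: le_lt_trans foo.
  have mn : measurable_fun setT (fun p : T1 * T2 => (normc (f p.1 p.2))%:E).
    exact: cmeas_normc_EFin mf.
  have ma : measurable_fun setT (fun p : T1 * T2 => (`|(h (f p.1 p.2))%:E|)%E).
    exact: measurableT_comp.
  apply: ge0_le_integral => //.
  - by move=> x _; apply: integral_ge0.
  - by apply: (@measurable_fun_fubini_tonelli_F _ _ _ _ _ m2 (fun p : T1 * T2 => (`|(h (f p.1 p.2))%:E|)%E)).
  - apply: (@measurable_fun_fubini_tonelli_F _ _ _ _ _ m2 (fun p : T1 * T2 => (normc (f p.1 p.2))%:E)) => //.
    by move=> p; rewrite lee_fin normc_ge0.
  - move=> x _; apply: ge0_le_integral => //.
    + by apply: (measurableT_comp ma (pair1_measurable x)).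
    + by apply: (measurableT_comp mn (pair1_measurable x)).
    + by move=> y _; rewrite abse_EFin lee_fin.
congr Complex.
  rewrite /cint /=; refine (key (fun z => re z) _ _ _ _) => [z|||]; first exact: abs_re_le.
  - exact: mf.1.
  - by move=> x; exact: (ix x).1.
  - by move=> y; exact: (iy y).1.
rewrite /cint /=; refine (key (fun z => im z) _ _ _ _) => [z|||]; first exact: abs_im_le.
- exact: mf.2.
- by move=> x; exact: (ix x).2.
- by move=> y; exact: (iy y).2.
Qed.

(* The library's canonical sigma-finite structure on [m1 \x m2] is only inferred
   for subprobabilities, hence this explicit packing. *)
Section ProductSigmaFinite.
Context d1 d2 (T1 : measurableType d1) (T2 : measurableType d2) (R : realType).
Variable m1 : {sigma_finite_measure set T1 -> \bar R}.
Variable m2 : {sigma_finite_measure set T2 -> \bar R}.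
Lemma sigma_finite_prod : sigma_finite setT (m1 \x m2)%E.
Proof.
have /sigma_finiteP[F [TF ndF Foo]] := sigma_finiteT m1.
have /sigma_finiteP[G [TG ndG Goo]] := sigma_finiteT m2.
exists (fun n => F n `*` G n).
  rewrite -setXTT TF TG; apply/seteqP; split=> -[x y].
    move=> [[n _ Fnx] [k _ Gky]]; exists (maxn n k) => //; split.
    - by move: (x) Fnx; exact/subsetPset/ndF/leq_maxl.
    - by move: (y) Gky; exact/subsetPset/ndG/leq_maxr.
  by move=> [n _ []/= ? ?]; split; exists n.
move=> k; have [mF fF] := Foo k; have [mG fG] := Goo k.
split; first exact: measurableX.
by rewrite product_measure1E// lte_mul_pinfty// ge0_fin_numE.
Qed.
Definition prod_sf : {sigma_finite_measure set (T1 * T2)%type -> \bar R} :=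
  HB.pack_for {sigma_finite_measure set (T1 * T2)%type -> \bar R} (product_measure1 m1 m2) 
   (Measure_isSigmaFinite.Build _ _ _ (product_measure1 m1 m2) sigma_finite_prod).
End ProductSigmaFinite.

(** * Nested integrals realized on a single measure space *)

Section IteratedIntegral.
Context {R : realType}.
Local Notation leb := (@lebesgue_measure R).

(* Measurability of a function of a sequence of complex variables, tested
   against every measurable family of sequences. *)
Definition umeas (f : (nat -> R[i]) -> \bar R) := forall d (X : measurableType d)
  (p : X -> nat -> R[i]), (forall j, cmeas (fun x => p x j)) ->
  measurable_fun setT (fun x => f (p x)).

(** An integrable weight on C that factors over the two real variables. Its products over the
    coordinates are the common dominating function for signed integrands. *)
Definition hat (z : R[i]) : R := ((1 + re z ^+ 2) * (1 + im z ^+ 2))^-1.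

Definition hatn n (w : nat -> R[i]) : R := \prod_(j < n) hat (w j).

(** The nested integral of depth [n] overwrites the entries below [n] of its starting sequence and
    keeps the others as parameters. *)
Definition splice n (a v : nat -> R[i]) : nat -> R[i] :=
  fun m => if (m < n)%N then a m else v m.

Lemma hat_ge0 z : 0 <= hat z.
Proof. by rewrite invr_ge0 mulr_ge0 ?addr_ge0 ?sqr_ge0. Qed.

Lemma hatn_ge0 n w : 0 <= hatn n w.
Proof. by apply: prodr_ge0 => i _; exact: hat_ge0. Qed.

Lemma meas_hat d (X : measurableType d) (p : X -> R[i]) : cmeas p ->
  measurable_fun setT (fun x => hat (p x)).
Proof.
move=> [p1 p2].
have -> : (fun x => hat (p x)) = (fun x => (oneDsqr (re (p x)))^-1 * (oneDsqr (im (p x)))^-1).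
  by apply/funext => x; rewrite /hat invfM.
have mo : measurable_fun setT (fun s : R => (oneDsqr s)^-1).
  by apply: continuous_measurable_fun; exact: continuous_oneDsqrV.
by apply: measurable_funM; [exact: measurableT_comp mo p1|exact: measurableT_comp mo p2].
Qed.

Lemma umeas_hatn n : umeas (fun w => (hatn n w)%:E).
Proof.
move=> d X p mp; apply/measurable_EFinP; rewrite /hatn.
by apply: measurable_prod => i _; exact: meas_hat.
Qed.

Lemma integral_oneDsqrV : (\int[leb]_s ((oneDsqr s)^-1)%:E)%E = pi%:E.
Proof.
rewrite ge0_symfun_integralT.
- rewrite (_ : [set x | _] = `[0, +oo[%classic); last first.
    by apply/seteqP; split => x/=; rewrite in_itv/= andbT.
  by rewrite integral0y_oneDsqr -EFinM; congr EFin; field.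
- by move=> x; rewrite invr_ge0 addr_ge0 ?sqr_ge0.
- exact: continuous_oneDsqrV.
- by move=> x /=; rewrite /oneDsqr sqrrN.
Qed.

Lemma integral_hat : (\int[leb \x leb]_q (hat (Complex q.1 q.2))%:E < +oo)%E.
Proof.
have mh : measurable_fun setT (fun q : R * R => (hat (Complex q.1 q.2))%:E).
  by apply/measurable_EFinP/meas_hat; split => /=; [exact: measurable_fst|exact: measurable_snd].
rewrite fubini_tonelli1//; last by move=> q; rewrite lee_fin hat_ge0.
rewrite /fubini_F /=.
under eq_integral => s _.
  under eq_integral => t _ do rewrite /hat /= invfM EFinM.
  rewrite ge0_integralZl_EFin//.
  - rewrite (_ : (\int[leb]_t _)%E = pi%:E); first over.
    exact: integral_oneDsqrV.
  - by move=> t _; rewrite lee_fin invr_ge0 addr_ge0 ?sqr_ge0.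
  - by apply/measurable_EFinP; apply: continuous_measurable_fun; exact: continuous_oneDsqrV.
  - by rewrite invr_ge0 addr_ge0 ?sqr_ge0.
under eq_integral do rewrite muleC.
rewrite ge0_integralZl_EFin//.
- by rewrite integral_oneDsqrV -EFinM ltry.
- by move=> t _; rewrite lee_fin invr_ge0 addr_ge0 ?sqr_ge0.
- by apply/measurable_EFinP; apply: continuous_measurable_fun; exact: continuous_oneDsqrV.
- exact: pi_ge0.
Qed.

(* A single measure space realizing the nested integrals [iint n], so that the
   theorems on one integral apply to them. *)
Record cspace n := CSpace {
  cs_d : measure_display;
  cs_T : measurableType cs_d;
  cs_mu : {sigma_finite_measure set cs_T -> \bar R};
  cs_e : cs_T -> nat -> R[i];
  cs_meas : forall j, cmeas (fun t => cs_e t j);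
  cs_pos : (0 < cs_mu setT)%E;
  cs_hat : (\int[cs_mu]_t (hatn n (cs_e t))%:E < +oo)%E;
  cs_iint : forall f v, (forall w, (0 <= f w)%E) -> umeas f ->
    iint n f v = (\int[cs_mu]_t f (splice n (cs_e t) v))%E;
  cs_iintR : forall (f : (nat -> R[i]) -> R) v K, umeas (fun w => (f w)%:E) ->
    (forall w, `|f w| <= K * hatn n w) ->
    iint n (fun w => (f w)%:E) v = (\int[cs_mu]_t (f (splice n (cs_e t) v))%:E)%E }.

(** With no variable left the nested integral is an evaluation, that is, integration against a Dirac
    mass. *)
Lemma cspace0 : inhabited (cspace 0).
Proof.
have h v (w : nat -> R[i]) : splice 0 w v = v by [].
constructor; apply: (@CSpace _ _ unit (dirac tt) (fun _ _ => 0)).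
- by move=> j; exact: cmeas_cst.
- by rewrite /= diracT lte01.
- by rewrite integral_dirac//= diracT mul1e ltry.
- by move=> f v f0 mf; rewrite /= integral_dirac//= ?diracT ?mul1e ?h//; exact: measurable_cst.
- by move=> f v K mf fK; rewrite /= integral_dirac//= ?diracT ?mul1e ?h//; exact: measurable_cst.
Qed.

Lemma hatnS n w : hatn n.+1 w = hatn n w * hat (w n).
Proof. by rewrite /hatn big_ord_recr. Qed.

Lemma eq_hatn n w w' : (forall j, (j < n)%N -> w j = w' j) -> hatn n w = hatn n w'.
Proof. by move=> h; apply: eq_bigr => j _; rewrite h. Qed.

(** [iint] integrates the entry [n] outermost, so the new variable becomes the first factor of a
    product measure. The two hypotheses comparing [lm] with [leb] say that [lm] realizes the double
    integral over one complex variable, for nonnegative and for integrable functions; Tonelli and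
    Fubini turn them into the last two fields of the record. *)
Lemma cspace_step n dS (S : measurableType dS) (lm : {sigma_finite_measure set S -> \bar R})
  (z : S -> R[i]) : cmeas z -> (0 < lm setT)%E -> (\int[lm]_q (hat (z q))%:E < +oo)%E ->
  (forall F : R[i] -> \bar R, (forall w, 0 <= F w)%E -> measurable_fun setT (F \o z) ->
    (\int[leb]_s \int[leb]_t F (Complex s t) = \int[lm]_q F (z q))%E) ->
  (forall F : R[i] -> \bar R, lm.-integrable setT (F \o z) ->
    (\int[leb]_s \int[leb]_t F (Complex s t) = \int[lm]_q F (z q))%E) ->
  cspace n -> inhabited (cspace n.+1).
Proof.
move=> mz lm0 lmh hz hzR [d T mu e me mu0 hfin hi hiR]; constructor.
pose e' (p : S * T) j := if j == n then z p.1 else e p.2 j.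
have me' j : cmeas (fun p => e' p j).
  rewrite /e'; case: eqP => _; first exact: cmeas_comp measurable_fst mz.
  exact: cmeas_comp measurable_snd (me j).
have msplice v j : cmeas (fun p => splice n.+1 (e' p) v j).
  by rewrite /splice; case: (j < n.+1)%N; [exact: me'|exact: cmeas_cst].
have pe q t v : splice n.+1 (e' (q, t)) v = splice n (e t) (upd v n (z q)).
  apply/funext => m; rewrite /splice /e' /upd /= ltnS leq_eqVlt.
  by case: eqP => [->|]; rewrite ?ltnn//=.
have hatE q t : hatn n.+1 (e' (q, t)) = hatn n (e t) * hat (z q).
  rewrite hatnS; congr (_ * _); last by rewrite /e' eqxx.
  apply: eq_hatn => j jn.
  by rewrite /e' /= ltn_eqF.
have mhat : measurable_fun setT (fun p => (hatn n.+1 (e' p))%:E) by exact: umeas_hatn.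
have hfin' : (\int[lm \x mu]_p (hatn n.+1 (e' p))%:E < +oo)%E.
  rewrite fubini_tonelli1//; last by move=> p; rewrite lee_fin hatn_ge0.
  rewrite /fubini_F /=.
  have hf : (\int[mu]_t (hatn n (e t))%:E)%E \is a fin_num.
    by rewrite ge0_fin_numE//; apply: integral_ge0 => t _; rewrite lee_fin hatn_ge0.
  under eq_integral => q _.
    under eq_integral => t _ do rewrite hatE mulrC EFinM.
    rewrite ge0_integralZl_EFin ?hat_ge0//; last 2 first.
    - by move=> t _; rewrite lee_fin hatn_ge0.
    - by apply: umeas_hatn.
    rewrite -(fineK hf) muleC; over.
  rewrite ge0_integralZl_EFin//.
  - by apply: lte_mul_pinfty; rewrite ?lee_fin ?fine_ge0//; apply: integral_ge0 => t _; rewrite lee_fin hatn_ge0.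
  - by move=> t _; rewrite lee_fin hat_ge0.
  - by apply/measurable_EFinP/meas_hat.
  - by apply: fine_ge0; apply: integral_ge0 => t _; rewrite lee_fin hatn_ge0.
refine (@CSpace n.+1 _ _ (prod_sf lm mu) e' me' _ _ _ _).
- rewrite -setXTT (_ : prod_sf lm mu _ = lm setT * mu setT)%E ?mule_gt0//.
  exact: product_measure1E.
- exact: hfin'.
- move=> f v f0 mf.
  have mf' : measurable_fun setT (fun p => f (splice n.+1 (e' p) v)) by exact: mf.
  have FE : fubini_F mu (fun p => f (splice n.+1 (e' p) v)) =
      fun q => iint n f (upd v n (z q)).
    by apply/funext => q; rewrite /fubini_F hi//; apply: eq_integral => t _; rewrite pe.
  have mF : measurable_fun setT (fun q => iint n f (upd v n (z q))).
    rewrite -FE; exact: (measurable_fun_fubini_tonelli_F (m2 := mu) _ mf' (fun p => f0 _)).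
  rewrite [RHS](fubini_tonelli1 _ mf')// FE.
  apply: (hz (fun w => iint n f (upd v n w))); last exact: mF.
  by move=> w; rewrite hi//; exact: integral_ge0.
- move=> f v K mf fK.
  have mf' : measurable_fun setT (fun p => (f (splice n.+1 (e' p) v))%:E) by exact: (mf _ _ _ (msplice v)).
  (* At a fixed value of the new variable the inner integral needs a bound by [hatn n], so the
     additional factor [hat] is dropped. *)
  have hat1 a : hat a <= 1.
    rewrite /hat invf_le1 ?mulr_gt0 ?ltr_pwDl ?sqr_ge0//.
    have := sqr_ge0 (re a); have := sqr_ge0 (im a); nra.
  have fK' w : `|f w| <= `|K| * hatn n w.
    apply: le_trans (fK w) _; apply: le_trans (ler_wpM2r (hatn_ge0 _ _) (ler_norm K)) _.
    by rewrite hatnS mulrA ler_piMr// mulr_ge0// hatn_ge0.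
  have if' : (lm \x mu)%E.-integrable setT (fun p => (f (splice n.+1 (e' p) v))%:E).
    have ih : (lm \x mu)%E.-integrable setT (fun p => (hatn n.+1 (e' p))%:E).
      apply/integrableP; split => //.
      by under eq_integral do rewrite gee0_abs ?lee_fin ?hatn_ge0//.
    apply: le_integrable (integrableZl _ `|K| ih) => //= p _.
    rewrite lee_fin; apply: le_trans (fK _) _.
    rewrite (@eq_hatn _ _ (e' p)); last by move=> j jn; rewrite /splice jn.
    by rewrite normrM normr_id (ger0_norm (hatn_ge0 _ _)) ler_wpM2r ?hatn_ge0 ?ler_norm.
  have FE : fubini_F mu (fun p => (f (splice n.+1 (e' p) v))%:E) =
      fun q => iint n (fun w => (f w)%:E) (upd v n (z q)).
    apply/funext => q; rewrite /fubini_F (hiR _ _ `|K|)//.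
    by apply: eq_integral => t _; rewrite pe.
  have iF := integrable_fubini_F if'.
  rewrite -(integral12_prod_meas1 if') FE.
  by apply: (hzR (fun w => iint n (fun w => (f w)%:E) (upd v n w))); rewrite FE in iF.
Qed.

Lemma cspaceS n : cspace n -> inhabited (cspace n.+1).
Proof.
apply: (@cspace_step n _ _ (prod_sf leb leb) (fun q => Complex q.1 q.2)).
- by split => /=; [exact: measurable_fst|exact: measurable_snd].
- rewrite -setXTT (_ : prod_sf leb leb _ = leb setT * leb setT)%E; last exact: product_measure1E.
  by rewrite -set_itvNyy mule_gt0// lebesgue_measure_itv /= ltry.
- exact: integral_hat.
- move=> F F0 mF; apply: esym.
  exact: (@fubini_tonelli1 _ _ _ _ _ leb leb (fun q => F (Complex q.1 q.2)) mF (fun q => F0 _)).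
- by move=> F iF; exact: (@integral12_prod_meas1 _ _ _ _ _ leb leb (fun q => F (Complex q.1 q.2)) iF).
Qed.

Lemma cspace_ex n : inhabited (cspace n).
Proof. by elim: n => [|n [X]]; [exact: cspace0|exact: cspaceS X]. Qed.

End IteratedIntegral.

(** * Translations, shears and rotations of planar integrals *)

Section Invariance.
Context {R : realType}.
Local Notation leb := (@lebesgue_measure R).
Local Notation mR := (measurableTypeR R).

(** The image of Lebesgue measure under the translation has the right value on half-open intervals,
    hence is Lebesgue measure by uniqueness. *)
Lemma ge0_integral_translation (g : mR -> \bar R) (a : R) :
  (forall s, 0 <= g s)%E -> measurable_fun setT g ->
  (\int[leb]_s g (s + a)%R = \int[leb]_s g s)%E.
Proof.
move=> g0 mg.
have ms : measurable_fun setT (fun s : mR => (s + a : mR)).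
  by apply: measurable_funD => //; exact: measurable_cst.
have h := ge0_integral_pushforward ms leb (D := setT) (f := g) measurableT mg (fun s _ => g0 s).
rewrite preimage_setT in h; rewrite -[LHS]h; apply: eq_measure_integral => A mA _.
rewrite -lebesgue_measure_unique//.
move=> X [[x y] /= _ <-]; rewrite /pushforward.
have -> : (fun s : R => s + a) @^-1` `]x, y]%classic = `]x - a, y - a]%classic.
  by apply/seteqP; split => s /=; rewrite !in_itv /= ltrBlDr lerBrDr.
by rewrite !lebesgue_measure_itv /= !lte_fin ltrD2r; case: ifP => // _; rewrite -!EFinB; congr EFin; ring.
Qed.

Definition cumeas (G : R[i] -> \bar R) := forall d (X : measurableType d)
  (p : X -> R[i]), cmeas p -> measurable_fun setT (fun x => G (p x)).

Lemma ge0_iint2_shear_im (G : R[i] -> \bar R) (b : R) : (forall z, 0 <= G z)%E -> cumeas G ->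
  (\int[leb]_s \int[leb]_t G (Complex s (t + b * s)%R) =
   \int[leb]_s \int[leb]_t G (Complex s t))%E.
Proof.
move=> G0 mG; apply: eq_integral => s _.
apply: (@ge0_integral_translation (fun t => G (Complex s t))) => //.
by apply: mG; split => //=; exact: measurable_cst.
Qed.

Lemma cmeas_pair : cmeas (fun q : mR * mR => Complex q.1 q.2).
Proof. by split => /=; [exact: measurable_fst|exact: measurable_snd]. Qed.

Lemma ge0_iint2_swap (G : R[i] -> \bar R) : (forall z, 0 <= G z)%E -> cumeas G ->
  (\int[leb]_s \int[leb]_t G (Complex s t) = \int[leb]_t \int[leb]_s G (Complex s t))%E.
Proof.
move=> G0 mG.
exact: (@fubini_tonelli _ _ _ _ _ leb leb (fun q => G (Complex q.1 q.2)) (mG _ _ _ cmeas_pair) (fun q => G0 _)).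
Qed.

Lemma ge0_iint2_shear_re (G : R[i] -> \bar R) (b : R) : (forall z, 0 <= G z)%E -> cumeas G ->
  (\int[leb]_s \int[leb]_t G (Complex (s + b * t)%R t) =
   \int[leb]_s \int[leb]_t G (Complex s t))%E.
Proof.
move=> G0 mG.
pose H z := G (Complex (re z + b * im z) (im z)).
have mH : cumeas H.
  move=> d X p [p1 p2]; apply: mG; split => //=.
  by apply: measurable_funD => //; apply: measurable_funM => //; exact: measurable_cst.
have H0 z : (0 <= H z)%E by exact: G0.
apply: etrans (ge0_iint2_swap H0 mH) _; apply: etrans (esym (ge0_iint2_swap G0 mG)).
apply: eq_integral => t _; rewrite /H /=.
apply: (@ge0_integral_translation (fun s => G (Complex s t))) => //.
by apply: mG; split => //=; exact: measurable_cst.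
Qed.

(* A rotation of the plane other than -1 is a product of three shears. *)
Lemma ge0_iint2_rotation (G : R[i] -> \bar R) (c : R[i]) : (forall z, 0 <= G z)%E -> cumeas G ->
  sqmod c = 1 ->
  (\int[leb]_s \int[leb]_t G (c * Complex s t)%R = \int[leb]_s \int[leb]_t G (Complex s t))%E.
Proof.
move=> G0 mG c1.
have main (H : R[i] -> \bar R) (e : R[i]) : (forall z, 0 <= H z)%E -> cumeas H ->
    sqmod e = 1 -> re e != -1 ->
    (\int[leb]_s \int[leb]_t H (e * Complex s t)%R = \int[leb]_s \int[leb]_t H (Complex s t))%E.
  move=> H0 mH; case: e => a b; rewrite /sqmod /= => ab1 aN1.
  have a1 : 1 + a != 0 by apply: contra aN1 => /eqP h; apply/eqP; lra.
  (* The tangent of half the rotation angle; the three shears have parameters [- tau], [b] and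
     [- tau]. *)
  pose tau := b / (1 + a).
  have tb : tau * b = 1 - a.
    have b2 : b * b = 1 - a ^+ 2 by move: ab1; rewrite expr2; lra.
    by rewrite /tau mulrAC b2; field.
  have ta : tau * (1 + a) = b by rewrite /tau; field.
  pose H1 z := H (Complex (re z + (- tau) * im z) (im z)).
  pose H2 z := H1 (Complex (re z) (im z + b * re z)).
  have mH1 : cumeas H1.
    move=> d X p [p1 p2]; apply: mH; split => //=.
    by apply: measurable_funD => //; apply: measurable_funM => //; exact: measurable_cst.
  have mH2 : cumeas H2.
    move=> d X p [p1 p2]; apply: mH1; split => //=.
    by apply: measurable_funD => //; apply: measurable_funM => //; exact: measurable_cst.
  have H10 z : (0 <= H1 z)%E by exact: H0.
  have H20 z : (0 <= H2 z)%E by exact: H10.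
  apply: etrans (ge0_iint2_shear_re (- tau) H0 mH).
  apply: etrans (ge0_iint2_shear_im b H10 mH1).
  apply: etrans (ge0_iint2_shear_re (- tau) H20 mH2).
  apply: eq_integral => s _; apply: eq_integral => t _.
  rewrite /H2 /H1 /=; congr H; apply: complex_ext; rewrite !reimE /=.
    have -> : s + - tau * t + - tau * (t + b * (s + - tau * t)) =
      s * (1 - tau * b) - t * (tau * (1 + (1 - tau * b))) by ring.
    have e : 1 - (1 - a) = a by ring.
    by rewrite tb e ta; ring.
  have -> : t + b * (s + - tau * t) = t * (1 - tau * b) + b * s by ring.
  by rewrite tb; ring.
(* Real part -1 forces the half turn, which is done as two quarter turns by [iC]. *)
have [cN1|] := eqVneq (re c) (-1); last exact: main.
have ic : im c = 0.
  move: c1; rewrite /sqmod cN1 sqrrN expr1n => h; apply/eqP; rewrite -sqrf_eq0; apply/eqP; lra.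
have cE : c = iC R * iC R by rewrite iC_sqr; apply: complex_ext; rewrite ?cN1 ?ic ?reimE /= ?oppr0.
have i1 : sqmod (iC R) = 1 by rewrite /sqmod /= expr0n expr1n add0r.
have iN : re (iC R) != -1 by rewrite /= eq_sym oppr_eq0 oner_eq0.
pose H z := G (iC R * z).
have mH : cumeas H by move=> d X p mp; apply: mG; apply: cmeasM => //; exact: cmeas_cst.
have H0 z : (0 <= H z)%E by exact: G0.
apply: etrans (main G (iC R) G0 mG i1 iN); apply: etrans (main H (iC R) H0 mH i1 iN).
by apply: eq_integral => s _; apply: eq_integral => t _; rewrite /H cE mulrA.
Qed.

End Invariance.

(** * Integration over C^n and its invariances *)

Section VectorIntegral.
Context {R : realType}.
Local Notation leb := (@lebesgue_measure R).

Lemma iint_ge0 n (f : (nat -> R[i]) -> \bar R) v :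
  (forall w, 0 <= f w)%E -> (0 <= iint n f v)%E.
Proof.
elim: n v => [|n IH] v f0 //=.
by apply: integral_ge0 => s _; apply: integral_ge0 => t _; exact: IH.
Qed.

Lemma umeas_iint n (f : (nat -> R[i]) -> \bar R) : (forall w, 0 <= f w)%E -> umeas f ->
  umeas (iint n f).
Proof.
move=> f0 mf d X p mp; have [[d' T mu e me mu0 hfin hi hiR]] := @cspace_ex R n.
have -> : (fun x => iint n f (p x)) = fubini_F mu (fun q : X * T => f (splice n (e q.2) (p q.1))).
  by apply/funext => x; rewrite hi.
apply: (@measurable_fun_fubini_tonelli_F _ _ _ _ _ mu) => //.
apply: mf => j; rewrite /splice; case: (j < n)%N.
  exact: cmeas_comp measurable_snd (me j).
exact: cmeas_comp measurable_fst (mp j).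
Qed.

Lemma cmeas_upd d (X : measurableType d) (p : X -> nat -> R[i]) (z : X -> R[i]) n :
  (forall j, cmeas (fun x => p x j)) -> cmeas z -> forall j, cmeas (fun x => upd (p x) n (z x) j).
Proof. by move=> mp mz j; rewrite /upd; case: (j == n). Qed.

(** Shifting the parameter sequence as well makes the induction close: the entry being integrated
    outside reaches the inner integral through that sequence. *)
Lemma iint_translation n (f : (nat -> R[i]) -> \bar R) (a v : nat -> R[i]) :
  (forall w, 0 <= f w)%E -> umeas f ->
  iint n (fun w => f (fun j => w j + a j)) v = iint n f (fun j => v j + a j).
Proof.
move=> f0 mf; elim: n v => [//|n IH] v /=.
pose G (z : R[i]) := iint n f (upd (fun j => v j + a j) n z).
have mG : cumeas G.
  move=> d X p mp; apply: umeas_iint => //.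
  by apply: cmeas_upd => // j; exact: cmeas_cst.
have G0 z : (0 <= G z)%E by exact: iint_ge0.
have -> : (\int[leb]_s \int[leb]_t iint n f (upd (fun j => v j + a j)%R n (Complex s t)) =
  \int[leb]_s \int[leb]_t G (Complex s t))%E by [].
rewrite -(@ge0_integral_translation _ (fun s => (\int[leb]_t G (Complex s t))%E) (re (a n))).
- apply: eq_integral => s _.
  rewrite -(@ge0_integral_translation _ (fun t => G (Complex (s + re (a n)) t)) (im (a n)))//.
    apply: eq_integral => t _; rewrite IH /G; congr iint; apply/funext => j; rewrite /upd.
    by case: eqP => // ->; case: (a n).
  by apply: mG; split => //=; exact: measurable_cst.
- by move=> s; exact: integral_ge0.
- apply: (@measurable_fun_fubini_tonelli_F _ _ _ _ _ leb (fun q => G (Complex q.1 q.2))) => //.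
  exact: mG cmeas_pair.
Qed.

Lemma iint_rotation n (f : (nat -> R[i]) -> \bar R) (c : R[i]) (v : nat -> R[i]) :
  (forall w, 0 <= f w)%E -> umeas f -> sqmod c = 1 ->
  iint n (fun w => f (fun j => c * w j)) v = iint n f (fun j => c * v j).
Proof.
move=> f0 mf c1; elim: n v => [//|n IH] v /=.
pose G (z : R[i]) := iint n f (upd (fun j => c * v j) n z).
have mG : cumeas G.
  move=> d X p mp; apply: umeas_iint => //.
  by apply: cmeas_upd => // j; exact: cmeas_cst.
have G0 z : (0 <= G z)%E by exact: iint_ge0.
rewrite -[RHS](ge0_iint2_rotation G0 mG c1).
apply: eq_integral => s _; apply: eq_integral => t _; rewrite IH /G; congr iint.
by apply/funext => j; rewrite /upd; case: eqP.
Qed.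

Definition vmeas n (F : 'cV[R[i]]_n -> \bar R) := forall d (X : measurableType d)
  (p : X -> 'cV[R[i]]_n), mxmeas p -> measurable_fun setT (fun x => F (p x)).

Definition vec n (w : nat -> R[i]) : 'cV[R[i]]_n := \col_(j < n) w j.

Lemma umeas_vec n (F : 'cV[R[i]]_n -> \bar R) : vmeas F -> umeas (fun w => F (vec n w)).
Proof.
move=> mF d X p mp; apply: mF => i j; apply: cmeas_ext (mp i) => x.
by rewrite mxE.
Qed.

Definition cs_pt n (X : @cspace R n) (t : cs_T X) : 'cV[R[i]]_n := vec n (cs_e t).

Section Space.
Context n (X : @cspace R n).
Local Notation mu := (cs_mu X).
Local Notation pt := (@cs_pt n X).

Lemma mxmeas_pt : mxmeas pt.
Proof. by move=> i j; apply: cmeas_ext (cs_meas X i) => x; rewrite mxE. Qed.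

Lemma vec_splice (a v : nat -> R[i]) : vec n (splice n a v) = vec n a.
Proof. by apply/matrixP => i j; rewrite !mxE /splice ltn_ord. Qed.

Lemma intCnE (F : 'cV[R[i]]_n -> \bar R) : (forall x, 0 <= F x)%E -> vmeas F ->
  intCn F = (\int[mu]_t F (pt t))%E.
Proof.
move=> F0 mF; rewrite /intCn (cs_iint X)//; last exact: umeas_vec.
by apply: eq_integral => t _; congr F; exact: vec_splice.
Qed.

Definition vhat (x : 'cV[R[i]]_n) : R := \prod_(j < n) hat (x j 0).

Lemma vhat_ge0 x : 0 <= vhat x.
Proof. by apply: prodr_ge0 => i _; exact: hat_ge0. Qed.

Lemma meas_vhat d (Y : measurableType d) (p : Y -> 'cV[R[i]]_n) : mxmeas p ->
  measurable_fun setT (fun y => vhat (p y)).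
Proof. by move=> mp; apply: measurable_prod => i _; apply: meas_hat; exact: mp. Qed.

Lemma vhat_vec w : vhat (vec n w) = hatn n w.
Proof. by apply: eq_bigr => j _; rewrite mxE. Qed.

Lemma integrable_vhat : mu.-integrable setT (fun t => (vhat (pt t))%:E).
Proof.
apply/integrableP; split; first by apply/measurable_EFinP; apply: meas_vhat; exact: mxmeas_pt.
under eq_integral do rewrite gee0_abs ?lee_fin ?vhat_ge0// vhat_vec.
exact: cs_hat.
Qed.

Lemma intCnRE (f : 'cV[R[i]]_n -> R) (K : R) : vmeas (fun x => (f x)%:E) ->
  (forall x, `|f x| <= K * vhat x) ->
  intCn (fun x => (f x)%:E) = (\int[mu]_t (f (pt t))%:E)%E.
Proof.
move=> mf fK; rewrite /intCn (@cs_iintR _ _ X (fun w => f (vec n w)) _ K).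
- by apply: eq_integral => t _; congr ((f _)%:E); exact: vec_splice.
- exact: umeas_vec mf.
- by move=> w; rewrite -vhat_vec; exact: fK.
Qed.

Lemma vint_translation (F : 'cV[R[i]]_n -> \bar R) (a : 'cV[R[i]]_n) :
  (forall x, 0 <= F x)%E -> vmeas F ->
  (\int[mu]_t F (pt t + a)%R = \int[mu]_t F (pt t))%E.
Proof.
move=> F0 mF.
(* Continuation of the vector by 0 to a sequence; [vec n] never reads the entries from [n] on. *)
pose a' (j : nat) := if insub j is Some i then a i 0 else 0.
have aE w : vec n w + a = vec n (fun j => w j + a' j).
  by apply/matrixP => i j; rewrite !mxE /a' valK ord1.
have mFa : vmeas (fun x => F (x + a)).
  by move=> d Y p mp; apply: mF; apply: mxmeasD => //; exact: mxmeas_cst.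
rewrite -intCnE// -(intCnE _ mFa)//.
transitivity (iint n (fun w => F (vec n (fun j => w j + a' j))) (fun=> 0)).
  by rewrite /intCn; congr iint; apply/funext => w; rewrite -aE.
rewrite (@iint_translation n (fun w => F (vec n w)))//; last exact: umeas_vec.
have h v := @cs_iint _ _ X (fun w => F (vec n w)) v (fun w => F0 _) (umeas_vec mF).
by rewrite /intCn !h; apply: eq_integral => t _; rewrite !vec_splice.
Qed.

Lemma vint_rotation (F : 'cV[R[i]]_n -> \bar R) (c : R[i]) :
  (forall x, 0 <= F x)%E -> vmeas F -> sqmod c = 1 ->
  (\int[mu]_t F (c *: pt t)%R = \int[mu]_t F (pt t))%E.
Proof.
move=> F0 mF c1.
have aE w : c *: vec n w = vec n (fun j => c * w j).
  by apply/matrixP => i j; rewrite !mxE.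
have mFa : vmeas (fun x => F (c *: x)).
  by move=> d Y p mp; apply: mF; apply: mxmeasZ => //; exact: cmeas_cst.
rewrite -intCnE// -(intCnE _ mFa)//.
transitivity (iint n (fun w => F (vec n (fun j => c * w j))) (fun=> 0)).
  by rewrite /intCn; congr iint; apply/funext => w; rewrite -aE.
rewrite (@iint_rotation n (fun w => F (vec n w)))//; last exact: umeas_vec.
have h v := @cs_iint _ _ X (fun w => F (vec n w)) v (fun w => F0 _) (umeas_vec mF).
by rewrite /intCn !h; apply: eq_integral => t _; rewrite !vec_splice.
Qed.

Definition vcmeas (g : 'cV[R[i]]_n -> R[i]) := forall d (Y : measurableType d)
  (p : Y -> 'cV[R[i]]_n), mxmeas p -> cmeas (fun y => g (p y)).

Lemma vcmeas_re g : vcmeas g -> vmeas (fun x => (re (g x))%:E).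
Proof. by move=> mg d Y p mp; apply/measurable_EFinP; exact: (mg _ _ _ mp).1. Qed.
Lemma vcmeas_im g : vcmeas g -> vmeas (fun x => (im (g x))%:E).
Proof. by move=> mg d Y p mp; apply/measurable_EFinP; exact: (mg _ _ _ mp).2. Qed.

(** The bridge from the nested integrals in the definitions to [cint]. The domination is there
    because a signed nested integral reduces to [mu] through Fubini. *)
Lemma cintCnE g (K : R) : vcmeas g -> (forall x, normc (g x) <= K * vhat x) ->
  cintCn g = cint mu setT (fun t => g (pt t)).
Proof.
move=> mg gK; rewrite /cintCn /cint; congr Complex; rewrite /Rintegral.
  rewrite (@intCnRE (fun x => re (g x)) K)//; first exact: vcmeas_re.
  by move=> x; apply: le_trans (abs_re_le _) _.
rewrite (@intCnRE (fun x => im (g x)) K)//; first exact: vcmeas_im.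
by move=> x; apply: le_trans (abs_im_le _) _.
Qed.

(** Invariance on nonnegative functions is applied to the positive and to the negative part, so [f]
    may fail to be integrable. *)
Lemma vint_invariant (G : 'cV[R[i]]_n -> 'cV[R[i]]_n) (f : 'cV[R[i]]_n -> R) :
  (forall F : 'cV[R[i]]_n -> \bar R, (forall x, 0 <= F x)%E -> vmeas F ->
     \int[mu]_t F (G (pt t)) = \int[mu]_t F (pt t))%E ->
  vmeas (fun x => (f x)%:E) ->
  (\int[mu]_t (f (G (pt t)))%:E = \int[mu]_t (f (pt t))%:E)%E.
Proof.
move=> hG mf; rewrite integralE [RHS]integralE; congr (_ - _)%E.
  under eq_integral do rewrite funeposE; under [RHS]eq_integral do rewrite funeposE.
  apply: (hG (fun x => maxe (f x)%:E 0%E)) => [x|d Y p mp]; first by rewrite le_max lexx orbT.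
  by apply: measurable_maxe; [exact: mf mp|exact: measurable_cst].
under eq_integral do rewrite funenegE; under [RHS]eq_integral do rewrite funenegE.
apply: (hG (fun x => maxe (- (f x)%:E)%E 0%E)) => [x|d Y p mp]; first by rewrite le_max lexx orbT.
by apply: measurable_maxe; [apply: measurableT_comp => //; exact: mf mp|exact: measurable_cst].
Qed.

Lemma cint_invariant (G : 'cV[R[i]]_n -> 'cV[R[i]]_n) (g : 'cV[R[i]]_n -> R[i]) :
  (forall F : 'cV[R[i]]_n -> \bar R, (forall x, 0 <= F x)%E -> vmeas F ->
     \int[mu]_t F (G (pt t)) = \int[mu]_t F (pt t))%E ->
  vcmeas g -> cint mu setT (fun t => g (G (pt t))) = cint mu setT (fun t => g (pt t)).
Proof.
move=> hG mg; congr Complex; rewrite /Rintegral; congr fine.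
  by apply: (@vint_invariant G (fun x => re (g x))) => //; exact: vcmeas_re.
by apply: (@vint_invariant G (fun x => im (g x))) => //; exact: vcmeas_im.
Qed.

Lemma cint_translation (g : 'cV[R[i]]_n -> R[i]) (a : 'cV[R[i]]_n) : vcmeas g ->
  cint mu setT (fun t => g (pt t + a)) = cint mu setT (fun t => g (pt t)).
Proof. by apply: (@cint_invariant (fun x => x + a)) => F; exact: vint_translation. Qed.

Lemma cint_rotation (g : 'cV[R[i]]_n -> R[i]) (c : R[i]) : vcmeas g -> sqmod c = 1 ->
  cint mu setT (fun t => g (c *: pt t)) = cint mu setT (fun t => g (pt t)).
Proof.
move=> mg c1; apply: (@cint_invariant (fun x => c *: x)) => // F F0 mF.
exact: vint_rotation.
Qed.

End Space.
End VectorIntegral.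

(** * Goursat's theorem on rectangles *)

Section Goursat.
Context {R : realType}.
Local Notation leb := (@lebesgue_measure R).

Definition cdiff (f : R[i] -> R[i]) (z : R[i]) := exists c : R[i], forall eps : R, 0 < eps ->
  exists2 del : R, 0 < del & forall w : R[i], normc (w - z) < del ->
    normc (f w - f z - c * (w - z)) <= eps * normc (w - z).

Lemma cdiff_cont f z : cdiff f z -> forall eps : R, 0 < eps ->
  exists2 del : R, 0 < del & forall w : R[i], normc (w - z) < del -> normc (f w - f z) < eps.
Proof.
move=> [c hc] eps e0; have [del d0 hd] := hc 1 ltr01.
have c0 := normc_ge0 c.
have c1 : 0 < 1 + normc c by lra.
exists (Num.min del (eps / (1 + normc c))); first by rewrite lt_min d0 divr_gt0.
move=> w; rewrite lt_min => /andP[h1 h2].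
have -> : f w - f z = (f w - f z - c * (w - z)) + c * (w - z) by ring.
apply: le_lt_trans (normcD _ _) _; rewrite normcM.
rewrite ltr_pdivlMr// in h2; have := hd w h1; lra.
Qed.

Lemma cdiff_comp f g z : cdiff g z -> cdiff f (g z) -> cdiff (fun w => f (g w)) z.
Proof.
move=> dg [c hc]; have [b hb] := dg; exists (c * b) => eps e0.
have b0 := normc_ge0 b; have c0 := normc_ge0 c.
have B : 0 < 1 + normc b by lra.
have C : 0 < 1 + normc c by lra.
have e2 : 0 < eps / 2 by rewrite divr_gt0.
have [d1 d10 h1] := hc (eps / 2 / (1 + normc b)) (divr_gt0 e2 B).
have [d2 d20 h2] := cdiff_cont dg d10.
have [d3 d30 h3] := hb (eps / 2 / (1 + normc c)) (divr_gt0 e2 C).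
have [d4 d40 h4] := hb 1 ltr01.
exists (Num.min (Num.min d2 d3) d4); first by rewrite !lt_min d20 d30 d40.
move=> w; rewrite !lt_min => /andP[/andP[w2 w3] w4].
have -> : f (g w) - f (g z) - c * b * (w - z) =
  (f (g w) - f (g z) - c * (g w - g z)) + c * (g w - g z - b * (w - z)) by ring.
apply: le_trans (normcD _ _) _; rewrite normcM.
have e1 := h1 (g w) (h2 w w2); have e3 := h3 w w3; have e4 := h4 w w4.
have e5 : normc (g w - g z) <= (1 + normc b) * normc (w - z).
  have -> : g w - g z = (g w - g z - b * (w - z)) + b * (w - z) by ring.
  by apply: le_trans (normcD _ _) _; rewrite normcM; lra.
have t0 := normc_ge0 (w - z).
have k1 : eps / 2 / (1 + normc b) * normc (g w - g z) <= eps / 2 * normc (w - z).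
  apply: le_trans (ler_wpM2l _ e5) _; first by rewrite !divr_ge0// ltW.
  by rewrite mulrA mulfVK ?gt_eqF.
have k2 : normc c * normc (g w - g z - b * (w - z)) <= eps / 2 * normc (w - z).
  apply: le_trans (ler_wpM2l c0 e3) _.
  rewrite mulrA ler_wpM2r// (_ : _ * (eps / 2 / _) = normc c * (eps / 2) / (1 + normc c)); last by rewrite mulrA.
  by rewrite ler_pdivrMr//; nra.
lra.
Qed.

Lemma cdiff_cexp z : cdiff (@cexp R) z.
Proof.
exists (cexp z) => eps e0.
pose E := expR (re z).
have E0 : 0 < E by exact: expR_gt0.
have e1 : 1 <= expR (1 : R) by have := expR_ge1Dx (1 : R); lra.
pose M := E * 5 * expR 1.
have M0 : 0 < M by rewrite /M !mulr_gt0// expR_gt0.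
exists (Num.min 1 (eps / M)); first by rewrite lt_min ltr01 divr_gt0.
move=> w; rewrite lt_min => /andP[h1 h2].
have -> : cexp w - cexp z - cexp z * (w - z) = cexp z * (cexp (w - z) - 1 - (w - z)).
  have e : cexp w = cexp z * cexp (w - z) by rewrite -cexpD; congr cexp; ring.
  by rewrite {1}e; ring.
rewrite normcM normc_cexp -/E.
have t0 := normc_ge0 (w - z).
apply: le_trans (ler_wpM2l (ltW E0) (cexp_sub1B_le _)) _.
have h3 : expR (normc (w - z)) <= expR 1 by rewrite ler_expR ltW.
rewrite ltr_pdivlMr// in h2.
have h4 : E * (5 * normc (w - z) ^+ 2 * expR (normc (w - z))) <= M * normc (w - z) ^+ 2.
  have -> : M * normc (w - z) ^+ 2 = E * (5 * normc (w - z) ^+ 2 * expR 1) by rewrite /M; ring.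
  by apply: ler_wpM2l (ltW E0) _ _ _; apply: ler_wpM2l; rewrite ?mulr_ge0 ?sqr_ge0.
apply: le_trans h4 _; rewrite expr2 mulrA ler_wpM2r// mulrC; exact: ltW.
Qed.

Lemma nested_intervals (a l : nat -> R) : (forall k, a k <= a k.+1) ->
  (forall k, a k.+1 + l k.+1 <= a k + l k) -> (forall k, 0 <= l k) ->
  exists x, forall k, a k <= x <= a k + l k.
Proof.
move=> ha hal hl.
have am j k : (j <= k)%N -> a j <= a k by exact: (@homo_leq _ a _ (@lexx _ _) (@le_trans _ _)).
have bm j k : (j <= k)%N -> a k + l k <= a j + l j.
  move=> jk; apply: (@homo_leq _ (fun k => a k + l k) (fun x y => y <= x)) => //=.
  by move=> x y z h1 h2; exact: le_trans h2 h1.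
have ub j k : a j <= a k + l k.
  case: (leqP j k) => jk; first by rewrite (le_trans (am _ _ jk))// lerDl.
  by rewrite (le_trans _ (bm _ _ (ltnW jk)))// lerDl.
exists (sup (range a)) => k; apply/andP; split.
  by apply: ub_le_sup; [exists (a 0 + l 0) => _ [j _ <-]|exists k].
by apply: ge_sup => [|_ [j _ <-]//]; exists (a 0); exists 0.
Qed.

Lemma dist_in_itv (x h s t : R) : x <= s <= x + h -> x <= t <= x + h -> `|s - t| <= h.
Proof. by move=> /andP[? ?] /andP[? ?]; rewrite ler_norml; apply/andP; split; lra. Qed.

Lemma le_sum4 (x a b c d : R) : x <= a + b + (c + d) ->
  [\/ x <= 4 * a, x <= 4 * b | x <= 4 * c \/ x <= 4 * d].
Proof.
move=> h; have [h1|h1] := leP x (4 * a); first by constructor 1.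
have [h2|h2] := leP x (4 * b); first by constructor 2.
constructor 3; have [h3|h3] := leP x (4 * c); [by left|right; lra].
Qed.

Lemma exists_half_lt (x e : R) : 0 <= x -> 0 < e -> exists k : nat, x / 2 ^+ k < e.
Proof.
move=> x0 e0; exists (Num.bound (x / e)).
have p0 : 0 < (2 : R) ^+ (Num.bound (x / e)) by rewrite exprn_gt0.
rewrite ltr_pdivrMr// -ltr_pdivrMl// mulrC.
apply: lt_trans (archi_boundP (divr_ge0 x0 (ltW e0))) _.
by rewrite -natrX ltr_nat ltn_expl.
Qed.

Definition rcont (g : R -> R[i]) :=
  continuous (fun s => re (g s)) /\ continuous (fun s => im (g s)).

Lemma rcontP g : (forall s (eps : R), 0 < eps ->
    exists2 del : R, 0 < del & forall t, `|t - s| < del -> normc (g t - g s) < eps) -> rcont g.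
Proof.
move=> h; split=> s; apply/cvgrPdist_lt => eps e0; have [del d0 hd] := h s eps e0;
  apply/nbhs_ballP; exists del => // t; rewrite /ball /= => st.
  rewrite -reB; apply: le_lt_trans (abs_re_le _) _; rewrite normcB.
  by apply: hd; rewrite distrC.
rewrite -imB; apply: le_lt_trans (abs_im_le _) _; rewrite normcB.
by apply: hd; rewrite distrC.
Qed.

Local Notation cI a b g := (cint leb `[a, b]%classic g).

Lemma rcont_integrable g (a b : R) : rcont g -> cintegrable leb `[a, b]%classic g.
Proof.
move=> [g1 g2]; split; apply: continuous_compact_integrable; try exact: segment_compact.
  exact: continuous_subspaceT.
exact: continuous_subspaceT.
Qed.

Lemma cI_split g (a b c : R) : rcont g -> a <= b -> b <= c -> cI a c g = cI a b g + cI b c g.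
Proof.
move=> hg ab bc; have [h1 h2] := rcont_integrable a c hg; have [k1 k2] := rcont_integrable b c hg.
apply: complex_ext; rewrite reimE /=.
  apply/eqP; rewrite addrC -subr_eq; apply/eqP.
  rewrite Rintegral_itvB//; rewrite ?bnd_simp// Rintegral_itv_obnd_cbnd//.
  by apply: integrableS k1 => //; apply: subset_itvr; rewrite bnd_simp.
apply/eqP; rewrite addrC -subr_eq; apply/eqP.
rewrite Rintegral_itvB//; rewrite ?bnd_simp// Rintegral_itv_obnd_cbnd//.
by apply: integrableS k2 => //; apply: subset_itvr; rewrite bnd_simp.
Qed.

Lemma integrable_cst_itv (a b x : R) : leb.-integrable `[a, b]%classic (fun=> x%:E).
Proof.
apply: continuous_compact_integrable; first exact: segment_compact.
by apply: continuous_subspaceT => y; exact: cvg_cst.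
Qed.

Lemma Rintegral_itv_cst (a b r : R) : a <= b ->
  Rintegral leb `[a, b]%classic (fun=> r) = r * (b - a).
Proof.
move=> ab; transitivity (r * fine (lebesgue_measure `[a, b]%classic)).
  exact: Rintegral_cst.
rewrite lebesgue_measure_itv /= lte_fin.
case: ltP => h; first by rewrite -EFinB.
by rewrite (_ : a = b) ?subrr//; apply/eqP; rewrite eq_le ab.
Qed.

Lemma cI_cst (a b : R) z : a <= b -> cI a b (fun=> z) = z * Complex (b - a) 0.
Proof.
move=> ab; apply: complex_ext; rewrite reimE [RHS]/=; apply: etrans (Rintegral_itv_cst _ ab) _.
  by ring.
by ring.
Qed.

Lemma rcont_cst z : rcont (fun=> z).
Proof. by split=> s; exact: cvg_cst. Qed.

(** The factor 2 is that of [normc_cint], which estimates real and imaginary parts separately. *)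
Lemma cI_near_cst g (a b : R) z M : rcont g -> a <= b ->
  (forall s, a <= s <= b -> normc (g s - z) <= M) ->
  normc (cI a b g - z * Complex (b - a) 0) <= 2 * (M * (b - a)).
Proof.
move=> hg ab h.
have ig := rcont_integrable a b hg; have ic := rcont_integrable a b (rcont_cst z).
rewrite -cI_cst// -cintB//.
have -> : M * (b - a) = Rintegral leb `[a, b]%classic (fun=> M).
  by rewrite Rintegral_itv_cst.
apply: normc_cint => //.
- apply: cintegrableD => //; exact: cintegrableN.
- exact: integrable_cst_itv.
Qed.

Variable G : R[i] -> R[i].
Hypothesis dG : forall z, cdiff G z.

Lemma rcont_horizontal (t : R) : rcont (fun s => G (Complex s t)).
Proof.
apply: rcontP => s eps e0; have [del d0 hd] := cdiff_cont (dG (Complex s t)) e0.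
exists del => // s' h; apply: hd.
by rewrite (_ : Complex s' t - Complex s t = Complex (s' - s) 0) ?normcR//; apply: complex_ext; rewrite reimE /= ?subrr.
Qed.

Lemma rcont_vertical (s : R) : rcont (fun t => G (Complex s t)).
Proof.
apply: rcontP => t eps e0; have [del d0 hd] := cdiff_cont (dG (Complex s t)) e0.
exists del => // t' h; apply: hd.
rewrite (_ : Complex s t' - Complex s t = iC R * Complex (t' - t) 0); last first.
  by apply: complex_ext; rewrite !reimE /=; ring.
by rewrite normcM normcR (_ : normc (iC R) = 1) ?mul1r// /= expr0n expr1n add0r sqrtr1.
Qed.

Lemma rcontB g h : rcont g -> rcont h -> rcont (fun s => g s - h s).
Proof.
move=> [g1 g2] [h1 h2]; split=> s.
  by rewrite (_ : (fun s => re _) = (fun s => re (g s) - re (h s))); [exact: cvgB (g1 s) (h1 s)|apply/funext => x; rewrite reB].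
by rewrite (_ : (fun s => im _) = (fun s => im (g s) - im (h s))); [exact: cvgB (g2 s) (h2 s)|apply/funext => x; rewrite imB].
Qed.

(* The integral of [G] along the boundary of the rectangle [a,b] x [c,d], with
   opposite sides grouped. *)
Definition rect_int (a b c d : R) : R[i] :=
  cI a b (fun s => G (Complex s c) - G (Complex s d)) +
  iC R * cI c d (fun t => G (Complex b t) - G (Complex a t)).

Lemma rect_hcont (c d : R) : rcont (fun s => G (Complex s c) - G (Complex s d)).
Proof. exact: rcontB (rcont_horizontal c) (rcont_horizontal d). Qed.

Lemma rect_vcont (a b : R) : rcont (fun t => G (Complex b t) - G (Complex a t)).
Proof. exact: rcontB (rcont_vertical b) (rcont_vertical a). Qed.

Lemma rect_int_hsplit (a m b c d : R) : a <= m -> m <= b -> c <= d ->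
  rect_int a b c d = rect_int a m c d + rect_int m b c d.
Proof.
move=> am mb cd; rewrite /rect_int (cI_split (rect_hcont c d) am mb).
have -> : cI c d (fun t => G (Complex b t) - G (Complex a t)) =
  cI c d (fun t => G (Complex m t) - G (Complex a t)) + cI c d (fun t => G (Complex b t) - G (Complex m t)).
  rewrite -cintD//; try exact: (rcont_integrable _ _ (rect_vcont _ _)).
  by apply: eq_cint => t _; ring.
ring.
Qed.

Lemma rect_int_vsplit (a b c m d : R) : c <= m -> m <= d -> a <= b ->
  rect_int a b c d = rect_int a b c m + rect_int a b m d.
Proof.
move=> cm md ab; rewrite /rect_int (cI_split (rect_vcont a b) cm md).
have -> : cI a b (fun s => G (Complex s c) - G (Complex s d)) =
  cI a b (fun s => G (Complex s c) - G (Complex s m)) + cI a b (fun s => G (Complex s m) - G (Complex s d)).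
  rewrite -cintD//; try exact: (rcont_integrable _ _ (rect_hcont _ _)).
  by apply: eq_cint => t _; ring.
ring.
Qed.

(** The affine part [G z + q (w - z)] has zero boundary integral, its contributions from horizontal
    and vertical sides cancelling. Only the remainder is left, at most [eps] times half the
    perimeter at each point. *)
Lemma rect_int_small (z q : R[i]) (eps a b c d : R) : 0 <= eps -> a <= re z <= b -> c <= im z <= d ->
  (forall w, a <= re w <= b -> c <= im w <= d ->
     normc (G w - G z - q * (w - z)) <= eps * normc (w - z)) ->
  normc (rect_int a b c d) <= 4 * eps * ((b - a) + (d - c)) ^+ 2.
Proof.
move=> e0 /andP[az zb] /andP[cz zd] h.
have ab : a <= b by lra.
have cd : c <= d by lra.
pose M := eps * ((b - a) + (d - c)).
have hM w : a <= re w <= b -> c <= im w <= d -> normc (G w - G z - q * (w - z)) <= M.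
  move=> w1 w2; apply: le_trans (h w w1 w2) _; apply: ler_wpM2l => //.
  apply: le_trans (normc_le_reim _) _; rewrite !reimE.
  move: w1 w2 => /andP[? ?] /andP[? ?].
  by apply: lerD; rewrite ler_norml; apply/andP; split; lra.
have i1 : normc (iC R) = 1 by rewrite /= expr0n expr1n add0r sqrtr1.
(* The reference constants are the increments of the affine part between opposite sides; [2 * M]
   collects the remainders on the two sides. *)
have H1 := @cI_near_cst _ a b (- (iC R) * q * Complex (d - c) 0) (2 * M) (rect_hcont c d) ab _.
have H2 := @cI_near_cst _ c d (q * Complex (b - a) 0) (2 * M) (rect_vcont a b) cd _.
have -> : rect_int a b c d =
  (cI a b (fun s => G (Complex s c) - G (Complex s d)) - (- (iC R) * q * Complex (d - c) 0) * Complex (b - a) 0) +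
  iC R * (cI c d (fun t => G (Complex b t) - G (Complex a t)) - (q * Complex (b - a) 0) * Complex (d - c) 0).
  by rewrite /rect_int; ring.
apply: le_trans (normcD _ _) _; rewrite normcM i1 mul1r.
have -> : 4 * eps * ((b - a) + (d - c)) ^+ 2 = 2 * (2 * M * (b - a)) + 2 * (2 * M * (d - c)).
  by rewrite /M; ring.
apply: lerD; [apply: H1|apply: H2] => s hs.
  have e : Complex s c - Complex s d = - (iC R) * Complex (d - c) 0.
    by apply: complex_ext; rewrite !reimE /=; ring.
  have -> : G (Complex s c) - G (Complex s d) - - iC R * q * Complex (d - c) 0 =
    (G (Complex s c) - G z - q * (Complex s c - z)) - (G (Complex s d) - G z - q * (Complex s d - z)).
    have -> : - iC R * q * Complex (d - c) 0 = q * (- (iC R) * Complex (d - c) 0) by ring.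
    by rewrite -e; ring.
  apply: le_trans (normcD _ _) _; rewrite normc_opp mulr_natl mulr2n.
  by apply: lerD; apply: hM => //=; lra.
have e : Complex b s - Complex a s = Complex (b - a) 0.
  by apply: complex_ext; rewrite !reimE /=; ring.
have -> : G (Complex b s) - G (Complex a s) - q * Complex (b - a) 0 =
  (G (Complex b s) - G z - q * (Complex b s - z)) - (G (Complex a s) - G z - q * (Complex a s - z)).
  by rewrite -e; ring.
apply: le_trans (normcD _ _) _; rewrite normc_opp mulr_natl mulr2n.
by apply: lerD; apply: hM => //=; lra.
Qed.

(** Bisection: some quarter carries at least a quarter of the boundary integral. The nested quarters
    shrink to a point [z], where differentiability bounds the integral by [4 eps (L / 2^k)^2], and
    the accumulated factor [4^k] is exactly compensated. *)
Theorem goursat_rect (a b c d : R) : a <= b -> c <= d -> rect_int a b c d = 0.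
Proof.
move=> ab cd.
pose h k := (b - a) / 2 ^+ k; pose v k := (d - c) / 2 ^+ k.
have h0 k : 0 <= h k by rewrite divr_ge0 ?exprn_ge0// subr_ge0.
have v0 k : 0 <= v k by rewrite divr_ge0 ?exprn_ge0// subr_ge0.
have hS k : h k = 2 * h k.+1 by rewrite /h exprS; field; rewrite expf_neq0.
have vS k : v k = 2 * v k.+1 by rewrite /v exprS; field; rewrite expf_neq0.
pose D k (p : R * R) := normc (rect_int p.1 (p.1 + h k) p.2 (p.2 + v k)).
(* [p] is the lower left corner of a rectangle with sides [h k] and [v k]. *)
have step k p : exists p' : R * R, [/\ p.1 <= p'.1, p'.1 + h k.+1 <= p.1 + h k,
    p.2 <= p'.2, p'.2 + v k.+1 <= p.2 + v k & D k p <= 4 * D k.+1 p'].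
  case: p => x y; pose x' := x + h k.+1; pose y' := y + v k.+1.
  have hx := h0 k.+1; have hy := v0 k.+1; have eh := hS k; have ev := vS k.
  have Dle : D k (x, y) <= D k.+1 (x, y) + D k.+1 (x, y') + (D k.+1 (x', y) + D k.+1 (x', y')).
    have x1 : x <= x' by rewrite /x'; lra.
    have x2 : x' <= x + h k by rewrite /x'; lra.
    have y1 : y <= y' by rewrite /y'; lra.
    have y2 : y' <= y + v k by rewrite /y'; lra.
    have ex : x' + h k.+1 = x + h k by rewrite /x' eh; ring.
    have ey : y' + v k.+1 = y + v k by rewrite /y' ev; ring.
    change (normc (rect_int x (x + h k) y (y + v k)) <=
      normc (rect_int x x' y y') + normc (rect_int x x' y' (y' + v k.+1)) +
      (normc (rect_int x' (x' + h k.+1) y y') + normc (rect_int x' (x' + h k.+1) y' (y' + v k.+1)))).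
    rewrite (rect_int_hsplit x1 x2 (le_trans y1 y2)).
    rewrite (rect_int_vsplit y1 y2 x1) (rect_int_vsplit y1 y2 x2) ex ey.
    by apply: le_trans (normcD _ _) (lerD (normcD _ _) (normcD _ _)).
  have x1 : x <= x' by rewrite lerDl.
  have y1 : y <= y' by rewrite lerDl.
  have x2 : x' <= x + h k by rewrite lerD2l eh mulr_natl mulr2n lerDl.
  have y2 : y' <= y + v k by rewrite lerD2l ev mulr_natl mulr2n lerDl.
  have ex : x' + h k.+1 = x + h k by rewrite -addrA eh mulr_natl mulr2n.
  have ey : y' + v k.+1 = y + v k by rewrite -addrA ev mulr_natl mulr2n.
  have [||] := le_sum4 Dle.
  - by exists (x, y); split.
  - by exists (x, y'); split=> //=; rewrite ey.
  - by case=> ?; [exists (x', y)|exists (x', y')]; split=> //=; rewrite ?ex ?ey.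
pose nx k p := sval (cid (step k p)).
have nxP k p := svalP (cid (step k p)).
pose P := fix P k := if k is k'.+1 then nx k' (P k') else (a, c).
have PP k : [/\ (P k).1 <= (P k.+1).1, (P k.+1).1 + h k.+1 <= (P k).1 + h k,
    (P k).2 <= (P k.+1).2, (P k.+1).2 + v k.+1 <= (P k).2 + v k & D k (P k) <= 4 * D k.+1 (P k.+1)].
  exact: nxP.
have D0 k : D 0 (a, c) <= 4 ^+ k * D k (P k).
  elim: k => [|k IH]; first by rewrite mul1r.
  apply: le_trans IH _; rewrite exprSr -mulrA ler_wpM2l ?exprn_ge0//.
  by case: (PP k).
have [al hal] : exists x, forall k, (P k).1 <= x <= (P k).1 + h k.
  by apply: nested_intervals => // k; case: (PP k).
have [be hbe] : exists x, forall k, (P k).2 <= x <= (P k).2 + v k.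
  by apply: nested_intervals => // k; case: (PP k).
pose z := Complex al be; pose L := (b - a) + (d - c).
have L0 : 0 <= L by rewrite /L; lra.
have D0E : D 0 (a, c) = normc (rect_int a b c d).
  have e1 : a + h 0 = b by rewrite /h divr1 addrC subrK.
  have e2 : c + v 0 = d by rewrite /v divr1 addrC subrK.
  by rewrite -[in RHS]e1 -[in RHS]e2.
have [q hq] := dG z.
have small eps : 0 < eps -> normc (rect_int a b c d) <= 4 * eps * L ^+ 2.
  move=> e0; have [del d0 hd] := hq eps e0.
  have [k hk] := exists_half_lt L0 d0.
  have hvk : h k + v k = L / 2 ^+ k by rewrite /h /v /L; ring.
  rewrite -D0E; apply: le_trans (D0 k) _.
  have := @rect_int_small z q eps (P k).1 ((P k).1 + h k) (P k).2 ((P k).2 + v k) (ltW e0) (hal k) (hbe k) _.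
  move=> /(_ _)/le_trans-H; rewrite mulrC -ler_pdivlMr ?exprn_gt0//; apply: H => [w w1 w2|].
    apply: hd; apply: le_lt_trans (normc_le_reim _) _; apply: le_lt_trans hk; rewrite -hvk !reimE /=.
    exact: lerD (dist_in_itv w1 (hal k)) (dist_in_itv w2 (hbe k)).
  have -> : (P k).1 + h k - (P k).1 + ((P k).2 + v k - (P k).2) = L / 2 ^+ k by rewrite -hvk; ring.
  have e4 : (L / 2 ^+ k) ^+ 2 = L ^+ 2 / 4 ^+ k.
    by rewrite expr_div_n -exprM mulnC exprM (_ : 2 ^+ 2 = 4)// -natrX.
  by rewrite e4 mulrA.
apply/eqP; rewrite -normc_eq0 eq_le normc_ge0 andbT; apply/ler_addgt0Pl => e e0; rewrite addr0.
(* The added 1 covers the degenerate rectangle, for which [L] is 0. *)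
have L1 : 0 < 4 * (L ^+ 2 + 1) by have := sqr_ge0 L; lra.
apply: le_trans (small _ (divr_gt0 e0 L1)) _.
have -> : 4 * (e / (4 * (L ^+ 2 + 1))) * L ^+ 2 = e * (4 * L ^+ 2) / (4 * (L ^+ 2 + 1)).
  by field; rewrite gt_eqF//; have := sqr_ge0 L; lra.
by rewrite ler_pdivrMr// ler_wpM2l ?ltW//; lra.
Qed.

End Goursat.

(** * The mean value property over circles *)

Section MeanValue.
Context {R : realType}.
Local Notation leb := (@lebesgue_measure R).

Lemma cexp_2pi (z : R[i]) : cexp (z + Complex 0 (2 * pi)) = cexp z.
Proof.
rewrite cexpD (_ : cexp (Complex 0 (2 * pi)) = 1) ?mulr1//.
apply: complex_ext; rewrite /cexp /= expR0 mul1r mulr_natl.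
  by rewrite cos2pi.
by rewrite sin2pi.
Qed.

(** Logarithmic coordinates: [f] composed with the exponential is entire with period [2 i pi]. On
    the rectangle [[s, 0] x [0, 2 pi]] the horizontal sides cancel by periodicity, so the circle
    integral is the same for the radii 1 and [exp s]; letting [s] tend to minus infinity leaves
    [f 0]. *)
Theorem mean_value (f : R[i] -> R[i]) : (forall z, cdiff f z) ->
  cint leb `[0, 2 * pi]%classic (fun t => f (cexp (Complex 0 t))) = f 0 * Complex (2 * pi) 0.
Proof.
move=> df; pose G z := f (cexp z).
have dG z : cdiff G z by apply: cdiff_comp => //; exact: cdiff_cexp.
have pi0 : 0 <= 2 * (pi : R) by rewrite mulr_ge0// pi_ge0.
have radius s : s <= 0 -> cint leb `[0, 2 * pi]%classic (fun t => G (Complex 0 t)) =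
    cint leb `[0, 2 * pi]%classic (fun t => G (Complex s t)).
  move=> s0.
  have h0 : cint leb `[s, 0]%classic (fun t => G (Complex t 0) - G (Complex t (2 * pi))) = 0.
    rewrite -[RHS](mul0r (Complex (0 - s) 0)) -cI_cst//; apply: eq_cint => t _.
    have := cexp_2pi (Complex t 0).
    rewrite (_ : Complex t 0 + Complex 0 (2 * pi) = Complex t (2 * pi)).
      by rewrite /G => ->; rewrite subrr.
    by apply: complex_ext; rewrite reimE /=; ring.
  have := goursat_rect dG s0 pi0; rewrite /rect_int.
  rewrite h0 add0r.
  have i0 : iC R != 0 by rewrite eq_complex /= oner_eq0 andbF.
  move=> e; have := mulfI i0 (etrans e (esym (mulr0 _))).
  have ri v := rcont_integrable 0 (2 * pi) (rcont_vertical dG v).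
  rewrite cintB; [by move/subr0_eq|exact: measurable_itv|exact: ri|exact: ri].
apply/eqP; rewrite -subr_eq0 -normc_eq0 eq_le normc_ge0 andbT; apply/ler_addgt0Pl => e e0; rewrite addr0.
have E0 : 0 < 2 * (2 * pi + 1) :> R by lra.
have [del d0 hd] := cdiff_cont (df 0) (divr_gt0 e0 E0).
(* Since [exp t > t] at [t = 1 / del], the radius [exp s] is below [del]. *)
pose s := - del^-1.
have s0 : s <= 0 by rewrite oppr_le0 invr_ge0 ltW.
have es : expR s < del.
  rewrite expRN -[ltRHS]invrK ltf_pV2 ?posrE ?expR_gt0 ?invr_gt0//.
  by have := expR_ge1Dx del^-1; lra.
rewrite [X in normc (X - _)](radius s s0).
have := @cI_near_cst R (fun t => G (Complex s t)) 0 (2 * pi) (f 0) (e / (2 * (2 * pi + 1)))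
  (rcont_vertical dG s) pi0.
rewrite subr0 => /(_ _)/le_trans; apply.
  move=> t _; apply/ltW/hd; rewrite subr0 normc_cexp //=.
rewrite (_ : 2 * _ = e * (2 * (2 * pi)) / (2 * (2 * pi + 1))); last by ring.
by rewrite ler_pdivrMr// ler_wpM2l ?ltW//; lra.
Qed.

End MeanValue.

(** * Holomorphy in several variables in explicit form *)

Section Holomorphic.
Context {R : realType}.
Local Notation K := (R[i] : numFieldType).

Lemma gt0_complexE (e : R[i]) : 0 < e -> e = Complex (re e) 0 /\ 0 < re e.
Proof. by case: e => a b; rewrite ltcE /= => /andP[/eqP -> ->]. Qed.

(** The norm of the normed module of column vectors takes its values in [R[i]]; this norm is
    real-valued and equivalent to it. *)
Definition l1 n (h : 'cV[R[i]]_n) : R := \sum_i normc (h i 0).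

Lemma l1_ge0 n (h : 'cV[R[i]]_n) : 0 <= l1 h.
Proof. by apply: sumr_ge0 => i _; exact: normc_ge0. Qed.

Lemma normc_le_l1 n (h : 'cV[R[i]]_n) i : normc (h i 0) <= l1 h.
Proof. by rewrite /l1 (bigD1 i)//= lerDl sumr_ge0// => j _; exact: normc_ge0. Qed.

Lemma l1_le n (h : 'cV[R[i]]_n) (r : R) : (forall i, normc (h i 0) <= r) -> l1 h <= n%:R * r.
Proof.
move=> hr; rewrite -[n in n%:R]card_ord -sumr_const mulr_suml; apply: ler_sum => i _.
by rewrite mul1r.
Qed.

Lemma mx_norm_le_l1 n (h : 'cV[K]_n) : `|h| <= Complex (l1 h) 0 :> K.
Proof.
rewrite /Num.norm /=; have [->|/mx_norm_neq0[[i j] /= ->]] := eqVneq (mx_norm h) 0.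
  by rewrite lecE /= eqxx l1_ge0.
by rewrite (ord1 j) normr_normc lecE /= eqxx normc_le_l1.
Qed.

Lemma l1_le_mx_norm n (h : 'cV[K]_n) : Complex (l1 h) 0 <= n%:R * `|h| :> K.
Proof.
have hi i : Complex (normc (h i 0)) 0 <= `|h| :> K.
  rewrite -normr_normc [leRHS]/Num.norm /= mx_normE -[leLHS]nngE num_le.
  exact: (le_bigmax _ (fun ij : 'I_n * 'I_1 => `|h ij.1 ij.2|%:nng) (i, 0)).
have -> : Complex (l1 h) 0 = \sum_i (Complex (normc (h i 0)) 0 : K).
  by apply: complex_ext; rewrite ?re_sum ?im_sum //= big1.
rewrite -[n in n%:R]card_ord -sumr_const mulr_suml; apply: ler_sum => i _.
by rewrite mul1r.
Qed.

(** The differential in epsilon-delta form with real norms. The complex homogeneity of [D] is what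
    gives complex differentiability along lines. *)
Lemma holomorphic_expand n (u : 'cV[R[i]]_n -> R[i]) (x : 'cV[R[i]]_n) : holomorphic u ->
  exists2 D : 'cV[R[i]]_n -> R[i], (forall (c : R[i]) h, D (c *: h) = c * D h) /\ (forall h k, D (h + k) = D h + D k) &
   forall eps : R, 0 < eps -> exists2 del : R, 0 < del & forall h : 'cV[R[i]]_n, (forall i, normc (h i 0) < del) ->
   normc (u (x + h) - u x - D h) <= eps * l1 h.
Proof.
move=> /(_ x) /diff_locallyP [dc /eqaddoP hd].
exists ('d (u : 'cV[K]_n -> K^o) (x : 'cV[K]_n)).
  by split=> [c h|h k]; [exact: linearZ|exact: linearD].
move=> eps e0.
have e0' : 0 < (Complex eps 0 : K) by rewrite ltcE /= eqxx.
have /nbhs_ballP[del d0 h1] := hd _ e0'.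
have [dE d0'] := gt0_complexE d0.
exists (re del) => // h hh.
have /h1 : ball (0 : 'cV[K]_n) del h.
  rewrite mx_norm_ball /ball_ /= sub0r normrN /Num.norm /=.
  have [->//|/mx_norm_neq0[[i j] /= ->]] := eqVneq (mx_norm h) 0.
  by rewrite (ord1 j) normr_normc dE ltcE /= eqxx /=.
rewrite /= => h2.
have : Complex (normc (u (x + h) - u x - 'd (u : 'cV[K]_n -> K^o) (x : 'cV[K]_n) h)) 0 <= Complex eps 0 * Complex (l1 h) 0 :> K.
  apply: le_trans (ler_wpM2l (ltW e0') (mx_norm_le_l1 h)); rewrite -normr_normc.
  have -> : x + h = (h : 'cV[K]_n) + x by exact: addrC.
  by rewrite -addrA -opprD.
by rewrite lecE /= => /andP[_]; rewrite !mul0r subr0.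
Qed.

Lemma holomorphic_ccont n (u : 'cV[R[i]]_n -> R[i]) : holomorphic u -> ccont u.
Proof.
move=> hu x eps e0; have [D [DZ DD] hD] := holomorphic_expand x hu.
have D0 : D 0 = 0 by rewrite -(scale0r 0) DZ mul0r.
have DE h : D h = \sum_i h i 0 * D (delta_mx i 0).
  rewrite {1}(_ : h = \sum_i h i 0 *: delta_mx i 0); last first.
    rewrite {1}[h]matrix_sum_delta; apply: eq_bigr => i _.
    by rewrite big_ord1.
  elim/big_ind2 : _ => [|a b c d <- <-|i _]; first exact: D0.
    exact: DD.
  exact: DZ.
pose M := \sum_i normc (D (delta_mx i 0)).
have M0 : 0 <= M by apply: sumr_ge0 => i _; exact: normc_ge0.
have Dle h : normc (D h) <= M * l1 h.
  rewrite DE; apply: le_trans (normc_sum _ _ _) _; rewrite /M mulr_suml; apply: ler_sum => i _.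
  by rewrite normcM mulrC ler_wpM2l ?normc_ge0// normc_le_l1.
have [del d0 hd] := hD 1 ltr01.
have n0 : 0 <= (n%:R : R) by [].
have E : 0 < (1 + M) * (n%:R + 1) by rewrite mulr_gt0//; lra.
pose r := Num.min del (eps / ((1 + M) * (n%:R + 1))).
have r0 : 0 < r by rewrite lt_min d0 divr_gt0.
have r1 : r <= del by rewrite ge_min lexx.
have r2 : r * ((1 + M) * (n%:R + 1)) <= eps by rewrite -ler_pdivlMr// ge_min lexx orbT.
exists r => // y hy.
have [h -> {y hy} hh] : exists2 h : 'cV[R[i]]_n, y = x + h & forall i, normc (h i 0) < r.
  by exists (y - x) => [|i]; [rewrite addrC subrK|have := hy i; rewrite !mxE].
have h1 : normc (u (x + h) - u x - D h) <= 1 * l1 h.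
  by apply: hd => i; apply: lt_le_trans (hh i) r1.
have -> : u (x + h) - u x = (u (x + h) - u x - D h) + D h by ring.
apply: le_lt_trans (normcD _ _) _.
have h2 := l1_le (fun i => ltW (hh i)); have h3 := Dle h; have h4 := l1_ge0 h.
have h5 : (1 + M) * l1 h <= (1 + M) * (n%:R * r) by rewrite ler_wpM2l//; lra.
nra.
Qed.

Lemma holomorphic_line n (u : 'cV[R[i]]_n -> R[i]) (x w : 'cV[R[i]]_n) : holomorphic u ->
  forall tau, cdiff (fun tau => u (x + tau *: w)) tau.
Proof.
move=> hu tau; have [D [DZ DD] hD] := holomorphic_expand (x + tau *: w) hu.
exists (D w) => eps e0.
have L0 := l1_ge0 w.
have L1 : 0 < 1 + l1 w by lra.
have [del d0 hd] := hD _ (divr_gt0 e0 L1).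
exists (del / (1 + l1 w)); first by rewrite divr_gt0.
move=> s hs; have := hd ((s - tau) *: w) _.
have -> : x + tau *: w + (s - tau) *: w = x + s *: w by rewrite -addrA -scalerDl addrC (addrC tau) subrK addrC.
rewrite DZ (mulrC (s - tau)) => /(_ _)/le_trans; apply.
  move=> i; rewrite mxE normcM; move: hs; rewrite ltr_pdivlMr// => hs.
  apply: le_lt_trans hs; apply: ler_wpM2l; first exact: normc_ge0.
  by have := normc_le_l1 w i; lra.
have -> : l1 ((s - tau) *: w) = normc (s - tau) * l1 w.
  by rewrite /l1 mulr_sumr; apply: eq_bigr => i _; rewrite mxE normcM.
rewrite mulrCA mulrC ler_wpM2r ?normc_ge0//.
by rewrite mulrAC ler_pdivrMr// ler_wpM2l ?ltW//; lra.
Qed.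

Section LinearForm.
Variables (n : nat) (c : 'cV[K]_n).

Definition lform_fun (h : 'cV[K]_n) : K^o := \sum_i c i 0 * h i 0.

Lemma lform_fun_linear : linear lform_fun.
Proof.
move=> a h k; rewrite /lform_fun scaler_sumr -big_split /=; apply: eq_bigr => i _.
by rewrite !mxE mulrDr mulrCA.
Qed.

HB.instance Definition _ := GRing.isLinear.Build K 'cV[K]_n K^o _ lform_fun lform_fun_linear.

Lemma lform_fun_continuous : continuous lform_fun.
Proof.
have H s : continuous (fun h : 'cV[K]_n => (\sum_(i <- s) c i 0 * h i 0 : K^o)).
  elim: s => [|i s IH] h.
    have -> : (fun h : 'cV[K]_n => (\sum_(i <- [::]) c i 0 * h i 0 : K^o)) = cst 0.
      by apply/funext => k; rewrite big_nil.
    exact: cst_continuous.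
  have -> : (fun h : 'cV[K]_n => (\sum_(j <- i :: s) c j 0 * h j 0 : K^o)) =
     (fun h : 'cV[K]_n => c i 0 * h i 0 + \sum_(j <- s) c j 0 * h j 0 : K^o).
    by apply/funext => k; rewrite big_cons.
  apply: cvgD (IH h); apply: cvgM; first exact: cvg_cst.
  exact: coord_continuous.
exact: H.
Qed.

End LinearForm.

(** Estimates under an integral sign produce a quadratic remainder, which is stronger than the
    little-o required by differentiability. *)
Lemma holomorphic_of_expand n (u : 'cV[R[i]]_n -> R[i]) :
  (forall x : 'cV[R[i]]_n, exists c : 'cV[R[i]]_n, exists M : R, forall h : 'cV[R[i]]_n, l1 h <= 1 ->
     normc (u (x + h) - u x - \sum_i c i 0 * h i 0) <= M * l1 h ^+ 2) -> holomorphic u.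
Proof.
move=> H x; have [c [M hM]] := H x.
have M0 : 0 <= `|M| by [].
have key : (u : 'cV[K]_n -> K^o) \o shift (x : 'cV[K]_n) = cst (u x : K^o) + (lform_fun c : 'cV[K]_n -> K^o) +o_ (0 : 'cV[K]_n) id.
  apply/eqaddoP => eps e0; have [eE e0'] := gt0_complexE e0.
  have n0 : 0 <= (n%:R : R) by [].
  have C0 : 0 < (n%:R + 1) ^+ 2 * (1 + `|M|) by rewrite mulr_gt0 ?exprn_gt0//; lra.
  (* Inside this radius [l1 h], which is at most [n |h|], stays below 1, and [|M| n^2 |h|] stays
     below [eps]; the added ones keep the denominators positive. *)
  pose r := Num.min ((n%:R + 1)^-1) (re eps / ((n%:R + 1) ^+ 2 * (1 + `|M|))).
  have r0 : 0 < r by rewrite lt_min invr_gt0 divr_gt0// andbT; lra.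
  have r1 : r * (n%:R + 1) <= 1.
    by rewrite -ler_pdivlMr ?mul1r ?ge_min ?lexx//; lra.
  have r2 : r * ((n%:R + 1) ^+ 2 * (1 + `|M|)) <= re eps.
    by rewrite -ler_pdivlMr// ge_min lexx orbT.
  apply/nbhs_ballP; exists (Complex r 0 : K) => [|h]; first by rewrite /= ltcE /= eqxx.
  rewrite mx_norm_ball /ball_ /= sub0r normrN => hr.
  have h0 : 0 <= `|h| :> K by exact: normr_ge0.
  have hl := l1_le_mx_norm h.
  move: h0 hr hl; case: (`|h|) => a b; rewrite lecE ltcE /= => /andP[/eqP -> a0] /andP[_ ar].
  rewrite lecE !reimE !re_natr !im_natr /= !mul0r ?mulr0 ?subr0 => /andP[_ hl].
  have l0 := l1_ge0 h.
  have hl1 : l1 h <= 1 by nra.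
  have E := hM h hl1.
  rewrite [X in `|X|](_ : _ = u (x + h) - u x - \sum_i c i 0 * h i 0); last first.
    by rewrite -addrA -opprD; congr (u _ - _); exact: addrC.
  rewrite normr_normc lecE eE !reimE /= ?mul0r ?mulr0 subr0 addr0 eqxx /=.
  apply: le_trans E _.
  have m1 := ler_norm M; have m0 := normr_ge0 M.
  have s1 : M * l1 h ^+ 2 <= `|M| * l1 h ^+ 2 by rewrite ler_wpM2r ?sqr_ge0.
  have s2 : l1 h ^+ 2 <= n%:R ^+ 2 * (r * a).
    have l2 : l1 h <= n%:R * r by apply: le_trans hl _; rewrite ler_wpM2l// ltW.
    have -> : n%:R ^+ 2 * (r * a) = (n%:R * a) * (n%:R * r) by ring.
    by rewrite expr2; apply: ler_pM.
  have s3 : `|M| * l1 h ^+ 2 <= `|M| * (n%:R ^+ 2 * (r * a)) by rewrite ler_wpM2l.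
  have s4 : n%:R ^+ 2 * `|M| <= (n%:R + 1) ^+ 2 * (1 + `|M|) by nra.
  have s5 : (r * a) * (n%:R ^+ 2 * `|M|) <= (r * a) * ((n%:R + 1) ^+ 2 * (1 + `|M|)).
    by rewrite ler_wpM2l// mulr_ge0// ltW.
  have s6 : a * (r * ((n%:R + 1) ^+ 2 * (1 + `|M|))) <= a * re eps by rewrite ler_wpM2l.
  lra.
apply/diff_locallyP; rewrite (diff_unique (@lform_fun_continuous n c) key); split => //.
exact: lform_fun_continuous.
Qed.

End Holomorphic.

(** * The bilinear pairing and real bilinear forms on C^n *)

Section Dot.
Context {R : realType}.
Local Notation C := R[i].

Definition dot n (u v : 'cV[C]_n) : C := (u^T *m v) 0 0.

Lemma dotE n (u v : 'cV[C]_n) : dot u v = \sum_i u i 0 * v i 0.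
Proof. by rewrite /dot mxE; apply: eq_bigr => i _; rewrite mxE. Qed.

Lemma dotC n (u v : 'cV[C]_n) : dot u v = dot v u.
Proof. by rewrite !dotE; apply: eq_bigr => i _; rewrite mulrC. Qed.

Lemma dotDl n (u v w : 'cV[C]_n) : dot (u + v) w = dot u w + dot v w.
Proof. by rewrite /dot linearD /= mulmxDl mxE. Qed.
Lemma dotDr n (u v w : 'cV[C]_n) : dot w (u + v) = dot w u + dot w v.
Proof. by rewrite /dot mulmxDr mxE. Qed.
Lemma dotZl n (a : C) (u w : 'cV[C]_n) : dot (a *: u) w = a * dot u w.
Proof. by rewrite /dot linearZ /= -scalemxAl mxE. Qed.
Lemma dotZr n (a : C) (u w : 'cV[C]_n) : dot u (a *: w) = a * dot u w.
Proof. by rewrite /dot -scalemxAr mxE. Qed.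
Lemma dotNl n (u w : 'cV[C]_n) : dot (- u) w = - dot u w.
Proof. by rewrite -scaleN1r dotZl mulN1r. Qed.
Lemma dotNr n (u w : 'cV[C]_n) : dot u (- w) = - dot u w.
Proof. by rewrite -scaleN1r dotZr mulN1r. Qed.
Lemma dot0l n (w : 'cV[C]_n) : dot 0 w = 0.
Proof. by rewrite -(scale0r 0) dotZl mul0r. Qed.
Lemma dot0r n (w : 'cV[C]_n) : dot w 0 = 0.
Proof. by rewrite dotC dot0l. Qed.

Lemma dot_mull m n (M : 'M[C]_(m, n)) u v : dot (M *m u) v = dot u (M^T *m v).
Proof. by rewrite /dot trmx_mul mulmxA. Qed.
Lemma dot_mulr m n (M : 'M[C]_(m, n)) u v : dot v (M *m u) = dot (M^T *m v) u.
Proof. by rewrite dotC dot_mull dotC. Qed.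

Lemma dot_col m n (a c : 'cV[C]_m) (b d : 'cV[C]_n) :
  dot (col_mx a b) (col_mx c d) = dot a c + dot b d.
Proof. by rewrite /dot tr_col_mx mul_row_col mxE. Qed.

Definition dotl n := (@dotDl n, @dotDr n, @dotZl n, @dotZr n, @dotNl n, @dotNr n).

Lemma conjD m n (u v : 'M[C]_(m, n)) : cconjmx (u + v) = cconjmx u + cconjmx v.
Proof. by apply/matrixP => i j; rewrite !mxE rmorphD. Qed.
Lemma conjZ m n (a : C) (u : 'M[C]_(m, n)) : cconjmx (a *: u) = complex.conjc a *: cconjmx u.
Proof. by apply/matrixP => i j; rewrite !mxE rmorphM. Qed.
Lemma conjN m n (u : 'M[C]_(m, n)) : cconjmx (- u) = - cconjmx u.
Proof. by apply/matrixP => i j; rewrite !mxE rmorphN. Qed.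
Lemma conjM m n p (u : 'M[C]_(m, n)) (v : 'M[C]_(n, p)) : cconjmx (u *m v) = cconjmx u *m cconjmx v.
Proof. exact: map_mxM. Qed.
Lemma conjT m n (u : 'M[C]_(m, n)) : cconjmx u^T = (cconjmx u)^T.
Proof. by rewrite /cconjmx map_trmx. Qed.
Lemma conjK m n (u : 'M[C]_(m, n)) : cconjmx (cconjmx u) = u.
Proof. by apply/matrixP => i j; rewrite !mxE complex.conjcK. Qed.
Lemma conj_col m1 m2 n (u : 'M[C]_(m1, n)) (v : 'M[C]_(m2, n)) :
  cconjmx (col_mx u v) = col_mx (cconjmx u) (cconjmx v).
Proof. exact: map_col_mx. Qed.
Lemma conj0 m n : cconjmx (0 : 'M[C]_(m, n)) = 0.
Proof. by apply/matrixP => i j; rewrite !mxE rmorph0. Qed.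

Lemma conj_dot n (u v : 'cV[C]_n) : complex.conjc (dot u v) = dot (cconjmx u) (cconjmx v).
Proof.
rewrite !dotE rmorph_sum; apply: eq_bigr => i _.
by rewrite rmorphM !mxE.
Qed.

Lemma normc_dot n (u v : 'cV[C]_n) : normc (dot u v) <= l1 u * l1 v.
Proof.
rewrite dotE; apply: le_trans (normc_sum _ _ _) _; rewrite {1}/l1 mulr_suml.
by apply: ler_sum => i _; rewrite normcM ler_wpM2l ?normc_ge0 ?normc_le_l1.
Qed.

Lemma meas_dot d (T : measurableType d) n (f g : T -> 'cV[C]_n) :
  mxmeas f -> mxmeas g -> cmeas (fun t => dot (f t) (g t)).
Proof. by move=> mf mg; apply: (mxmeasM (mxmeas_tr mf) mg). Qed.

Definition nsq n (x : 'cV[C]_n) : R := \sum_i sqmod (x i 0).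

Lemma nsq_ge0 n (x : 'cV[C]_n) : 0 <= nsq x.
Proof. by apply: sumr_ge0 => i _; exact: sqmod_ge0. Qed.

Lemma unitmx_inj n (M : 'M[C]_n) : (forall x : 'cV[C]_n, M *m x = 0 -> x = 0) -> M \in unitmx.
Proof.
move=> h; rewrite -unitmx_tr -row_free_unit -kermx_eq0; apply/eqP/row_matrixP => i.
rewrite row0; apply: trmx_inj; rewrite trmx0; apply: h.
apply: trmx_inj; rewrite trmx_mul trmxK trmx0; apply/sub_kermxP; exact: row_sub.
Qed.

Lemma unitmx_injr n (M : 'M[C]_n) : M \in unitmx -> forall x : 'cV[C]_n, M *m x = 0 -> x = 0.
Proof. by move=> uM x h; rewrite -(mulKmx uM x) h mulmx0. Qed.

(** Symmetric bilinear forms on C^n viewed as a real space, with real scalars embedded as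
    [Complex r 0]. The quadratic part of the kernel phase is of this kind, being neither complex
    bilinear nor sesquilinear. *)
Record rbilin n (p : 'cV[C]_n -> 'cV[C]_n -> R) : Prop := RBilin {
  rb_sym : forall x y, p x y = p y x;
  rb_add : forall x y z, p (x + y) z = p x z + p y z;
  rb_scale : forall r x z, p (Complex r 0 *: x) z = r * p x z }.

Section RBilin.
Variables (n : nat) (p : 'cV[C]_n -> 'cV[C]_n -> R).
Hypothesis hp : rbilin p.

Lemma rb_addr x y z : p z (x + y) = p z x + p z y.
Proof. by rewrite rb_sym// rb_add// !(rb_sym hp z). Qed.
Lemma rb_scaler r x z : p z (Complex r 0 *: x) = r * p z x.
Proof. by rewrite rb_sym// rb_scale// (rb_sym hp z). Qed.
Lemma rb_opp x z : p (- x) z = - p x z.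
Proof.
rewrite -mulN1r -rb_scale//; congr p; rewrite -scaleN1r; congr (_ *: _).
by apply: complex_ext; rewrite ?reimE /= ?oppr0.
Qed.
Lemma rb_oppr x z : p z (- x) = - p z x.
Proof. by rewrite rb_sym// rb_opp// (rb_sym hp z). Qed.

Lemma rb_cauchy_schwarz (x u : 'cV[C]_n) : (forall y, 0 <= p y y) -> 0 < p u u ->
  p u x ^+ 2 <= p u u * p x x.
Proof.
move=> p0 pu.
have := p0 (Complex (p u u) 0 *: x - Complex (p u x) 0 *: u).
rewrite rb_add ?rb_addr ?rb_opp ?rb_oppr ?rb_scale ?rb_scaler// (rb_sym hp x u).
move: (p u u) (p x x) (p u x) pu => a b c a0 h.
have h2 : 0 <= a * (a * b - c ^+ 2) by lra.
by rewrite pmulr_rge0// subr_ge0 in h2.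
Qed.

(** The value of the form at [s x + u] is affine in the real number [s] and nonnegative, so its
    slope [2 p x u] is zero. *)
Lemma rb_semidef_radical (x u : 'cV[C]_n) : (forall y, 0 <= p y y) -> p x x = 0 -> p x u = 0.
Proof.
move=> p0 px.
have H (s : R) : 0 <= s * (2 * p x u) + p u u.
  have := p0 (Complex s 0 *: x + u).
  rewrite rb_add ?rb_addr ?rb_scale ?rb_scaler// px (rb_sym hp u x); lra.
move: (p x u) (p u u) H => a b H.
have [//|a0] := eqVneq a 0.
(* At this [s] the affine function takes the value -1. *)
by have := H (- (1 + b) / (2 * a)); rewrite mulfVK ?mulf_neq0 ?pnatr_eq0//; lra.
Qed.

Lemma rb_0l z : p 0 z = 0.
Proof. by rewrite -(scale0r 0) (_ : 0 = Complex 0 0) // rb_scale// mul0r. Qed.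

Lemma rb_suml (I : Type) (s : seq I) (c : I -> R) (F : I -> 'cV[C]_n) z :
  p (\sum_(i <- s) Complex (c i) 0 *: F i) z = \sum_(i <- s) c i * p (F i) z.
Proof.
elim: s => [|i s IH]; first by rewrite !big_nil rb_0l.
by rewrite !big_cons rb_add// IH rb_scale.
Qed.

(** The real basis made of the [e_i] followed by the [i e_i]. *)
Definition rbase (k : 'I_(n + n)) : 'cV[C]_n :=
  match fintype.split k with inl i => delta_mx i 0 | inr i => iC R *: delta_mx i 0 end.

Definition rcoord (y : 'cV[C]_n) (k : 'I_(n + n)) : R :=
  match fintype.split k with inl i => re (y i 0) | inr i => im (y i 0) end.

Lemma rbaseE (c : 'I_(n + n) -> R) (i : 'I_n) (j : 'I_1) :
  (\sum_k Complex (c k) 0 *: rbase k) i j = Complex (c (lshift n i)) (c (rshift n i)).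
Proof.
rewrite summxE big_split_ord /= (ord1 j).
have -> : \sum_(k < n) (Complex (c (lshift n k)) 0 *: rbase (lshift n k)) i 0 = Complex (c (lshift n i)) 0.
  rewrite (bigD1 i) //= big1 => [|k ki]; rewrite !mxE /rbase (unsplitK (inl _)) mxE eqxx.
    by rewrite eqxx mulr1 addr0.
  by rewrite (eq_sym i) (negbTE ki) /= mulr0.
have -> : \sum_(k < n) (Complex (c (rshift n k)) 0 *: rbase (rshift n k)) i 0 = Complex 0 (c (rshift n i)).
  rewrite (bigD1 i) //= big1 => [|k ki]; rewrite !mxE /rbase (unsplitK (inr _)) !mxE eqxx.
    by rewrite eqxx addr0; apply: complex_ext; rewrite !reimE /=; ring.
  by rewrite (eq_sym i) (negbTE ki) /= !mulr0.
by apply: complex_ext; rewrite !reimE /= ?addr0 ?add0r.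
Qed.

Lemma rcoordK y : y = \sum_k Complex (rcoord y k) 0 *: rbase k.
Proof.
apply/matrixP => i j; rewrite rbaseE /rcoord (unsplitK (inl i)) (unsplitK (inr i)) (ord1 j).
by case: (y i 0).
Qed.

Lemma nsq_rcoord y : nsq y = \sum_k rcoord y k ^+ 2.
Proof.
rewrite big_split_ord /= -big_split /=; apply: eq_bigr => i _.
by rewrite /rcoord (unsplitK (inl i)) (unsplitK (inr i)).
Qed.

(** An algebraic substitute for compactness of the sphere: the Gram matrix in the real basis is
    invertible, so each real coordinate is [p (g k)] for some vector [g k], and Cauchy-Schwarz
    bounds its square by [p (g k) (g k)] times [p y y]. *)
Lemma rb_posdef_lower : (forall y, y != 0 -> 0 < p y y) ->
  exists2 del : R, 0 < del & forall y, del * nsq y <= p y y.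
Proof.
move=> ppos.
have p0 y : 0 <= p y y by have [->|/ppos/ltW//] := eqVneq y 0; rewrite rb_0l.
pose G : 'M[R]_(n + n) := \matrix_(k, l) p (rbase k) (rbase l).
have uG : G \in unitmx.
  rewrite -row_free_unit -kermx_eq0; apply/eqP/row_matrixP => i; rewrite row0.
  have : row i (kermx G) *m G = 0 by apply/sub_kermxP; exact: row_sub.
  move: (row i _) => v vG.
  pose y : 'cV[C]_n := \sum_k Complex (v 0 k) 0 *: rbase k.
  have py l : p y (rbase l) = 0.
    rewrite /y rb_suml; transitivity ((v *m G) 0 l); last by rewrite vG mxE.
    by rewrite mxE; apply: eq_bigr => k _; rewrite mxE.
  have pyy : p y y = 0.
    rewrite {1}/y rb_suml big1// => k _.
    by rewrite (rb_sym hp) py mulr0.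
  have y0 : y = 0 by apply: contra_eq pyy => /ppos; rewrite lt_def => /andP[].
  apply/rowP => k; rewrite mxE.
  have E i' := rbaseE (v 0) i' 0; rewrite -/y y0 in E.
  case: (split_ordP k) => i' ->; have := E i'; rewrite mxE => /esym/eqP; rewrite eq_complex /= => /andP[/eqP h1 /eqP h2].
    exact: h1.
  exact: h2.
have [g hg] : exists g : 'I_(n + n) -> 'cV[C]_n, forall k y, p (g k) y = rcoord y k.
  exists (fun k => \sum_l Complex (invmx G k l) 0 *: rbase l) => k y.
  rewrite rb_suml {1}(rcoordK y).
  transitivity ((invmx G *m G *m \col_j rcoord y j) k 0); last by rewrite mulVmx// mul1mx mxE.
  rewrite -mulmxA mxE; apply: eq_bigr => l _; congr (_ * _).
  rewrite (rb_sym hp) rb_suml mxE; apply: eq_bigr => j _.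
  by rewrite !mxE mulrC (rb_sym hp (rbase j)).
have C0 : 0 < 1 + \sum_k p (g k) (g k) by rewrite ltr_pwDl// sumr_ge0.
exists ((1 + \sum_k p (g k) (g k))^-1) => [|y]; first by rewrite invr_gt0.
rewrite ler_pdivrMl// nsq_rcoord mulrDl mul1r; apply: ler_wpDl; first exact: p0.
rewrite mulr_suml; apply: ler_sum => k _; rewrite -hg.
have [->|/ppos gk] := eqVneq (g k) 0; first by rewrite !rb_0l expr0n mul0r.
exact: rb_cauchy_schwarz.
Qed.

(* A concave quadratic function bounded above decays quadratically away from any
   almost-maximizer, by evaluating it at midpoints. *)
Lemma rb_concave_decay (a : 'cV[C]_n -> R) (K del : R) :
  (forall y z, a (y + z) = a y + a z) -> (forall r y, a (Complex r 0 *: y) = r * a y) ->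
  0 < del -> (forall y, del * nsq y <= p y y) -> (forall y, a y - p y y <= K) ->
  exists z, forall y, a y - p y y <= K + 1 - del / 2 * nsq (y - z).
Proof.
move=> aD aZ d0 hdel hK.
pose f y := a y - p y y.
have fS : has_sup (range f) by split; [exists (f 0), 0|exists K => _ [y _ <-]; exact: hK].
(* [z] comes within 1 of the supremum; this is the 1 added to [K]. *)
have [_ [z _ <-] hz] := sup_adherent ltr01 fS.
exists z => y; rewrite -/(f y).
have sK : sup (range f) <= K by apply: ge_sup => [|_ [x _ <-]]; [exists (f 0), 0|exact: hK].
have hm : f (Complex 2^-1 0 *: (y + z)) <= sup (range f) by apply: ub_le_sup; [case: fS|exists (Complex 2^-1 0 *: (y + z))].
(* Parallelogram law: the quadratic term contributes an excess at the midpoint, and bounding the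
   left side by the supremum turns it into decay. *)
have mid : f (Complex 2^-1 0 *: (y + z)) = (f y + f z) / 2 + p (y - z) (y - z) / 4.
  rewrite /f aZ aD !(rb_scale hp, rb_scaler, rb_add hp, rb_addr, rb_opp, rb_oppr) (rb_sym hp z y).
  by field.
have := hdel (y - z); lra.
Qed.

End RBilin.
End Dot.

(** * Sums and products of complex differentiable functions *)

Section CdiffAlgebra.
Context {R : realType}.
Implicit Types f g : R[i] -> R[i].

Lemma cdiff_cst (c z : R[i]) : cdiff (fun=> c) z.
Proof.
exists 0 => eps e0; exists 1 => // w _.
by rewrite subrr mul0r subrr normc0 mulr_ge0 ?normc_ge0// ltW.
Qed.

Lemma cdiff_id (z : R[i]) : cdiff id z.
Proof.
exists 1 => eps e0; exists 1 => // w _.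
by rewrite mul1r subrr normc0 mulr_ge0 ?normc_ge0// ltW.
Qed.

Lemma cdiff_ext f g z : f =1 g -> cdiff f z -> cdiff g z.
Proof. by move=> /funext ->. Qed.

Lemma cdiffD f g z : cdiff f z -> cdiff g z -> cdiff (fun w => f w + g w) z.
Proof.
move=> [a ha] [b hb]; exists (a + b) => eps e0.
have e2 : 0 < eps / 2 by rewrite divr_gt0.
have [d1 d10 h1] := ha _ e2; have [d2 d20 h2] := hb _ e2.
exists (Num.min d1 d2); first by rewrite lt_min d10.
move=> w; rewrite lt_min => /andP[w1 w2].
have -> : f w + g w - (f z + g z) - (a + b) * (w - z) =
  (f w - f z - a * (w - z)) + (g w - g z - b * (w - z)) by ring.
apply: le_trans (normcD _ _) _; have := h1 w w1; have := h2 w w2; lra.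
Qed.

(** The real arithmetic of the product rule: [x] and [v] are the remainders of the two factors, [y]
    is the increment of the second one, and [A], [F], [G] are moduli of a derivative and of values.
    The minimum with 1 keeps [x] below [t], so that [x * y] is small against [t]. *)
Lemma product_remainder_le (t x y v A F G eps : R) : let M := 1 + A + F + G in
  let q := eps / (4 * M) in 0 <= t -> 0 <= x -> 0 <= y -> 0 <= v -> 0 <= A -> 0 <= F -> 0 <= G ->
  0 < q -> x <= Num.min 1 q * t -> v <= q * t -> y < q ->
  x * y + x * G + A * t * y + F * v <= eps * t.
Proof.
move=> M q t0 x0 y0 v0 A0 F0 G0 q0 E1 E2 E3.
have M0 : 0 < M by rewrite /M; lra.
have k1 : Num.min 1 q <= 1 by rewrite ge_min lexx.
have k2 : Num.min 1 q <= q by rewrite ge_min lexx orbT.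
have qM : 4 * q * M = eps by rewrite /q; field; rewrite gt_eqF.
have x1 : x <= t by apply: le_trans E1 _; rewrite ler_piMl.
have x2 : x <= q * t by apply: le_trans E1 _; rewrite ler_wpM2r.
have p1 : x * y <= q * t by rewrite mulrC; apply: ler_pM => //; exact: ltW.
have p2 : x * G <= q * t * G by rewrite ler_wpM2r.
have p3 : A * t * y <= A * t * q by rewrite ler_wpM2l ?mulr_ge0// ltW.
have p4 : F * v <= F * (q * t) by rewrite ler_wpM2l.
have p5 : 0 <= q * t by rewrite mulr_ge0// ltW.
have -> : eps * t = 4 * (q * t) * (1 + A + F + G) by rewrite -qM /M; ring.
have a1 := mulr_ge0 p5 A0; have a2 := mulr_ge0 p5 F0; have a3 := mulr_ge0 p5 G0.
lra.
Qed.

Lemma cdiffM f g z : cdiff f z -> cdiff g z -> cdiff (fun w => f w * g w) z.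
Proof.
move=> df dg; have [a ha] := df; have [b hb] := dg.
exists (a * g z + f z * b) => eps e0.
have na := normc_ge0 a; have nb := normc_ge0 b.
have nf := normc_ge0 (f z); have ng := normc_ge0 (g z).
pose M := 1 + normc a + normc (f z) + normc (g z).
have M0 : 0 < M by rewrite /M; lra.
have e3 : 0 < eps / (4 * M) by rewrite divr_gt0// mulr_gt0.
pose e4 := Num.min 1 (eps / (4 * M)).
have e40 : 0 < e4 by rewrite lt_min ltr01.
have [d1 d10 h1] := ha _ e40; have [d2 d20 h2] := hb _ e3.
have [d3 d30 h3] := cdiff_cont dg e3.
exists (Num.min (Num.min d1 d2) d3); first by rewrite !lt_min d10 d20.
move=> w; rewrite !lt_min => /andP[/andP[w1 w2] w3].
have E1 := h1 w w1; have E2 := h2 w w2; have E3 := h3 w w3.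
have -> : f w * g w - f z * g z - (a * g z + f z * b) * (w - z) =
  (f w - f z - a * (w - z)) * (g w - g z) + (f w - f z - a * (w - z)) * g z
  + a * (w - z) * (g w - g z) + f z * (g w - g z - b * (w - z)) by ring.
apply: le_trans (normcD _ _) _; apply: le_trans (lerD (le_trans (normcD _ _) (lerD (normcD _ _) (lexx _))) (lexx _)) _.
rewrite !normcM.
have t0 := normc_ge0 (w - z).
have x0 := normc_ge0 (f w - f z - a * (w - z)).
have y0 := normc_ge0 (g w - g z); have z0 := normc_ge0 (g w - g z - b * (w - z)).
exact: product_remainder_le.
Qed.

End CdiffAlgebra.

(** * Gaussian domination and averaging over rotations *)

Section GaussianIntegrals.
Context {R : realType} {n : nat} (X : @cspace R n).
Local Notation leb := (@lebesgue_measure R).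
Local Notation mR := (measurableTypeR R).
Local Notation mu := (cs_mu X).
Local Notation pt := (@cs_pt R n X).
Local Notation C := R[i].
Local Notation V := 'cV[C]_n.

(** From [1 + r <= exp r], since [m (1 + s^2) <= 1 + del s^2] for [m = min 1 del]. *)
Lemma expRN_le_hat (del s : R) : 0 < del ->
  expR (- (del * s ^+ 2)) <= (Num.min 1 del)^-1 * (1 + s ^+ 2)^-1.
Proof.
move=> d0; rewrite expRN -invfM lef_pV2 ?posrE ?expR_gt0//; last first.
  by rewrite mulr_gt0 ?lt_min ?ltr01//= ltr_pwDl// sqr_ge0.
apply: le_trans (expR_ge1Dx _); have := sqr_ge0 s.
have m1 : Num.min 1 del <= 1 by rewrite ge_min lexx.
have m2 : Num.min 1 del <= del by rewrite ge_min lexx orbT.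
move: (s ^+ 2) (Num.min 1 del) m1 m2 => x m m1 m2 x0.
by rewrite mulrDr mulr1; apply: lerD => //; rewrite ler_wpM2r.
Qed.

Lemma gauss_le_vhat (del : R) : 0 < del ->
  exists K : R, forall x : V, expR (- (del * nsq x)) <= K * vhat x.
Proof.
move=> d0; pose k := (Num.min 1 del)^-1; exists (\prod_(j < n) (k * k)) => x.
rewrite /vhat -big_split /= /nsq mulr_sumr -sumrN expR_sum; apply: ler_prod => j _.
rewrite expR_ge0 /= /sqmod mulrDr opprD expRD /hat invfM mulrACA.
by apply: ler_pM; rewrite ?expR_ge0//; exact: expRN_le_hat.
Qed.

Lemma integrable_vhat_le (f : V -> R) (K : R) : vmeas (fun x => (f x)%:E) ->
  (forall x, `|f x| <= K * vhat x) -> mu.-integrable setT (fun t => (f (pt t))%:E).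
Proof.
move=> mf hf; have h := integrableZl measurableT K (integrable_vhat X).
apply: le_integrable h => //; first exact: mf (mxmeas_pt X).
by move=> t _; rewrite /= lee_fin (le_trans (hf _))// ler_norm.
Qed.

Lemma cintegrable_vhat (g : V -> C) (K : R) : vcmeas g ->
  (forall x, normc (g x) <= K * vhat x) -> cintegrable mu setT (fun t => g (pt t)).
Proof.
move=> mg hg; split.
  apply: (@integrable_vhat_le (fun x => re (g x)) K); first exact: vcmeas_re.
  by move=> x; apply: le_trans (abs_re_le _) _.
apply: (@integrable_vhat_le (fun x => im (g x)) K); first exact: vcmeas_im.
by move=> x; apply: le_trans (abs_im_le _) _.
Qed.

Lemma vcmeas_normc (g : V -> C) : vcmeas g -> vmeas (fun x => (normc (g x))%:E).
Proof. by move=> mg d Y q mq; apply: cmeas_normc_EFin; exact: mg. Qed.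

Lemma meas_nsq d (Y : measurableType d) (q : Y -> V) : mxmeas q ->
  measurable_fun setT (fun y => nsq (q y)).
Proof.
move=> mq; rewrite /nsq; apply: measurable_sum => i.
by apply: cmeas_sqmod; exact: mq.
Qed.

Lemma vmeas_gauss (del : R) (a : V) : vmeas (fun x => (expR (- (del * nsq (x - a))))%:E).
Proof.
move=> d Y q mq; apply/measurable_EFinP; apply: measurableT_comp => //.
apply: measurableT_comp => //; apply: measurable_funM; first exact: measurable_cst.
by apply: meas_nsq; apply: mxmeasD => //; exact: mxmeas_cst.
Qed.

Lemma vmeas_gauss0 (del : R) : vmeas (fun x : V => (expR (- (del * nsq x)))%:E).
Proof. by have := vmeas_gauss del 0; under eq_fun do rewrite subr0. Qed.

Lemma nsqD_le (x a : V) : nsq (x + a) <= 2 * nsq x + 2 * nsq a.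
Proof.
rewrite /nsq !mulr_sumr -big_split /=; apply: ler_sum => i _; rewrite mxE /sqmod !reimE.
move: (re (x i 0)) (im (x i 0)) (re (a i 0)) (im (a i 0)) => p q r s.
have := sqr_ge0 (p - r); have := sqr_ge0 (q - s); rewrite !expr2; nra.
Qed.

(** Recentring at the origin costs a constant and half of the rate, because
    [nsq x <= 2 nsq (x - a) + 2 nsq a]. *)
Lemma gauss_shift_le (del : R) (x a : V) : 0 <= del ->
  expR (- (del * nsq (x - a))) <= expR (del * nsq a) * expR (- (del / 2 * nsq x)).
Proof.
move=> d0; rewrite -expRD ler_expR; have := nsqD_le (x - a) a; rewrite subrK => h.
have := ler_wpM2l d0 h; lra.
Qed.

Lemma gauss_integral_shift (del : R) (a : V) :
  (\int[mu]_t (expR (- (del * nsq (pt t - a))))%:E = \int[mu]_t (expR (- (del * nsq (pt t))))%:E)%E.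
Proof.
apply: (@vint_translation R n X (fun x => (expR (- (del * nsq x)))%:E) (- a)) => [x|].
  by rewrite lee_fin expR_ge0.
exact: vmeas_gauss0.
Qed.

Lemma integrable_gauss (del : R) (a : V) : 0 < del ->
  mu.-integrable setT (fun t => (expR (- (del * nsq (pt t - a))))%:E).
Proof.
move=> d0; have d2 : 0 < del / 2 by rewrite divr_gt0.
have [K hK] := gauss_le_vhat d2.
apply: (@integrable_vhat_le (fun x => expR (- (del * nsq (x - a)))) (expR (del * nsq a) * K)).
  exact: vmeas_gauss.
move=> x; rewrite ger0_norm ?expR_ge0// -mulrA.
by apply: le_trans (gauss_shift_le _ _ (ltW d0)) _; rewrite ler_wpM2l ?expR_ge0.
Qed.

Lemma cintegrable_gauss (g : V -> C) (K del : R) (a : V) : 0 < del -> vcmeas g ->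
  (forall x, normc (g x) <= K * expR (- (del * nsq (x - a)))) ->
  cintegrable mu setT (fun t => g (pt t)).
Proof.
move=> d0 mg hg.
apply: (@cintegrable_le _ _ _ _ _ _ (fun t => K * expR (- (del * nsq (pt t - a))))) => //.
  by apply: mg; exact: mxmeas_pt.
exact: integrableZl (integrable_gauss a d0).
Qed.

Lemma cintegrable_lty d (T : measurableType d) (nu : {measure set T -> \bar R}) (f : T -> C) :
  cmeas f -> (\int[nu]_t (normc (f t))%:E < +oo)%E -> cintegrable nu setT f.
Proof.
move=> mf h; apply: (@cintegrable_le _ _ _ _ _ _ (fun t => normc (f t))) => //.
apply/integrableP; split; first exact: cmeas_normc_EFin.
by under eq_integral do rewrite gee0_abs ?lee_fin ?normc_ge0//.
Qed.

(** Rewrites the integral over the angles as one over the whole line, the form that [cfubini]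
    exchanges. *)
Lemma cint_indic (A : set mR) (h : mR -> C) : measurable A -> cintegrable leb A h ->
  cintegrable leb setT (fun s => Complex (\1_A s) 0 * h s) /\
  cint leb setT (fun s => Complex (\1_A s) 0 * h s) = cint leb A h.
Proof.
move=> mA [h1 h2].
have e1 : (fun s => re (Complex (\1_A s) 0 * h s)) = (fun s => re (h s)) \_ A.
  by apply/funext => s; rewrite reimE /= mul0r subr0 patchE indicE; case: ifP => sA; rewrite ?mul1r ?mul0r.
have e2 : (fun s => im (Complex (\1_A s) 0 * h s)) = (fun s => im (h s)) \_ A.
  by apply/funext => s; rewrite reimE /= mul0r addr0 patchE indicE; case: ifP => sA; rewrite ?mul1r ?mul0r.
split.
  split.
    move/(integrable_mkcond _ mA) : h1; apply: eq_integrable => // s _.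
    by rewrite reimE /= mul0r subr0 patchE indicE; case: ifP => _; rewrite ?mul1r ?mul0r.
  move/(integrable_mkcond _ mA) : h2; apply: eq_integrable => // s _.
  by rewrite reimE /= mul0r addr0 patchE indicE; case: ifP => _; rewrite ?mul1r ?mul0r.
by rewrite /cint e1 e2 -!Rintegral_mkcond.
Qed.

(* Averaging over the rotations [x -> e^{i s} x] turns the integral of an entire
   function against a circularly symmetric weight into circle means. *)
Lemma circular_mean (E : V -> R) (f : V -> C) (K : R) :
  vmeas (fun x => (E x)%:E) -> (forall x, 0 <= E x) ->
  (forall c x, sqmod c = 1 -> E (c *: x) = E x) -> vcmeas f ->
  (forall w z, cdiff (fun tau => f (tau *: w)) z) ->
  (forall x, E x <= K * vhat x) -> (forall x, E x * normc (f x) <= K * vhat x) ->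
  cint mu setT (fun t => Complex (E (pt t)) 0 * f (pt t)) =
  f 0 * cint mu setT (fun t => Complex (E (pt t)) 0).
Proof.
move=> mE E0 Erot mf df EK EfK.
pose g x := Complex (E x) 0 * f x.
have ng x : normc (g x) = E x * normc (f x) by rewrite normcM normcR ger0_norm.
have mEc : vcmeas (fun x => Complex (E x) 0).
  by move=> d Y q mq; apply: cmeas_real; apply/measurable_EFinP; exact: mE.
have mg : vcmeas g by move=> d Y q mq; apply: cmeasM; [exact: mEc|exact: mf].
pose u (s : R) := cexp (Complex 0 s).
have u1 s : sqmod (u s) = 1 by rewrite -normc_sqr normc_cexp /= expR0 expr1n.
have gu s x : Complex (E x) 0 * f (u s *: x) = g (u s *: x) by rewrite /g Erot.
pose A := `[0, 2 * pi]%classic : set mR.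
have mA : measurable A by exact: measurable_itv.
have muA : (lebesgue_measure A < +oo)%E.
  by rewrite /A lebesgue_measure_itv /=; case: ifP => _; rewrite ?ltry.
have pi0 : 0 <= 2 * (pi : R) by rewrite mulr_ge0// pi_ge0.
have ru x : rcont (fun s => f (u s *: x)).
  by have dG z := cdiff_comp (cdiff_cexp z) (df x (cexp z)); exact: rcont_vertical dG 0.
pose F (s : mR) t := Complex (\1_A s) 0 * (Complex (E (pt t)) 0 * f (u s *: pt t)).
pose J := (\int[mu]_t (normc (g (pt t)))%:E)%E.
have Jfin : (J < +oo)%E.
  have /integrableP[_] : mu.-integrable setT (fun t => (normc (g (pt t)))%:E).
    apply: (@integrable_vhat_le (fun x => normc (g x)) K); first exact: vcmeas_normc.
    by move=> x; rewrite ger0_norm ?normc_ge0// ng.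
  by under eq_integral do rewrite gee0_abs ?lee_fin ?normc_ge0//.
have J0 : (0 <= J)%E by apply: integral_ge0 => t _; rewrite lee_fin normc_ge0.
have Jrot s : (\int[mu]_t (normc (g (u s *: pt t)))%:E = J)%E.
  apply: (@vint_rotation R n X (fun x => (normc (g x))%:E)) => // [x|].
    by rewrite lee_fin normc_ge0.
  exact: vcmeas_normc.
have i0 s : 0 <= \1_A s :> R by rewrite indicE.
have mF : cmeas (fun p : mR * cs_T X => F p.1 p.2).
  have mp : mxmeas (fun p : mR * cs_T X => pt p.2).
    by apply: (mxmeas_comp measurable_snd); exact: mxmeas_pt.
  apply: cmeasM.
    apply: cmeas_real; apply: measurableT_comp measurable_fst; exact: measurable_indic.
  apply: cmeasM; first exact: mEc.
  apply: mf; apply: mxmeasZ => //; apply: cmeas_cexp; split => /=; first exact: measurable_cst.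
  exact: measurable_fst.
have nF s t : normc (F s t) = \1_A s * normc (g (u s *: pt t)).
  by rewrite /F gu normcM normcR ger0_norm.
have intF s : (\int[mu]_t (normc (F s t))%:E = (\1_A s)%:E * J)%E.
  under eq_integral => t _ do rewrite nF EFinM.
  rewrite ge0_integralZl_EFin//; first by rewrite Jrot.
    by move=> t _; rewrite lee_fin normc_ge0.
  apply: cmeas_normc_EFin; apply: mg; apply: mxmeasZ; [exact: cmeas_cst|exact: mxmeas_pt].
have sliceF s : cintegrable mu setT (F s).
  apply: cintegrable_lty; last by rewrite intF lte_mul_pinfty ?lee_fin.
  by apply: (cmeas_comp (pair1_measurable s) mF).
have ih x : cintegrable leb A (fun s => Complex (E x) 0 * f (u s *: x)).
  by apply: cintegrableZ => //; apply: rcont_integrable; exact: ru.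
have fub := @cfubini R _ _ _ _ leb mu F mF.
have Jint : (\int[leb]_s \int[mu]_t (normc (F s t))%:E < +oo)%E.
  under eq_integral do rewrite intF.
  rewrite -(fineK (_ : J \is a fin_num)) ?ge0_fin_numE//.
  under eq_integral do rewrite muleC.
  rewrite ge0_integralZl_EFin ?fine_ge0//.
    rewrite integral_indic// setIT; apply: lte_mul_pinfty; rewrite ?lee_fin ?fine_ge0//.
  by apply/measurable_EFinP; exact: measurable_indic.
have := fub Jint sliceF (fun t => (cint_indic mA (ih (pt t))).1).
(* At a fixed angle the rotation can be undone in the vector variable, so the inner integral does
   not depend on [s] and the outer one multiplies it by [2 pi]. *)
have -> : cint leb setT (fun s => cint mu setT (F s)) =
    cint mu setT (fun t => g (pt t)) * Complex (2 * pi) 0.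
  have hs s : cint mu setT (F s) = Complex (\1_A s) 0 * cint mu setT (fun t => g (pt t)).
    rewrite -(cint_rotation X mg (u1 s)) -cintZ; [|exact: measurableT|].
      by apply: eq_cint => t _; rewrite /F gu.
    apply: cintegrable_lty; last by rewrite Jrot.
    by apply: mg; apply: mxmeasZ; [exact: cmeas_cst|exact: mxmeas_pt].
  under [X in cint _ _ X]eq_fun do rewrite hs.
  have := (@cint_indic A (fun=> cint mu setT (fun t => g (pt t))) mA (rcont_integrable 0 (2 * pi) (rcont_cst _))).2.
  by move=> ->; rewrite /A cI_cst// subr0.
(* At a fixed vector the inner integral is the circle mean of an entire function of one variable,
   whose value at the centre is [f 0]. *)
have -> : cint mu setT (fun t => cint leb setT (fun s => F s t)) =
    f 0 * Complex (2 * pi) 0 * cint mu setT (fun t => Complex (E (pt t)) 0).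
  have iE : cintegrable mu setT (fun t => Complex (E (pt t)) 0).
    by apply: (@cintegrable_vhat (fun x => Complex (E x) 0) K) => // x; rewrite normcR ger0_norm.
  rewrite -cintZ; [|exact: measurableT|exact: iE].
  apply: eq_cint => t _; rewrite (cint_indic mA (ih (pt t))).2 cintZ//; last first.
    by apply: rcont_integrable; exact: ru.
  by rewrite (mean_value (df (pt t))) scale0r mulrC.
have p2 : Complex (2 * pi) 0 != 0 :> C.
  by rewrite -normc_gt0 normcR normr_gt0 mulf_neq0 ?pnatr_eq0 ?(gt_eqF (pi_gt0 _)).
by move=> h; apply: (mulIf p2); rewrite -/(g _) h; ring.
Qed.

End GaussianIntegrals.

Section RealScalars.
Context {R : realType}.
Lemma re2M (z : R[i]) : re (2 * z) = 2 * re z.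
Proof. by rewrite reM re_natr im_natr mul0r subr0. Qed.
Lemma im2M (z : R[i]) : im (2 * z) = 2 * im z.
Proof. by rewrite imM re_natr im_natr mul0r addr0. Qed.
Lemma cexp_real (z : R[i]) : im z = 0 -> cexp z = Complex (expR (re z)) 0.
Proof. by rewrite /cexp => ->; rewrite cos0 sin0 mulr1 mulr0. Qed.
End RealScalars.

(** * The reproducing formula for the Hermitian weight *)

Section Reproducing.
Context {R : realType} {n : nat} (X : @cspace R n).
Local Notation mu := (cs_mu X).
Local Notation pt := (@cs_pt R n X).
Local Notation C := R[i].
Local Notation V := 'cV[C]_n.
Variable B : 'M[C]_n.
Hypothesis hB : B^T = cconjmx B.
Hypothesis posB : forall v : V, v != 0 -> 0 < re (((cconjmx v)^T *m B *m v) 0 0).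

(** Linear, hence holomorphic, in the first argument and conjugate-linear in the second. *)
Definition hform (p q : V) : C := dot (cconjmx q) (B *m p).
Definition hsq (x : V) : R := re (hform x x).

Lemma hermDl p q r : hform (p + q) r = hform p r + hform q r.
Proof. by rewrite /hform mulmxDr dotDr. Qed.
Lemma hermDr p q r : hform r (p + q) = hform r p + hform r q.
Proof. by rewrite /hform conjD dotDl. Qed.
Lemma hermZl c p q : hform (c *: p) q = c * hform p q.
Proof. by rewrite /hform -scalemxAr dotZr. Qed.
Lemma hermZr c p q : hform p (c *: q) = complex.conjc c * hform p q.
Proof. by rewrite /hform conjZ dotZl. Qed.
Lemma hermNl p q : hform (- p) q = - hform p q.
Proof. by rewrite /hform mulmxN dotNr. Qed.
Lemma hermNr p q : hform p (- q) = - hform p q.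
Proof. by rewrite /hform conjN dotNl. Qed.

Lemma hform_conj p q : hform p q = complex.conjc (hform q p).
Proof. by rewrite /hform conj_dot conjK conjM -hB dot_mulr dotC. Qed.

Lemma hermxx x : hform x x = Complex (hsq x) 0.
Proof.
apply: complex_ext => //=; have /(congr1 (fun z : C => im z)) := hform_conj x x; rewrite imJ; lra.
Qed.

Lemma rbilin_herm : rbilin (fun x y => re (hform x y)).
Proof.
split => [x y|x y z|r x z]; first by rewrite hform_conj reJ.
  by rewrite hermDl reD.
by rewrite hermZl reM /= mul0r subr0.
Qed.

Lemma hq_pos x : x != 0 -> 0 < hsq x.
Proof. by move=> /posB; rewrite /hsq /hform /dot mulmxA. Qed.

Lemma hq_lower : exists2 del : R, 0 < del & forall x, del * nsq x <= hsq x.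
Proof. exact: rb_posdef_lower rbilin_herm hq_pos. Qed.

Lemma hqD x y : hsq (x + y) = hsq x + 2 * re (hform x y) + hsq y.
Proof. by rewrite /hsq hermDl !hermDr !reD (hform_conj y x) reJ; ring. Qed.

Lemma meas_herm d (T : measurableType d) (f g : T -> V) :
  mxmeas f -> mxmeas g -> cmeas (fun t => hform (f t) (g t)).
Proof.
move=> mf mg; apply: meas_dot; first exact: mxmeas_conj.
by apply: mxmeasM => //; exact: mxmeas_cst.
Qed.

(** The mass of the Gaussian weight. Its value is never computed; [cB_neq0] suffices. *)
Definition cB : C := cint mu setT (fun t => Complex (expR (- (2 * hsq (pt t)))) 0).

(** After translation by [z] the exponent becomes [- 2 h(w,w) - 2 h(w,z)]. The first term is a
    circularly symmetric weight; the second is holomorphic in [w], so [f] is entire with [f 0 = v z]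
    and [circular_mean] applies. *)
Lemma reproducing (v : V -> C) (K : R) (z : V) : vcmeas v ->
  (forall x w tau, cdiff (fun tau => v (x + tau *: w)) tau) ->
  (forall y, normc (v y) <= K * expR (hsq y)) ->
  cint mu setT (fun t => cexp (2 * hform z (pt t) - 2 * hform (pt t) (pt t)) * v (pt t)) = v z * cB.
Proof.
move=> mv dv vK; have [del d0 hdel] := hq_lower.
pose g y := cexp (2 * hform z y - 2 * hform y y) * v y.
have mg : vcmeas g.
  move=> d Y q mq; apply: cmeasM; last exact: mv.
  apply: cmeas_cexp; apply: cmeasD; last apply: cmeasN;
    apply: cmeasM; try exact: cmeas_cst; apply: meas_herm => //; exact: mxmeas_cst.
rewrite -(cint_translation X z mg).
pose f w := cexp (- (2 * hform w z)) * v (w + z).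
have -> : cint mu setT (fun t => g (pt t + z)) =
    cint mu setT (fun t => Complex (expR (- (2 * hsq (pt t)))) 0 * f (pt t)).
  apply: eq_cint => t _; rewrite /g /f mulrA; congr (_ * _).
  have -> : Complex (expR (- (2 * hsq (pt t)))) 0 = cexp (- (2 * hform (pt t) (pt t))).
    by rewrite cexp_real ?reN ?re2M// imN im2M hermxx /= mulr0 oppr0.
  by rewrite -cexpD; congr cexp; rewrite !hermDl !hermDr; ring.
have -> : v z = f 0 by rewrite /f add0r /hform mulmx0 dot0r mulr0 oppr0 cexp0 mul1r.
have k2 : 0 < 2 * del by rewrite mulr_gt0.
have [K1 hK1] := @gauss_le_vhat R n _ k2.
have [K2 hK2] := @gauss_le_vhat R n _ d0.
have K0 : 0 <= K.
  have := vK 0; have := normc_ge0 (v 0); have := expR_gt0 (hsq 0).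
  by move=> e0 n0 /(le_trans n0); rewrite pmulr_lge0.
have mE : vmeas (fun x => (expR (- (2 * hsq x)))%:E).
  move=> d Y q mq; apply/measurable_EFinP; apply: measurableT_comp => //.
  apply: measurableT_comp => //; apply: measurable_funM; first exact: measurable_cst.
  exact: (meas_herm mq mq).1.
apply: (@circular_mean R n X (fun x => expR (- (2 * hsq x))) f (`|K1| + `|K * expR (hsq z) * K2|) mE).
- by move=> x; exact: expR_ge0.
- move=> c x c1; congr (expR (- (2 * _))).
  rewrite /hsq hermZl hermZr mulrA (_ : c * complex.conjc c = 1) ?mul1r//.
  by apply: complex_ext; move: c1; rewrite /sqmod !reimE /= => h; [rewrite -h|]; ring.
- move=> d Y q mq; apply: cmeasM; last by apply: mv; apply: mxmeasD => //; exact: mxmeas_cst.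
  apply: cmeas_cexp; apply: cmeasN; apply: cmeasM; first exact: cmeas_cst.
  by apply: meas_herm => //; exact: mxmeas_cst.
- move=> w tau; apply: cdiffM; last first.
    by apply: cdiff_ext (dv z w tau) => s; rewrite addrC.
  apply: (cdiff_comp (f := @cexp R)); last exact: cdiff_cexp.
  apply: (@cdiff_ext _ (fun s => s * - (2 * hform w z))) => [s|]; first by rewrite hermZl; ring.
  by apply: cdiffM; [exact: cdiff_id|exact: cdiff_cst].
- move=> x; have := hdel x => hx.
  have : expR (- (2 * hsq x)) <= expR (- (2 * del * nsq x)) by rewrite ler_expR; lra.
  move=> /le_trans; apply; apply: le_trans (hK1 x) _; rewrite ler_wpM2r ?vhat_ge0//.
  by apply: le_trans (ler_norm _) _; rewrite lerDl.
- move=> x; have := hdel x => hx.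
  (* The exponents [- 2 h(x,x) - 2 Re h(x,z) + h(x+z,x+z)] add up to [h(z,z) - h(x,x)]: Gaussian
     decay survives the growth allowed to [v]. *)
  have h1 : expR (- (2 * hsq x)) * normc (f x) <= K * expR (hsq z) * expR (- (del * nsq x)).
    rewrite /f normcM normc_cexp.
    apply: le_trans (_ : expR (- (2 * hsq x)) * (expR (re (- (2 * hform x z))) * (K * expR (hsq (x + z)))) <= _).
      by rewrite ler_wpM2l ?expR_ge0// ler_wpM2l ?expR_ge0.
    have -> : expR (- (2 * hsq x)) * (expR (re (- (2 * hform x z))) * (K * expR (hsq (x + z)))) =
        K * expR (- (2 * hsq x) + re (- (2 * hform x z)) + hsq (x + z)) by rewrite !expRD; ring.
    rewrite -mulrA -expRD ler_wpM2l// ler_expR hqD reN re2M; lra.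
  apply: le_trans h1 _; apply: le_trans (ler_wpM2l _ (hK2 x)) _; first by rewrite mulr_ge0 ?expR_ge0.
  rewrite mulrA ler_wpM2r ?vhat_ge0//.
  by apply: le_trans (ler_norm _) _; rewrite lerDr.
Qed.

(** A strictly positive function with zero integral vanishes off a null set, which would have to be
    the whole space; [cs_pos] excludes this. *)
Lemma cB_neq0 : cB != 0.
Proof.
have [del d0 hdel] := hq_lower.
have i1 : mu.-integrable setT (fun t => (expR (- (2 * hsq (pt t))))%:E).
  have h := integrable_gauss X 0 (mulr_gt0 (ltr0Sn R 1) d0).
  apply: le_integrable h => //.
    apply/measurable_EFinP; apply: measurableT_comp => //.
    apply: measurableT_comp => //; apply: measurable_funM; first exact: measurable_cst.
    exact: (meas_herm (mxmeas_pt X) (mxmeas_pt X)).1.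
  move=> t _; rewrite /= lee_fin !ger0_norm ?expR_ge0// ler_expR subr0; have := hdel (pt t); lra.
apply/negP => /eqP /(congr1 (fun z : C => re z)) /=; rewrite /Rintegral => /eqP.
rewrite fine_eq0 ?integrable_fin_num// => /eqP h.
have h' : (\int[mu]_t `|(expR (- (2 * hsq (pt t))))%:E| = 0)%E.
  by under eq_integral do rewrite gee0_abs ?lee_fin ?expR_ge0//.
have [A [mA A0 hA]] := (ae_eq_integral_abs mu measurableT (measurable_int _ i1)).1 h'.
have AT : A = setT.
  apply/seteqP; split => // t _; apply: hA => /= /(_ I) /eqP.
  by rewrite eqe gt_eqF ?expR_gt0.
by have := cs_pos X; rewrite -AT; move: A0 => /= ->; rewrite ltxx.
Qed.

End Reproducing.

(** * Holomorphic dependence of exponential integrals on a parameter *)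

Section Laplace.
Context {R : realType} {n : nat} (X : @cspace R n).
Local Notation mu := (cs_mu X).
Local Notation pt := (@cs_pt R n X).
Local Notation C := R[i].
Local Notation V := 'cV[C]_n.

(** Completing the square in each coordinate: [c r <= del r^2 + c^2 / (4 del)]. *)
Lemma linear_le_nsq (c del : R) : 0 < del ->
  exists K : R, forall y : V, c * l1 y <= del * nsq y + K.
Proof.
move=> d0; exists (n%:R * (c ^+ 2 / (4 * del))) => y.
rewrite /l1 /nsq !mulr_sumr -[n in n%:R]card_ord -sumr_const mulr_suml -big_split /=.
apply: ler_sum => i _; rewrite mul1r -normc_sqr.
have d4 : 0 < 4 * del by rewrite mulr_gt0.
rewrite -(ler_pM2l d4) mulrDr [X in _ <= _ + X]mulrC mulfVK ?gt_eqF//.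
have := sqr_ge0 (c - 2 * del * normc (y i 0)); rewrite !expr2; lra.
Qed.

Lemma expR_l1_gauss (c del : R) : 0 < del ->
  exists2 K : R, 0 <= K & forall y : V,
    expR (c * l1 y) * expR (- (del * nsq y)) <= K * expR (- (del / 2 * nsq y)).
Proof.
move=> d0; have d2 : 0 < del / 2 by rewrite divr_gt0.
have [K hK] := linear_le_nsq c d2; exists (expR K) => [|y]; first exact: expR_ge0.
rewrite -!expRD ler_expR; have := hK y; lra.
Qed.

Lemma sqr_le_expR (s : R) : 0 <= s -> s ^+ 2 <= expR (2 * s).
Proof.
move=> s0; have e : s <= expR s by have := expR_ge1Dx s; lra.
by rewrite mulr_natl mulr2n expRD expr2; apply: ler_pM.
Qed.

Section Transform.
Variables (m : nat) (Lam : V -> 'cV[C]_m) (w : V -> C) (L K del : R).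
Hypothesis mLam : forall i, vcmeas (fun y => Lam y i 0).
Hypothesis hLam : forall y, l1 (Lam y) <= L * l1 y.
Hypothesis mw : vcmeas w.
Hypothesis d0 : 0 < del.
Hypothesis hw : forall y, normc (w y) <= K * expR (- (del * nsq y)).

(** [Lam] may depend on the integration variable in a non-holomorphic way. It is instantiated with
    [dbl] for the Gaussian integral and with [couple] for the Weyl operator. *)
Definition laplace (x : 'cV[C]_m) : C := cint mu setT (fun t => cexp (dot x (Lam (pt t))) * w (pt t)).

Let mxLam d (Y : measurableType d) (q : Y -> V) : mxmeas q -> mxmeas (fun y => Lam (q y)).
Proof. by move=> mq i j; rewrite (ord1 j); exact: (mLam i mq). Qed.

Lemma vcmeas_laplace (x : 'cV[C]_m) : vcmeas (fun y => cexp (dot x (Lam y)) * w y).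
Proof.
move=> d Y q mq; apply: cmeasM; last exact: mw.
by apply: cmeas_cexp; apply: meas_dot; [exact: mxmeas_cst|exact: mxLam].
Qed.

Let K0 : 0 <= K.
Proof.
have := hw 0; have := normc_ge0 (w 0); have := expR_gt0 (- (del * nsq (0 : V))).
by move=> e0 n0 /(le_trans n0); rewrite pmulr_lge0.
Qed.

(** Half of the Gaussian rate of [w] absorbs any exponential of a multiple of [l1 (Lam y)]. *)
Lemma laplace_dom (c : R) : exists2 M : R, 0 <= M & forall y,
  expR (c * l1 (Lam y)) * normc (w y) <= M * expR (- (del / 2 * nsq y)).
Proof.
have [M M0 hM] := @expR_l1_gauss (`|c| * L) del d0; exists (M * K) => [|y]; first exact: mulr_ge0.
have h1 : expR (c * l1 (Lam y)) <= expR (`|c| * L * l1 y).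
  rewrite ler_expR -mulrA; apply: le_trans (_ : `|c| * l1 (Lam y) <= _).
    by rewrite ler_wpM2r ?l1_ge0// ler_norm.
  by rewrite ler_wpM2l.
apply: le_trans (ler_pM (expR_ge0 _) (normc_ge0 _) h1 (hw y)) _.
by have := ler_wpM2l K0 (hM y); lra.
Qed.

Lemma re_dot_le (x : 'cV[C]_m) y : re (dot x (Lam y)) <= l1 x * l1 (Lam y).
Proof. exact: le_trans (ler_norm _) (le_trans (abs_re_le _) (normc_dot _ _)). Qed.

Lemma cintegrable_laplace_dom (g : V -> C) (c M : R) : vcmeas g ->
  (forall y, normc (g y) <= M * (expR (c * l1 (Lam y)) * normc (w y))) ->
  cintegrable mu setT (fun t => g (pt t)).
Proof.
move=> mg hg; have [M1 M10 hM1] := laplace_dom c.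
have d2 : 0 < del / 2 by rewrite divr_gt0.
apply: (@cintegrable_gauss R n X g (`|M| * M1) (del / 2) 0 d2 mg) => y.
rewrite subr0 -[leRHS]mulrA; apply: le_trans (hg y) _.
have h0 : 0 <= expR (c * l1 (Lam y)) * normc (w y) by rewrite mulr_ge0 ?expR_ge0 ?normc_ge0.
apply: le_trans (ler_wpM2r h0 (ler_norm M)) _; exact: (ler_wpM2l (normr_ge0 M) (hM1 y)).
Qed.

Lemma cintegrable_laplace (x : 'cV[C]_m) :
  cintegrable mu setT (fun t => cexp (dot x (Lam (pt t))) * w (pt t)).
Proof.
apply: (@cintegrable_laplace_dom (fun y => cexp (dot x (Lam y)) * w y) (l1 x) 1).
  exact: vcmeas_laplace.
move=> y; rewrite mul1r normcM normc_cexp ler_wpM2r ?normc_ge0// ler_expR; exact: re_dot_le.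
Qed.

(** Differentiation under the integral sign, with [c] as gradient: the integrated second-order
    remainder of the exponential is at most a constant times [l1 h ^+ 2]. *)
Lemma laplace_holomorphic : holomorphic laplace.
Proof.
apply: holomorphic_of_expand => x.
pose c : 'cV[C]_m := \col_i cint mu setT (fun t => Lam (pt t) i 0 * (cexp (dot x (Lam (pt t))) * w (pt t))).
(* Of the rate, [l1 x] pays for the exponential at [x], 2 for the square of the increment through
   [s^2 <= exp (2 s)], and 1 for the exponential in the remainder, where [l1 h <= 1]. *)
have [M M0 hM] := laplace_dom (l1 x + 3).
have d2 : 0 < del / 2 by rewrite divr_gt0.
exists c; exists (2 * (5 * M * Rintegral mu setT (fun t => expR (- (del / 2 * nsq (pt t)))))) => h h1.
have iL i : cintegrable mu setT (fun t => Lam (pt t) i 0 * (cexp (dot x (Lam (pt t))) * w (pt t))).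
  apply: (@cintegrable_laplace_dom (fun y => Lam y i 0 * (cexp (dot x (Lam y)) * w y)) (l1 x + 1) 1).
    by move=> d Y q mq; apply: cmeasM; [exact: mLam|exact: vcmeas_laplace].
  move=> y; rewrite mul1r !normcM normc_cexp mulrA ler_wpM2r ?normc_ge0//.
  rewrite mulrDl mul1r expRD mulrC; apply: ler_pM; rewrite ?expR_ge0 ?normc_ge0//.
    by rewrite ler_expR; exact: re_dot_le.
  by apply: le_trans (normc_le_l1 _ _) _; have := expR_ge1Dx (l1 (Lam y)); lra.
have iS : cintegrable mu setT (fun t => dot h (Lam (pt t)) * (cexp (dot x (Lam (pt t))) * w (pt t))) /\
    cint mu setT (fun t => dot h (Lam (pt t)) * (cexp (dot x (Lam (pt t))) * w (pt t))) = \sum_i c i 0 * h i 0.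
  have -> : (fun t => dot h (Lam (pt t)) * (cexp (dot x (Lam (pt t))) * w (pt t))) =
     (fun t => \sum_i h i 0 * (Lam (pt t) i 0 * (cexp (dot x (Lam (pt t))) * w (pt t)))).
    by apply/funext => t; rewrite (dotE h) mulr_suml; apply: eq_bigr => i _; rewrite -[LHS]mulrA.
  elim: (index_enum _) => [|i s [IH1 IH2]].
    have -> : (fun t => \sum_(i <- [::]) h i 0 * (Lam (pt t) i 0 * (cexp (dot x (Lam (pt t))) * w (pt t)))) = (fun=> 0).
      by apply/funext => t; rewrite big_nil.
    rewrite big_nil; split; first by split => /=; exact: integrable0.
    by apply: complex_ext; rewrite /= /Rintegral integral0.
  have -> : (fun t => \sum_(j <- i :: s) h j 0 * (Lam (pt t) j 0 * (cexp (dot x (Lam (pt t))) * w (pt t)))) =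
     (fun t => h i 0 * (Lam (pt t) i 0 * (cexp (dot x (Lam (pt t))) * w (pt t))) +
        \sum_(j <- s) h j 0 * (Lam (pt t) j 0 * (cexp (dot x (Lam (pt t))) * w (pt t)))).
    by apply/funext => t; rewrite big_cons.
  have ihi := cintegrableZ (h i 0) measurableT (iL i).
  split; first exact: (cintegrableD measurableT ihi IH1).
  by rewrite (cintD measurableT ihi IH1) IH2 (cintZ _ measurableT (iL i)) big_cons mxE mulrC.
have [i1 e1] := iS; rewrite -e1.
have i2 := cintegrable_laplace (x + h); have i3 := cintegrable_laplace x.
have i4 := cintegrableD measurableT i2 (cintegrableN measurableT i3).
have i5 := cintegrableD measurableT i4 (cintegrableN measurableT i1).
rewrite /laplace -(cintB measurableT i2 i3) -(cintB measurableT i4 i1).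
have ig : mu.-integrable setT (EFin \o (fun t => 5 * M * l1 h ^+ 2 * expR (- (del / 2 * nsq (pt t))))).
  have := integrableZl measurableT (5 * M * l1 h ^+ 2) (integrable_gauss X 0 d2).
  by apply: eq_integrable => // t _; rewrite /= subr0 EFinM.
have -> : 2 * (5 * M * Rintegral mu setT (fun t => expR (- (del / 2 * nsq (pt t))))) * l1 h ^+ 2 =
   2 * Rintegral mu setT (fun t => 5 * M * l1 h ^+ 2 * expR (- (del / 2 * nsq (pt t)))).
  rewrite RintegralZl//; first by ring.
  by have := integrable_gauss X 0 d2; apply: eq_integrable => // t _; rewrite /= subr0.
apply: (normc_cint measurableT i5 ig) => t _.
move: (pt t) => y; set s := l1 (Lam y).
have s0 : 0 <= s by exact: l1_ge0.
have -> : cexp (dot (x + h) (Lam y)) * w y - cexp (dot x (Lam y)) * w y - dot h (Lam y) * (cexp (dot x (Lam y)) * w y)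
  = cexp (dot x (Lam y)) * w y * (cexp (dot h (Lam y)) - 1 - dot h (Lam y)).
  by rewrite dotDl cexpD; ring.
rewrite !normcM normc_cexp.
have hh0 := l1_ge0 h.
have b1 : normc (dot h (Lam y)) <= l1 h * s by exact: normc_dot.
have b2 : normc (dot h (Lam y)) <= s by apply: le_trans b1 _; rewrite ler_piMl.
have b3 : normc (cexp (dot h (Lam y)) - 1 - dot h (Lam y)) <= 5 * l1 h ^+ 2 * expR (3 * s).
  apply: le_trans (cexp_sub1B_le _) _.
  have q1 : normc (dot h (Lam y)) ^+ 2 <= l1 h ^+ 2 * expR (2 * s).
    apply: le_trans (_ : (l1 h * s) ^+ 2 <= _).
      by rewrite ler_pXn2r ?nnegrE ?normc_ge0 ?mulr_ge0.
    by rewrite exprMn ler_wpM2l ?sqr_ge0// sqr_le_expR.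
  have q2 : expR (normc (dot h (Lam y))) <= expR s by rewrite ler_expR.
  have -> : 5 * l1 h ^+ 2 * expR (3 * s) = 5 * (l1 h ^+ 2 * expR (2 * s)) * expR s.
    by rewrite -!mulrA -expRD; do 3 congr (_ * _); congr expR; ring.
  apply: ler_pM; rewrite ?expR_ge0 ?mulr_ge0 ?sqr_ge0 ?normc_ge0//.
  by rewrite ler_wpM2l.
have b4 : expR (re (dot x (Lam y))) <= expR (l1 x * s) by rewrite ler_expR; exact: re_dot_le.
have hM' := hM y; rewrite -/s mulrDl expRD in hM'.
have b5 : expR (re (dot x (Lam y))) * normc (w y) * normc (cexp (dot h (Lam y)) - 1 - dot h (Lam y)) <=
   (expR (l1 x * s) * normc (w y)) * (5 * l1 h ^+ 2 * expR (3 * s)).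
  apply: ler_pM; rewrite ?mulr_ge0 ?expR_ge0 ?normc_ge0//.
  by rewrite ler_wpM2r ?normc_ge0.
apply: le_trans b5 _.
have hh2 : 0 <= 5 * l1 h ^+ 2 by rewrite mulr_ge0 ?sqr_ge0.
have := ler_wpM2l hh2 hM'; lra.
Qed.

End Transform.
End Laplace.

(** * Entire functions invariant under real translations *)

Section RealInvariant.
Context {R : realType}.

Lemma is_derive0_bound (f : R -> R) (t : R) :
  (forall eps : R, 0 < eps -> exists2 del : R, 0 < del & forall s, `|s - t| < del ->
     `|f s - f t| <= eps * `|s - t|) -> is_derive t 1 f 0.
Proof.
move=> h.
have cv : (fun k : R => k^-1 *: (f (k *: 1 + t) - f t)) @ 0^' --> (0 : R).
  apply/cvgrPdist_le => eps e0; have [del d0 hd] := h eps e0.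
  apply/nbhs_ballP; exists del => //= k; rewrite /ball /= sub0r normrN => kd k0.
  rewrite sub0r normrN scaler1 normrM normfV mulrC ler_pdivrMr ?normr_gt0//.
  by have := hd (k + t); rewrite addrK; apply.
by apply: DeriveDef; [apply/cvg_ex; exists 0|exact: cvg_lim].
Qed.

(* Invariance under real translations kills the derivative, hence everything. *)
Lemma real_invariant_cst (f : R[i] -> R[i]) : (forall z, cdiff f z) ->
  (forall z r, f (z + Complex r 0) = f z) -> forall z, f z = f 0.
Proof.
move=> df hf.
have small z (eps : R) : 0 < eps -> exists2 del : R, 0 < del & forall w, normc (w - z) < del ->
    normc (f w - f z) <= eps * normc (w - z).
  move=> e0; have [c hc] := df z.
  have c0 : c = 0.
    (* Tested at [z + del / 2], where [f] has no increment: the remainder there is [c] times the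
       displacement, whence [|c| <= e]. *)
    apply/eqP; rewrite -normc_eq0 eq_le normc_ge0 andbT; apply/ler_addgt0Pl => e e1; rewrite addr0.
    have [del d0 hd] := hc e e1.
    have d2 : 0 < del / 2 by rewrite divr_gt0.
    have := hd (z + Complex (del / 2) 0); rewrite hf addrC addKr subrr sub0r normc_opp normcM normcR.
    rewrite (gtr0_norm d2) => /(_ _); rewrite ler_pM2r//; apply.
    by rewrite ltr_pdivrMr// mulr_natr mulr2n ltrDl.
  have [del d0 hd] := hc eps e0; exists del => // w hw.
  by have := hd w hw; rewrite c0 mul0r subr0.
have vert (t : R) : f (Complex 0 t) = f 0.
  have key (h : R[i] -> R) : (forall a b, h a - h b = h (a - b)) -> (forall a, `|h a| <= normc a) ->
      h (f (Complex 0 t)) = h (f (Complex 0 0)).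
    move=> hB hn.
    have der (s : R) : is_derive s 1 (fun s => h (f (Complex 0 s))) (0 : R).
      apply: is_derive0_bound => eps e0; have [del d0 hd] := small (Complex 0 s) eps e0.
      have e s' : normc (Complex 0 s' - Complex 0 s) = `|s' - s|.
        rewrite (_ : Complex 0 s' - Complex 0 s = iC R * Complex (s' - s) 0).
          by rewrite normcM normcR /= expr0n expr1n add0r sqrtr1 mul1r.
        by apply: complex_ext; rewrite !reimE /=; ring.
      exists del => // s' hs; rewrite hB; apply: le_trans (hn _) _.
      by rewrite -e; apply: hd; rewrite e.
    exact: (@is_derive_0_is_cst R (fun s => h (f (Complex 0 s))) t 0 der).
  apply: complex_ext.
    by apply: (key (fun z => re z)) => [a b|a]; [rewrite reB|exact: abs_re_le].
  by apply: (key (fun z => im z)) => [a b|a]; [rewrite imB|exact: abs_im_le].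
move=> z; rewrite -(vert (im z)) -[RHS](hf _ (re z)); congr f.
by apply: complex_ext; rewrite reimE /= ?add0r ?addr0.
Qed.

End RealInvariant.

(** * Gaussian integrals as functions of a complex source *)

Section GaussianFormula.
Context {R : realType} {n : nat} (X : @cspace R n).
Local Notation pt := (@cs_pt R n X).
Local Notation C := R[i].
Local Notation V := 'cV[C]_n.
Local Notation V2 := 'cV[C]_(n + n).

(** Embeds C^n as a totally real subspace of C^{2n}; real quadratic exponents in [x] become complex
    quadratic forms in the doubled variable. *)
Definition dbl (x : V) : V2 := col_mx x (cconjmx x).

Lemma dblD x y : dbl (x + y) = dbl x + dbl y.
Proof. by rewrite /dbl conjD add_col_mx. Qed.

Lemma dblZ (r : R) x : dbl (Complex r 0 *: x) = Complex r 0 *: dbl x.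
Proof. by rewrite /dbl conjZ scale_col_mx /= oppr0. Qed.

(** The doubled points span C^{2n} over the complex numbers: [s1] and [s2] solve [s1 + i s2 = p] and
    [conj s1 + i conj s2 = r]. *)
Lemma dbl_span (b : V2) : exists s1 s2, b = dbl s1 + iC R *: dbl s2.
Proof.
pose p := usubmx b; pose r := dsubmx b.
exists (2^-1 *: (p + cconjmx r)), ((2^-1 * - iC R) *: (p - cconjmx r)).
have c2 : complex.conjc (2^-1 : C) = 2^-1 by rewrite conjc_inv conjc_nat.
have ci : complex.conjc (- iC R) = iC R by rewrite /iC /= opprK oppr0.
have cj : complex.conjc (2^-1 * - iC R : C) = 2^-1 * iC R.
  by transitivity (complex.conjc (2^-1 : C) * complex.conjc (- iC R)); [exact: rmorphM|rewrite c2 ci].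
have i2 := @iC_sqr R.
have ii : iC R * (2^-1 * - iC R) = 2^-1 by rewrite mulrCA mulrN i2 opprK mulr1.
have ij : iC R * (2^-1 * iC R) = - 2^-1 by rewrite mulrCA i2 mulrN1.
rewrite /dbl !conjZ cj c2 !conjD conjN !conjK !scale_col_mx !scalerA ii ij add_col_mx.
rewrite -[LHS]vsubmxK -/p -/r.
have h2 (x y : V) : 2^-1 *: (x + y) + 2^-1 *: (x - y) = x.
  rewrite -scalerDr addrACA subrr addr0.
  have -> : x + x = 2%:R *: x by rewrite scaler_nat mulr2n.
  by rewrite scalerA mulVf ?scale1r// pnatr_eq0.
congr col_mx; first by rewrite h2.
by rewrite scaleNr -scalerN opprB addrC (addrC (cconjmx p)) addrC h2.
Qed.

Lemma mxmeas_dbl d (Y : measurableType d) (q : Y -> V) : mxmeas q -> mxmeas (fun y => dbl (q y)).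
Proof. by move=> mq; apply: mxmeas_col => //; exact: mxmeas_conj. Qed.

Lemma l1_dbl x : l1 (dbl x) = 2 * l1 x.
Proof.
rewrite /l1 big_split_ord /= mulr_natl mulr2n; congr (_ + _); apply: eq_bigr => i _.
  by rewrite col_mxEu.
by rewrite col_mxEd mxE normc_conj.
Qed.

Variables (S : 'M[C]_(n + n)) (del : R).
Hypothesis symS : S^T = S.
Hypothesis d0 : 0 < del.
Hypothesis hS : forall x, del * nsq x <= re (2^-1 * dot (dbl x) (S *m dbl x)).

Definition gw (x : V) : C := cexp (- (2^-1 * dot (dbl x) (S *m dbl x))).

Definition gint (b : V2) : C := laplace X dbl gw b.

Lemma vcmeas_dbl i : vcmeas (fun x => dbl x i 0).
Proof. by move=> d Y q mq; exact: mxmeas_dbl. Qed.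

Lemma vcmeas_gw : vcmeas gw.
Proof.
move=> d Y q mq; apply: cmeas_cexp; apply: cmeasN; apply: cmeasM; first exact: cmeas_cst.
apply: meas_dot; first exact: mxmeas_dbl.
by apply: mxmeasM; [exact: mxmeas_cst|exact: mxmeas_dbl].
Qed.

Lemma gw_le x : normc (gw x) <= 1 * expR (- (del * nsq x)).
Proof. by rewrite mul1r normc_cexp ler_expR reN lerN2. Qed.

Lemma gint_holomorphic : holomorphic gint.
Proof.
apply: (laplace_holomorphic X vcmeas_dbl (L := 2) _ vcmeas_gw d0 gw_le) => y.
by rewrite l1_dbl.
Qed.

Lemma dotS u v : dot u (S *m v) = dot v (S *m u).
Proof. by rewrite dotC dot_mull symS. Qed.

(** Translation of the integration variable by [s], that is, completing the square at a doubled
    point. *)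
Lemma gint_shift (b : V2) (s : V) :
  gint b = cexp (dot b (dbl s) - 2^-1 * dot (dbl s) (S *m dbl s)) * gint (b - S *m dbl s).
Proof.
have mv c := vcmeas_laplace vcmeas_dbl vcmeas_gw c.
have hl y : l1 (dbl y) <= 2 * l1 y by rewrite l1_dbl.
have iv := cintegrable_laplace X vcmeas_dbl hl vcmeas_gw d0 gw_le (b - S *m dbl s).
rewrite /gint /laplace -(cintZ _ measurableT iv) -(cint_translation X s (mv b)).
apply: eq_cint => t _; rewrite /gw -!cexpD; congr cexp.
move: (pt t) => y; rewrite dblD mulmxDr !dotl.
rewrite (dotC (S *m dbl s) (dbl y)) (dotS (dbl s) (dbl y)).
by field.
Qed.

(** For real [tau] this is [gint_shift]. The left side divided by the exponential is entire in [tau]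
    and invariant under real translations, hence constant, which reaches complex [tau]. *)
Lemma gint_line (b : V2) (s : V) (tau : C) :
  gint (b + tau *: (S *m dbl s)) =
  cexp (tau * dot b (dbl s) + 2^-1 * tau ^+ 2 * dot (dbl s) (S *m dbl s)) * gint b.
Proof.
pose u := dot b (dbl s); pose v := dot (dbl s) (S *m dbl s).
pose f tau := cexp (- (tau * u + 2^-1 * tau ^+ 2 * v)) * gint (b + tau *: (S *m dbl s)).
have df z : cdiff f z.
  apply: cdiffM; last exact: holomorphic_line gint_holomorphic _.
  apply: (cdiff_comp (f := @cexp R)); last exact: cdiff_cexp.
  apply: (@cdiff_ext _ (fun z => z * (- u) + z * (z * (- (2^-1 * v))))) => [w|]; first by ring.
  apply: cdiffD; apply: cdiffM; try exact: cdiff_id; try exact: cdiff_cst.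
  by apply: cdiffM; [exact: cdiff_id|exact: cdiff_cst].
have hf z r : f (z + Complex r 0) = f z.
  rewrite /f (gint_shift (b + (z + Complex r 0) *: (S *m dbl s)) (Complex r 0 *: s)).
  have -> : b + (z + Complex r 0) *: (S *m dbl s) - S *m dbl (Complex r 0 *: s) = b + z *: (S *m dbl s).
    by rewrite dblZ -scalemxAr scalerDl addrA addrK.
  rewrite mulrA -cexpD; congr (cexp _ * _).
  rewrite dblZ -scalemxAr !dotl (dotC (S *m dbl s)) -/u -/v.
  by field.
have := real_invariant_cst df hf tau.
rewrite {2}/f mul0r expr0n /= mulr0 mul0r addr0 oppr0 cexp0 mul1r scale0r addr0 => <-.
by rewrite /f mulrA -cexpD subrr cexp0 mul1r.
Qed.

(** Completing the square at a complex point without deforming a contour: [dbl_span] splits [be],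
    and [gint_line] is applied with parameters 1 and [i]. *)
Theorem gint_formula (b be : V2) :
  gint (b + S *m be) = cexp (dot b be + 2^-1 * dot be (S *m be)) * gint b.
Proof.
have [s1 [s2 ->]] := dbl_span be.
have -> : b + S *m (dbl s1 + iC R *: dbl s2) = (b + 1 *: (S *m dbl s1)) + iC R *: (S *m dbl s2).
  by rewrite scale1r mulmxDr -scalemxAr addrA.
rewrite !gint_line mulrA -cexpD; congr (cexp _ * _).
rewrite !mulmxDr -!scalemxAr !dotl (dotC (S *m dbl s1)) (dotS (dbl s2) (dbl s1)).
rewrite (_ : iC R ^+ 2 = -1) ?expr2 ?iC_sqr//.
have := @iC_sqr R; move: (iC R) => i i2.
move: (dot _ _) (dot _ _) (dot _ _) (dot _ _) (dot _ _) => p q r s t.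
by field: i2.
Qed.

End GaussianFormula.

Lemma quadratic_bounded_above {R : realType} (a b K : R) :
  (forall r : R, a * r ^+ 2 + b * r <= K) -> a <= 0.
Proof.
move=> h; rewrite leNgt; apply/negP => a0.
have K0 : 0 <= K by have := h 0; rewrite expr0n /= !mulr0 addr0.
(* Chosen so that [a r + b] exceeds [1 + K] while [r >= 1]. *)
pose r := (1 + K + `|b|) / a + 1.
have b0 := normr_ge0 b; have b1 := ler_norm b; have b2 := lerNnormlW (lexx `|b|).
have ra : a * r = 1 + K + `|b| + a by rewrite /r mulrDr mulr1 mulrCA divff ?mulr1 ?gt_eqF.
have r1 : 1 <= r by rewrite lerDr divr_ge0 ?ltW//; lra.
have := h r; rewrite (_ : a * r ^+ 2 + b * r = (a * r + b) * r); last by ring.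
rewrite ra; nra.
Qed.

Lemma sum0_le {R : realType} (a b c e : R) : a + b = 0 -> c <= a -> e <= b -> 0 <= c -> 0 <= e ->
  c <= 0 /\ e <= 0.
Proof. by move=> *; split; lra. Qed.

Lemma natCE {R : realType} m : (m%:R : R[i]) = Complex m%:R 0.
Proof. by apply: complex_ext; rewrite ?re_natr ?im_natr. Qed.

Lemma invCE {R : realType} m : (m.+1%:R : R[i])^-1 = Complex m.+1%:R^-1 0.
Proof.
have m0 : (m.+1%:R : R[i]) != 0 by rewrite pnatr_eq0.
apply: (mulfI m0); rewrite divff// natCE; apply: complex_ext; rewrite !reimE /=.
  by rewrite mulr0 subr0 divff ?pnatr_eq0.
by rewrite mulr0 mul0r addr0.
Qed.

(** * Quadratic algebra linking the symbol, Lambda and the fundamental matrix *)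

Section WeylAlgebra.
Context {R : realType} {n : nat}.
Local Notation C := R[i].
Local Notation V := 'cV[C]_n.
Local Notation V2 := 'cV[C]_(n + n).
Variables (Q : 'M[C]_(n + n)) (L : 'rV[C]_(n + n)) (A B : 'M[C]_n).
Hypothesis eigm2 : ~~ eigenvalue (fundmx Q) (-2).
Hypothesis hA : A^T = A.
Hypothesis hB : B^T = cconjmx B.
Hypothesis posB : forall v : V, v != 0 -> 0 < re (((cconjmx v)^T *m B *m v) 0 0).

Local Notation herm := (hform B).
Local Notation hq := (hsq B).

(** Complex linear extension of the parametrization of Lambda, with [conj x] as an independent
    variable. Its invertibility, inherited from [B], expresses that Lambda is totally real. *)
Definition lammx : 'M[C]_(n + n) := block_mx 1%:M 0 ((2 / iC R) *: A) ((2 / iC R) *: B^T).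

Lemma LamPtE x : LamPt A B x = lammx *m dbl x.
Proof.
rewrite /LamPt /lammx /dbl mul_block_col mul1mx mul0mx addr0; congr col_mx.
by rewrite /dPhi0 scalerDr -!scalemxAl.
Qed.

Lemma unitB : B \in unitmx.
Proof.
apply: unitmx_inj => x Bx; apply/eqP; apply: contraT => /posB.
by rewrite -mulmxA Bx mulmx0 mxE ltxx.
Qed.

Lemma iC_neq0 : iC R != 0.
Proof. by rewrite eq_complex /= oner_eq0 andbF. Qed.

Lemma two_neq0 : (2 : C) != 0. Proof. by rewrite pnatr_eq0. Qed.

Lemma lammx_inj (z : V2) : lammx *m z = 0 -> z = 0.
Proof.
rewrite -[z]vsubmxK /lammx mul_block_col mul1mx mul0mx addr0 => h.
have /(congr1 usubmx) := h; rewrite col_mxKu (_ : usubmx 0 = 0); last by apply/matrixP => i j; rewrite !mxE.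
move=> h1; have /(congr1 dsubmx) := h; rewrite col_mxKd h1 mulmx0 add0r (_ : dsubmx 0 = 0); last by apply/matrixP => i j; rewrite !mxE.
rewrite -scalemxAl => /eqP; rewrite scaler_eq0 mulf_eq0 invr_eq0 (negbTE iC_neq0) (negbTE two_neq0) /= => /eqP h2.
by rewrite (unitmx_injr _ h2) ?col_mx0// unitmx_tr unitB.
Qed.

Lemma unit_lammx : lammx \in unitmx.
Proof. exact: unitmx_inj lammx_inj. Qed.

Definition hermblock : 'M[C]_(n + n) := block_mx 0 B^T B 0.
(** Half of its quadratic form at [dbl x] is [h(x,x) - (i/4) F] at the point of Lambda over [x]. The
    quarter here and the half in [dvec] arise because the symbol is evaluated at a midpoint, at half
    of the integration variable. *)
Definition Smx : 'M[C]_(n + n) := hermblock - (iC R / 4) *: (lammx^T *m hessQ Q *m lammx).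
Definition dvec : V2 := (iC R / 2) *: (lammx^T *m L^T).

Lemma hessQ_sym : (hessQ Q)^T = hessQ Q.
Proof. by rewrite /hessQ linearD /= trmxK addrC. Qed.

Lemma Smx_sym : Smx^T = Smx.
Proof.
rewrite /Smx linearB /= linearZ /= !trmx_mul trmxK hessQ_sym mulmxA; congr (_ - _).
by rewrite /hermblock tr_block_mx !trmx0 trmxK.
Qed.

Lemma dot_hermblock x : dot (dbl x) (hermblock *m dbl x) = 2 * herm x x.
Proof.
rewrite /hermblock /dbl mul_block_col !mul0mx addr0 add0r dot_col /herm.
by rewrite dot_mulr trmxK dotC; ring.
Qed.

Lemma qformE z : qform Q z = dot z (Q *m z).
Proof. by rewrite /qform /dot mulmxA. Qed.

Lemma dot_hessQ z : dot z (hessQ Q *m z) = 2 * qform Q z.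
Proof. by rewrite /hessQ mulmxDl dotDr -dot_mull (dotC (Q *m z)) qformE; ring. Qed.

Lemma lformE z : lform L z = dot L^T z.
Proof. by rewrite /lform /dot trmxK. Qed.

Lemma dot_Smx x : 2^-1 * dot (dbl x) (Smx *m dbl x) =
  herm x x - iC R / 4 * qform Q (LamPt A B x).
Proof.
rewrite /Smx mulmxBl dotDr dotNr dot_hermblock -scalemxAl dotZr -!mulmxA -dot_mull -LamPtE dot_hessQ.
have t0 := two_neq0; have f0 : (4 : C) != 0 by rewrite pnatr_eq0.
by field.
Qed.

Lemma symb_gw z : cexp (- herm z z) * symb Q L (LamPt A B (2^-1 *: z)) =
  cexp (dot dvec (dbl z)) * gw Smx z.
Proof.
have lam2 : LamPt A B (2^-1 *: z) = 2^-1 *: LamPt A B z.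
  rewrite invCE.
  by rewrite !LamPtE dblZ scalemxAr.
have de : dot dvec (dbl z) = iC R / 2 * dot L^T (LamPt A B z).
  by rewrite /dvec dotZl dot_mull trmxK LamPtE.
rewrite /symb lam2 /gw -!cexpD de dot_Smx; congr cexp.
move: (LamPt A B z) => w; rewrite !qformE lformE.
have -> : Q *m (2^-1 *: w) = 2^-1 *: (Q *m w) by rewrite scalemxAr.
rewrite dotZl !dotZr.
have t0 := two_neq0; have f0 : (4 : C) != 0 by rewrite pnatr_eq0.
by field.
Qed.

Hypothesis bddS : exists M : R, forall x : V, Num.sqrt (sqmod (symb Q L (LamPt A B x))) <= M.

Lemma symb_bound : exists2 M : R, 0 <= M & forall x, normc (symb Q L (LamPt A B x)) <= M.
Proof.
have [M hM] := bddS; exists M => [|x]; last by rewrite normc_sqrt.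
exact: le_trans (sqrtr_ge0 _) (hM 0).
Qed.

Lemma LamPtZ r x : LamPt A B (Complex r 0 *: x) = Complex r 0 *: LamPt A B x.
Proof. by rewrite !LamPtE dblZ scalemxAr. Qed.

(** On the real ray through [x] the modulus of the symbol is [exp (a r^2 + b r)] with [a] this real
    part, and it stays bounded. *)
Lemma re_qform_le0 x : re (iC R * qform Q (LamPt A B x)) <= 0.
Proof.
have [M M0 hM] := symb_bound.
apply: (@quadratic_bounded_above _ _ (re (iC R * lform L (LamPt A B x))) M) => r.
have := hM (Complex r 0 *: x); rewrite normc_cexp LamPtZ => h.
rewrite !qformE !lformE in h *.
have e : Q *m (Complex r 0 *: LamPt A B x) = Complex r 0 *: (Q *m LamPt A B x) by rewrite scalemxAr.
rewrite e dotZl !dotZr in h.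
move: (dot (LamPt A B x) (Q *m LamPt A B x)) (dot L^T (LamPt A B x)) h => a b h.
apply: le_trans h; apply: le_trans (expR_ge1Dx _).
have -> : iC R * (Complex r 0 * (Complex r 0 * a) + Complex r 0 * b) =
  Complex r 0 * (Complex r 0 * (iC R * a)) + Complex r 0 * (iC R * b) by ring.
by move: (iC R * a) (iC R * b) => a' b'; rewrite !reimE /=; lra.
Qed.

(** The symbol contributes with the favourable sign, so the lower bound for the Hermitian form of
    [B] persists. *)
Lemma Smx_lower : exists2 del : R, 0 < del &
  forall x, del * nsq x <= re (2^-1 * dot (dbl x) (Smx *m dbl x)).
Proof.
have [del d0 hdel] := hq_lower hB posB; exists del => // x.
apply: le_trans (hdel x) _; rewrite dot_Smx reB -/(hq x).
have := re_qform_le0 x.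
rewrite (_ : iC R / 4 * _ = Complex (4^-1) 0 * (iC R * qform Q (LamPt A B x))); last first.
  by rewrite -invCE; ring.
by move: (iC R * _) => w; rewrite reM /= mul0r subr0; lra.
Qed.

Lemma nsq_le0 (x : V) : nsq x <= 0 -> x = 0.
Proof.
move=> h; apply/matrixP => i j; rewrite (ord1 j) mxE; apply/eqP; rewrite -normc_eq0.
rewrite -sqrf_eq0 normc_sqr eq_le sqmod_ge0 andbT (le_trans _ h)//.
by rewrite /nsq (bigD1 i)//= lerDl sumr_ge0// => k _; exact: sqmod_ge0.
Qed.

(** A null vector [dbl s1 + i dbl s2] is paired, after applying [S], with [dbl s1 - i dbl s2]. The
    cross terms cancel by symmetry of [S], leaving two quadratic values with nonnegative real parts
    and zero sum. *)
Lemma unit_Smx : Smx \in unitmx.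
Proof.
have [del d0 hdel] := Smx_lower.
apply: unitmx_inj => be h; have [s1 [s2 E]] := dbl_span be.
have h0 : re (2^-1 * dot (dbl s1) (Smx *m dbl s1)) + re (2^-1 * dot (dbl s2) (Smx *m dbl s2)) = 0.
  have : dot (dbl s1 - iC R *: dbl s2) (Smx *m be) = 0 by rewrite h dot0r.
  rewrite E mulmxDr -scalemxAr !dotl (dotS Smx_sym (dbl s2) (dbl s1)).
  move=> e; rewrite -reD -mulrDr.
  have -> : dot (dbl s1) (Smx *m dbl s1) + dot (dbl s2) (Smx *m dbl s2) = 0.
    by rewrite -e; have := @iC_sqr R; move: (iC R) => i i2; ring: i2.
  by rewrite mulr0.
have [l1 l2] := sum0_le h0 (hdel s1) (hdel s2) (mulr_ge0 (ltW d0) (nsq_ge0 s1)) (mulr_ge0 (ltW d0) (nsq_ge0 s2)).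
rewrite pmulr_rle0// in l1; rewrite pmulr_rle0// in l2.
have z1 := nsq_le0 l1; have z2 := nsq_le0 l2.
rewrite E z1 z2 (_ : dbl 0 = 0) ?scaler0 ?addr0//.
by rewrite /dbl conj0 col_mx0.
Qed.

(** Applied to [omv x s] and paired with [dbl z] it gives [2 h(z,s) + 2 h(x,z)]: the reproducing
    factor and the cross term of the Weyl kernel. *)
Definition srcmx : 'M[C]_(n + n) := block_mx (2 *: B^T) 0 0 (2 *: B).
(** Hessian of the kernel exponent in the variable [omv x s]: the first term is the completed
    square, the second accounts for the factor [exp (- 2 h(x,s))] left by the translation by [x]. *)
Definition Nmx : 'M[C]_(n + n) :=
  srcmx^T *m invmx Smx *m srcmx - block_mx 0 (2 *: B) (2 *: B^T) 0.
Definition evec : V2 := (invmx Smx *m srcmx)^T *m dvec.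

(** The kernel is holomorphic in [x] and antiholomorphic in [s], so [conj s] and [x] are its
    holomorphic variables. *)
Definition omv (x s : V) : V2 := col_mx (cconjmx s) x.

Lemma kernel_exponent x s :
  - (2 * herm x s) + (dot dvec (invmx Smx *m (srcmx *m omv x s)) +
     2^-1 * dot (invmx Smx *m (srcmx *m omv x s)) (Smx *m (invmx Smx *m (srcmx *m omv x s)))) =
  2^-1 * dot (omv x s) (Nmx *m omv x s) + dot evec (omv x s).
Proof.
rewrite (mulKVmx unit_Smx) /Nmx mulmxBl dotDr dotNr /evec.
rewrite [dot ((invmx Smx *m srcmx)^T *m _) _]dot_mull trmxK.
rewrite -!mulmxA [dot (omv x s) (srcmx^T *m _)]dot_mulr trmxK.
rewrite [dot (invmx _ *m _) _]dotC.
have -> : dot (omv x s) (block_mx 0 (2 *: B) (2 *: B^T) 0 *m omv x s) = 4 * herm x s.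
  rewrite /omv mul_block_col !mul0mx addr0 add0r dot_col -!scalemxAl !dotZr /herm.
  by rewrite [dot x _]dot_mulr trmxK [dot (B *m x) _]dotC; ring.
have t0 := two_neq0.
by field.
Qed.

Lemma src_omv x s z : dot (srcmx *m omv x s) (dbl z) = 2 * herm z s + 2 * herm x z.
Proof.
rewrite /srcmx /omv /dbl mul_block_col !mul0mx addr0 add0r dot_col -!scalemxAl !dotZl /herm.
by rewrite dot_mull trmxK [dot (B *m x) _]dotC.
Qed.

Lemma Nmx_sym : Nmx^T = Nmx.
Proof.
rewrite /Nmx linearB /= !trmx_mul trmxK trmx_inv Smx_sym mulmxA; congr (_ - _).
by rewrite tr_block_mx !trmx0 !linearZ /= trmxK.
Qed.

(* A null vector of the mixed block of the kernel exponent produces an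
   eigenvector of the fundamental matrix for the eigenvalue -2. *)
Lemma mixed_block_inj (x : V) : usubmx (Nmx *m col_mx (0 : V) x) = 0 -> x = 0.
Proof.
move=> h; apply/eqP; apply: contraT => x0; case/negP: eigm2.
pose b := srcmx *m col_mx 0 x.
have bE : b = col_mx 0 ((2 *: B) *m x).
  by rewrite /b /srcmx mul_block_col !mul0mx mulmx0 addr0 add0r.
(* The critical point of the Gaussian exponent with source [b]. *)
pose w := invmx Smx *m b; pose p := usubmx w; pose r := dsubmx w.
have wE : w = col_mx p r by rewrite vsubmxK.
(* The first block of [N] at [(0, x)] is [2 B (p - x)]. *)
have px : p = x.
  have e : Nmx *m col_mx 0 x = col_mx ((2 *: B) *m p - (2 *: B) *m x) ((2 *: B^T) *m r).
    rewrite /Nmx mulmxBl -!mulmxA -/b -/w wE /srcmx tr_block_mx !trmx0 !linearZ /= trmxK.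
    by rewrite !mul_block_col !mul0mx !mulmx0 !addr0 !add0r opp_col_mx add_col_mx oppr0 addr0.
  move: h; rewrite e col_mxKu -mulmxBr -scalemxAl => /eqP.
  rewrite scaler_eq0 (negbTE two_neq0) /= => /eqP h.
  by apply/subr0_eq; exact: unitmx_injr unitB _ h.
have Sw : Smx *m col_mx x r = b by rewrite -px -wE /w (mulKVmx unit_Smx).
pose ze := lammx *m col_mx x r.
pose J : 'M[C]_(n + n) := block_mx 0 1%:M (- 1%:M) 0.
have fE : fundmx Q = J *m hessQ Q.
  rewrite /fundmx -[in RHS](submxK (hessQ Q)) /J mulmx_block !mul0mx !mul1mx !addr0 !add0r.
  by rewrite !mulNmx !mul1mx.
(* The equation [S w = b] pulled back by the transpose of [lammx]; the terms in [A] cancel by its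
   symmetry. Applying [J], with [J J = -1] and [fundmx = J H], produces the eigenvalue -2. *)
have Hze : hessQ Q *m ze = 2 *: (J *m ze).
  have ut : lammx^T \in unitmx by rewrite unitmx_tr unit_lammx.
  apply/subr0_eq; apply: unitmx_injr ut _ _.
  rewrite mulmxBr.
  have e1 : (iC R / 4) *: (lammx^T *m (hessQ Q *m ze)) = col_mx (B^T *m r) (- (B *m x)).
    move: Sw; rewrite /Smx mulmxBl -scalemxAl -!mulmxA -/ze bE /hermblock mul_block_col !mul0mx addr0 add0r.
    move=> e; have -> : col_mx (B^T *m r) (- (B *m x)) =
        col_mx (B^T *m r) (B *m x) - col_mx 0 ((2 *: B) *m x).
      rewrite opp_col_mx add_col_mx oppr0 addr0 -scalemxAl; congr col_mx.
      by rewrite scaler_nat mulr2n opprD addrA subrr add0r.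
    by rewrite -e opprB addrC subrK.
  have e2 : lammx^T *m (J *m ze) = (2 / iC R) *: col_mx (B^T *m r) (- (B *m x)).
    rewrite /ze /lammx /J tr_block_mx trmx0 trmx1 !linearZ /= trmxK hA.
    rewrite !mul_block_col !mul0mx !mul1mx !addr0 !add0r mulNmx mul1mx scale_col_mx.
    rewrite !mulmxN -!scalemxAl ?scalerN; congr col_mx.
    by rewrite addrAC subrr add0r.
  rewrite -scalemxAr e2 scalerA.
  have i0 := iC_neq0.
  have f4 : (4 : C) != 0 by rewrite pnatr_eq0.
  have -> : lammx^T *m (hessQ Q *m ze) = (4 / iC R) *: ((iC R / 4) *: (lammx^T *m (hessQ Q *m ze))).
    by rewrite scalerA (_ : 4 / iC R * _ = 1) ?scale1r//; field; rewrite i0.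
  rewrite e1 (_ : 2 * (2 / iC R) = 4 / iC R) ?subrr//; ring.
have ev : (fundmx Q - (-2)%:M) *m ze = 0.
  rewrite mulmxBl fE -mulmxA Hze -scalemxAr mulmxA.
  have -> : J *m J = - 1%:M.
    by rewrite /J mulmx_block !mul0mx !mulmx0 !mul1mx !mulmx1 !addr0 !add0r scalar_mx_block opp_block_mx !oppr0.
  by rewrite mulNmx mul1mx mul_scalar_mx scalerN scaleNr opprK addNr.
rewrite /eigenvalue /eigenspace kermx_eq0 row_free_unit; apply/negP => u.
have := unitmx_injr u ev => /lammx_inj /eqP; rewrite col_mx_eq0 => /andP[/eqP xz _].
by rewrite xz eqxx in x0.
Qed.

End WeylAlgebra.

(** * The Gaussian kernel, its bound and the definiteness of its phase *)

Section Kernel.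
Context {R : realType} {n : nat} (X : @cspace R n).
Local Notation mu := (cs_mu X).
Local Notation pt := (@cs_pt R n X).
Local Notation C := R[i].
Local Notation V := 'cV[C]_n.
Local Notation V2 := 'cV[C]_(n + n).
Variables (Q : 'M[C]_(n + n)) (L : 'rV[C]_(n + n)) (A B : 'M[C]_n).
Hypothesis eigm2 : ~~ eigenvalue (fundmx Q) (-2).
Hypothesis hA : A^T = A.
Hypothesis hB : B^T = cconjmx B.
Hypothesis posB : forall v : V, v != 0 -> 0 < re (((cconjmx v)^T *m B *m v) 0 0).
Hypothesis bddS : exists M : R, forall x : V, Num.sqrt (sqmod (symb Q L (LamPt A B x))) <= M.

Local Notation herm := (hform B).
Local Notation hq := (hsq B).
Local Notation S := (Smx Q A B).
Local Notation N := (Nmx Q A B).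

Lemma vcmeas_symb : vcmeas (fun x : V => symb Q L (LamPt A B x)).
Proof.
move=> d Y q mq; apply: cmeas_cexp; apply: cmeasM; first exact: cmeas_cst.
have ml : mxmeas (fun y => LamPt A B (q y)).
  have -> : (fun y => LamPt A B (q y)) = (fun y => lammx A B *m dbl (q y)).
    by apply/funext => y; rewrite LamPtE.
  by apply: mxmeasM; [exact: mxmeas_cst|exact: mxmeas_dbl].
apply: cmeasD.
  apply: mxmeasM; last exact: ml.
  by apply: mxmeasM; [exact: mxmeas_tr|exact: mxmeas_cst].
by apply: mxmeasM; [exact: mxmeas_cst|exact: ml].
Qed.

(** The Weyl kernel times the reproducing factor; its integral over [y] is the kernel that acts on
    [twisted u]. *)
Definition kern_integrand (x s y : V) : C :=
  cexp (herm (x - y) (x + y)) * symb Q L (LamPt A B (2^-1 *: (x + y))) * cexp (2 * herm y s).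

Lemma vcmeas_kern x s : vcmeas (kern_integrand x s).
Proof.
move=> d Y q mq; apply: cmeasM; first apply: cmeasM.
- apply: cmeas_cexp; apply: meas_herm; apply: mxmeasD; try exact: mxmeas_cst.
    by apply: mxmeasN; exact: mq.
  exact: mq.
- have mm : mxmeas (fun y => 2^-1 *: (x + q y)).
    by apply: mxmeasZ; [exact: cmeas_cst|apply: mxmeasD; [exact: mxmeas_cst|exact: mq]].
  exact: (@vcmeas_symb _ _ (fun y => 2^-1 *: (x + q y)) mm).
- apply: cmeas_cexp; apply: cmeasM; first exact: cmeas_cst.
  by apply: meas_herm => //; exact: mxmeas_cst.
Qed.

Definition kernel_exp (x s : V) : C :=
  2^-1 * dot (omv x s) (N *m omv x s) + dot (evec Q L A B) (omv x s).

Definition kernel_cst : C := gint X S (dvec L A B).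

(** Translating by [- x] makes [z = x + y] the variable and puts the symbol at [z / 2], where
    [symb_gw] yields a Gaussian with linear source. [gint_formula] at the shift [S^-1 src] then
    extracts the dependence on [x] and [s]. *)
Lemma kernel_eq x s :
  cint mu setT (fun t => kern_integrand x s (pt t)) = kernel_cst * cexp (kernel_exp x s).
Proof.
have [del d0 hdel] := Smx_lower hB posB bddS.
have symS := Smx_sym Q A B.
rewrite -(cint_translation X (- x) (@vcmeas_kern x s)).
pose b := dvec L A B + srcmx B *m omv x s.
have hl (y : V) : l1 (dbl y) <= 2 * l1 y :> R by rewrite l1_dbl.
have ib := @cintegrable_laplace R n X _ dbl (gw S) 2 1 del (@vcmeas_dbl R n) hl (@vcmeas_gw R n S) d0 (@gw_le R n S del hdel) b.
transitivity (cexp (- (2 * herm x s)) * gint X S b).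
  rewrite /gint /laplace -(cintZ _ measurableT ib); apply: eq_cint => t _.
  move: (pt t) => z; rewrite /kern_integrand.
  have -> : x + (z - x) = z by rewrite addrC subrK.
  have -> : cexp (herm (x - (z - x)) z) = cexp (2 * herm x z) * cexp (- herm z z).
    by rewrite -cexpD; congr cexp; rewrite opprB addrA hermDl hermNl hermDl; ring.
  have -> : cexp (2 * herm (z - x) s) = cexp (- (2 * herm x s)) * cexp (2 * herm z s).
    by rewrite -cexpD; congr cexp; rewrite hermDl hermNl; ring.
  have e2 := symb_gw Q L A B z.
  rewrite -(mulrA (cexp (2 * herm x z))) e2 /b dotDl src_omv !cexpD.
  by ring.
have -> : b = dvec L A B + S *m (invmx S *m (srcmx B *m omv x s)).
  by rewrite (mulKVmx (unit_Smx hB posB bddS)).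
rewrite (gint_formula X symS d0 hdel) mulrA -cexpD mulrC; congr (_ * cexp _).
exact: (kernel_exponent hB posB bddS).
Qed.

Lemma re_hermBD x y : re (herm (x - y) (x + y)) = hq x - hq y.
Proof. by rewrite hermDl hermNl !hermDr /hq reB !reD (hform_conj hB y x) reJ; ring. Qed.

Lemma hqB x y : hq (x - y) = hq x - 2 * re (herm x y) + hq y.
Proof. by rewrite (hqD hB) hermNr reN /hq hermNl hermNr opprK; ring. Qed.

(** The exponent [h(x,x) - h(y,y) + 2 Re h(y,s)] equals [h(x,x) + h(s,s) - h(y-s,y-s)]. *)
Lemma normc_kern x s y M : (forall x, normc (symb Q L (LamPt A B x)) <= M) ->
  normc (kern_integrand x s y) <= M * expR (hq x + hq s) * expR (- hq (y - s)).
Proof.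
move=> hM; rewrite /kern_integrand 2!normcM (normc_cexp (herm _ _)) (normc_cexp (2 * _)) re_hermBD re2M.
have -> : M * expR (hq x + hq s) * expR (- hq (y - s)) =
  expR (hq x - hq y) * M * expR (2 * re (herm y s)).
  rewrite hqB [_ * M]mulrC -(mulrA M) -expRD -(mulrA M) -expRD.
  move: (hq x) (hq s) (hq y) (re _) => a b c d; congr (_ * expR _); ring.
by apply: ler_wpM2r; [exact: expR_ge0|apply: ler_wpM2l; [exact: expR_ge0|exact: hM]].
Qed.

Lemma kernel_bound : exists2 M : R, 0 <= M &
  forall x s, normc (kernel_cst * cexp (kernel_exp x s)) <= M * expR (hq x + hq s).
Proof.
have [M M0 hM] := symb_bound bddS.
have [del d0 hdel] := hq_lower hB posB.
pose J := Rintegral mu setT (fun t => expR (- (del * nsq (pt t)))).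
have J0 : 0 <= J by apply: Rintegral_ge0 => t _; exact: expR_ge0.
exists (2 * (M * J)) => [|x s]; first by rewrite !mulr_ge0.
rewrite -kernel_eq.
have ig := integrable_gauss X s d0.
have ig2 : mu.-integrable setT (EFin \o (fun t => M * expR (hq x + hq s) * expR (- (del * nsq (pt t - s))))).
  by have := integrableZl measurableT (M * expR (hq x + hq s)) ig; apply: eq_integrable.
have hk y : normc (kern_integrand x s y) <= M * expR (hq x + hq s) * expR (- (del * nsq (y - s))).
  apply: le_trans (normc_kern x s y hM) _; apply: ler_wpM2l; first by rewrite mulr_ge0 ?expR_ge0.
  by rewrite ler_expR lerN2.
have ik := cintegrable_gauss X d0 (@vcmeas_kern x s) hk.
apply: le_trans (normc_cint measurableT ik ig2 (fun t _ => hk (pt t))) _.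
rewrite RintegralZl//.
have -> : Rintegral mu setT (fun t => expR (- (del * nsq (pt t - s)))) = J.
  by rewrite /J /Rintegral gauss_integral_shift.
by rewrite le_eqVlt; apply/orP; left; apply/eqP; ring.
Qed.

Definition BB : 'M[C]_(n + n) := block_mx B^T 0 0 B.
(** The polarized quadratic part of the phase in the variables [(conj s, x)]. The first block of
    [BB] is [B^T] because that variable is conjugated. *)
Definition phase_quad (o o' : V2) : R := re (dot (cconjmx o') (BB *m o)) - re (2^-1 * dot o (N *m o')).
Definition phase_lin (o : V2) : R := re (dot (evec Q L A B) o).
(** Logarithm of the modulus of the exponential kernel after absorbing one weight on each side. *)
Definition kernel_phase (x s : V) : R := re (kernel_exp x s) - hq x - hq s.

Lemma BB_herm : BB^T = cconjmx BB.
Proof.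
rewrite /BB tr_block_mx !trmx0 trmxK /cconjmx map_block_mx -/(cconjmx B) -/(cconjmx B^T).
rewrite -hB conjT -hB trmxK; congr block_mx; apply/matrixP => i j; rewrite !mxE rmorph0//.
Qed.

Lemma kp_rbilin : rbilin phase_quad.
Proof.
have [s1 a1 z1] := rbilin_herm BB_herm.
split => [x y|x y z|r x z]; rewrite /phase_quad.
- by rewrite (s1 x y) (dotS (Nmx_sym Q A B) x y).
- have := a1 x y z; rewrite /hform => ->.
  by rewrite dotDl mulrDr reD; ring.
- have := z1 r x z; rewrite /hform => ->.
  by rewrite dotZl mulrCA [re (Complex r 0 * _)]reM /= mul0r subr0; ring.
Qed.

Lemma krD o o' : phase_lin (o + o') = phase_lin o + phase_lin o'.
Proof. by rewrite /phase_lin dotDr reD. Qed.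
Lemma krZ r o : phase_lin (Complex r 0 *: o) = r * phase_lin o.
Proof. by rewrite /phase_lin dotZr reM /= mul0r subr0. Qed.

Lemma kphaseE x s : kernel_phase x s = phase_lin (omv x s) - phase_quad (omv x s) (omv x s).
Proof.
rewrite /kernel_phase /kernel_exp reD /phase_lin /phase_quad /BB /omv mul_block_col !mul0mx addr0 add0r conj_col conjK dot_col reD.
have -> : re (dot s (B^T *m cconjmx s)) = hq s.
  by rewrite dot_mulr trmxK dotC.
rewrite -/(hq x) /hq /hform; ring.
Qed.

Hypothesis kcst0 : kernel_cst != 0.

Lemma kphase_bounded : exists K : R, forall x s, kernel_phase x s <= K.
Proof.
have [M M0 hM] := kernel_bound; have c0 : 0 < normc kernel_cst by rewrite normc_gt0.
exists (M / normc kernel_cst) => x s.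
have := hM x s; rewrite normcM normc_cexp mulrC -ler_pdivlMr// => h.
have h2 : expR (kernel_phase x s) <= M / normc kernel_cst.
  rewrite /kernel_phase -addrA -opprD expRD expRN ler_pdivrMr ?expR_gt0//.
  by apply: le_trans h _; rewrite mulrAC.
by have := expR_ge1Dx (kernel_phase x s); lra.
Qed.

Definition omr (x : V) : V2 := col_mx 0 x.
Definition oml (s : V) : V2 := col_mx (cconjmx s) 0.

Lemma omvE x s : omv x s = oml s + omr x.
Proof. by rewrite /omv /oml /omr add_col_mx addr0 add0r. Qed.

Lemma omv_surj (o : V2) : o = omv (dsubmx o) (cconjmx (usubmx o)).
Proof. by rewrite /omv conjK vsubmxK. Qed.

Lemma kp_ge0 o : 0 <= phase_quad o o.
Proof.
have [K hK] := kphase_bounded; rewrite -oppr_le0.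
apply: (@quadratic_bounded_above _ _ (phase_lin o) K) => r.
have := hK (dsubmx (Complex r 0 *: o)) (cconjmx (usubmx (Complex r 0 *: o))).
rewrite kphaseE -omv_surj krZ (rb_scale kp_rbilin) (rb_scaler kp_rbilin); lra.
Qed.

(** [BB] is block diagonal, so only the mixed block of [N] pairs the two variables. *)
Lemma kp_mixed o1 x : phase_quad (col_mx o1 0) (omr x) = - re (2^-1 * dot o1 (usubmx (N *m omr x))).
Proof.
rewrite /phase_quad /BB /omr mul_block_col !mulmx0 !mul0mx addr0 add0r conj_col conj0 dot_col dot0l dot0r.
rewrite addr0 sub0r -[N *m _ in LHS]vsubmxK dot_col dot0l addr0; congr (- re _); by rewrite add0r.
Qed.

(** The scalars 1 and [i] recover the real and the imaginary part of the complex pairing. *)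
Lemma mixed_zero o1 x : (forall c : C, phase_quad (c *: col_mx o1 0) (omr x) = 0) ->
  dot o1 (usubmx (N *m omr x)) = 0.
Proof.
move=> h.
have h1 := h 1; have h2 := h (iC R); rewrite !scale_col_mx !scaler0 !kp_mixed !dotZl invCE in h1 h2.
move: (dot _ _) h1 h2 => w; rewrite mul1r !reimE /= => h1 h2.
by apply: complex_ext => /=; lra.
Qed.

Lemma dot_delta (w : V) i : dot (delta_mx i 0) w = w i 0.
Proof. by rewrite /dot trmx_delta -rowE mxE. Qed.

(** In a semidefinite form a null direction is orthogonal to everything. Tested against the other
    variable, this says that the mixed block kills [x]. *)
Lemma kp_posr x : x != 0 -> 0 < phase_quad (omr x) (omr x).
Proof.
move=> x0; rewrite lt_def kp_ge0 andbT; apply/negP => /eqP h; case/negP: x0; apply/eqP.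
apply: (mixed_block_inj eigm2 hA hB posB bddS).
apply/matrixP => i j; rewrite (ord1 j) [RHS]mxE -dot_delta.
apply: mixed_zero => c; rewrite (rb_sym kp_rbilin).
exact: (rb_semidef_radical kp_rbilin _ kp_ge0 h).
Qed.

(** Here a null direction is killed by the transposed mixed block. The block is square and
    injective, so its transpose is injective too. *)
Lemma kp_posl s : s != 0 -> 0 < phase_quad (oml s) (oml s).
Proof.
move=> s0; rewrite lt_def kp_ge0 andbT; apply/negP => /eqP h; case/negP: s0; apply/eqP.
pose N12 : 'M[C]_n := ursubmx N.
have NE x : usubmx (N *m omr x) = N12 *m x.
  by rewrite -[N in LHS]submxK /omr mul_block_col !mulmx0 !add0r col_mxKu.
have uN : N12 \in unitmx.
  by apply: unitmx_inj => x; rewrite -NE => /(mixed_block_inj eigm2 hA hB posB bddS).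
have d0 x : dot (cconjmx s) (N12 *m x) = 0.
  rewrite -NE; apply: mixed_zero => c.
  rewrite (rb_sym kp_rbilin) -[LHS](rb_sym kp_rbilin).
  (* The mixed part is complex bilinear: the scalar moves to the other argument and the null
     direction itself is left. *)
  have -> : phase_quad (c *: col_mx (cconjmx s) 0) (omr x) = phase_quad (col_mx (cconjmx s) 0) (omr (c *: x)).
    by rewrite scale_col_mx scaler0 !kp_mixed /omr -[in RHS](scaler0 _ c) -scale_col_mx -scalemxAr linearZ /= dotZl dotZr.
  exact: (rb_semidef_radical kp_rbilin _ kp_ge0 h).
have : N12^T *m cconjmx s = 0.
  apply/matrixP => i j; rewrite (ord1 j) [RHS]mxE.
  have := d0 (delta_mx i 0).
  by rewrite dot_mulr dotC dot_delta.
move/(unitmx_injr (etrans (unitmx_tr _) uN)) => cs.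
by rewrite -(conjK s) cs conj0.
Qed.

End Kernel.

(** * Exponentials of quadratic polynomials are entire *)

Section HolomorphicQuadratic.
Context {R : realType}.
Local Notation C := R[i].

Lemma holomorphicM n (u v : 'cV[C]_n -> C) : holomorphic u -> holomorphic v ->
  holomorphic (fun x => u x * v x).
Proof. by move=> hu hv x; exact: (@differentiableM _ _ _ _ x (hu x) (hv x)). Qed.

Lemma holomorphic_cst n (c : C) : holomorphic (fun _ : 'cV[C]_n => c).
Proof. by move=> x; exact: (@differentiable_cst _ _ _ (c : (C : numFieldType)^o)). Qed.

Lemma l1_mulmx m n (M : 'M[C]_(m, n)) : exists2 K : R, 0 <= K & forall x : 'cV[C]_n, l1 (M *m x) <= K * l1 x.
Proof.
exists (\sum_i \sum_j normc (M i j)) => [|x].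
  by apply: sumr_ge0 => i _; apply: sumr_ge0 => j _; exact: normc_ge0.
rewrite {1}/l1 mulr_suml; apply: ler_sum => i _.
rewrite mxE mulr_suml; apply: le_trans (normc_sum _ _ _) _; apply: ler_sum => j _.
by rewrite normcM ler_wpM2l ?normc_ge0// normc_le_l1.
Qed.

(** For [l1 h <= 1] the exponent changes by [z = d.h + h.Mh], of modulus at most [(D + K) l1 h].
    Both [h.Mh] and the remainder of the exponential at [z] are then quadratic in [h]. *)
Lemma holomorphic_cexp_quadratic n (M : 'M[C]_n) (e : 'cV[C]_n) :
  holomorphic (fun x => cexp (dot x (M *m x) + dot e x)).
Proof.
apply: holomorphic_of_expand => x.
have [K K0 hK] := l1_mulmx M.
pose q x := dot x (M *m x) + dot e x.
pose d := M *m x + M^T *m x + e.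
exists (cexp (q x) *: d).
pose D := l1 d; have D0 : 0 <= D := l1_ge0 d.
exists (normc (cexp (q x)) * (5 * (D + K) ^+ 2 * expR (D + K) + K)) => h h1.
have h0 := l1_ge0 h.
have -> : \sum_i (cexp (q x) *: d) i 0 * h i 0 = cexp (q x) * dot d h.
  by rewrite -dotZl dotE.
have qD : q (x + h) = q x + (dot d h + dot h (M *m h)).
  rewrite /q /d mulmxDr !dotDl !dotDr (dot_mull M^T) trmxK (dotC (M *m x)); ring.
set z := dot d h + dot h (M *m h) in qD.
rewrite -/(q (x + h)) -/(q x) qD cexpD.
have -> : cexp (q x) * cexp z - cexp (q x) - cexp (q x) * dot d h =
  cexp (q x) * ((cexp z - 1 - z) + dot h (M *m h)) by rewrite /z; ring.
rewrite normcM -[leRHS]mulrA; apply: ler_wpM2l; first exact: normc_ge0.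
have b1 : normc (dot h (M *m h)) <= K * l1 h ^+ 2.
  apply: le_trans (normc_dot _ _) _; rewrite mulrC expr2 mulrA.
  by apply: ler_wpM2r.
have b2 : normc z <= (D + K) * l1 h.
  apply: le_trans (normcD _ _) _.
  have := normc_dot d h; rewrite -/D => b3.
  have : K * l1 h ^+ 2 <= K * l1 h by rewrite ler_wpM2l// expr2 ler_piMr.
  lra.
have b4 : normc z <= D + K by apply: le_trans b2 _; rewrite ler_piMr// addr_ge0.
apply: le_trans (normcD _ _) _; rewrite mulrDl; apply: lerD => //.
apply: le_trans (cexp_sub1B_le _) _.
have -> : 5 * (D + K) ^+ 2 * expR (D + K) * l1 h ^+ 2 = 5 * ((D + K) * l1 h) ^+ 2 * expR (D + K) by ring.
apply: ler_pM; rewrite ?expR_ge0 ?ler_expR//.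
  by rewrite mulr_ge0 ?sqr_ge0.
by rewrite ler_wpM2l// ler_pXn2r ?nnegrE ?normc_ge0 ?mulr_ge0 ?addr_ge0.
Qed.

End HolomorphicQuadratic.

(** * Gaussian decay of the reduced kernel in each variable *)

Section Decay.
Context {R : realType} {n : nat} (X : @cspace R n).
Local Notation C := R[i].
Local Notation V := 'cV[C]_n.
Local Notation V2 := 'cV[C]_(n + n).
Variables (Q : 'M[C]_(n + n)) (L : 'rV[C]_(n + n)) (A B : 'M[C]_n).
Hypothesis eigm2 : ~~ eigenvalue (fundmx Q) (-2).
Hypothesis hA : A^T = A.
Hypothesis hB : B^T = cconjmx B.
Hypothesis posB : forall v : V, v != 0 -> 0 < re (((cconjmx v)^T *m B *m v) 0 0).
Hypothesis bddS : exists M : R, forall x : V, Num.sqrt (sqmod (symb Q L (LamPt A B x))) <= M.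
Hypothesis kcst0 : kernel_cst X Q L A B != 0.

Local Notation N := (Nmx Q A B).
Local Notation kp := (phase_quad Q A B).
Local Notation kr := (phase_lin Q L A B).
Local Notation kphase := (kernel_phase Q L A B).

(** Freezing the other variable at [c] alters the linear part and the additive constant, but neither
    the quadratic part nor the total upper bound [K]. The rate is therefore uniform in [c]; only the
    centre [z] moves. *)
Lemma kphase_decay_along (f : V -> V2) (K : R) :
  (forall x y, f (x + y) = f x + f y) -> (forall r x, f (Complex r 0 *: x) = Complex r 0 *: f x) ->
  (forall y, y != 0 -> 0 < kp (f y) (f y)) -> (forall o, kr o - kp o o <= K) ->
  exists2 del, 0 < del & forall c, exists z, forall y,
    kr (f y + c) - kp (f y + c) (f y + c) <= K + 1 - del * nsq (y - z).
Proof.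
move=> fD fZ pos hK; have kb := kp_rbilin Q A hB.
pose p x y := kp (f x) (f y).
have pb : rbilin p.
  split => [x y|x y z|r x z]; rewrite /p ?fD ?fZ; first exact: (rb_sym kb).
    exact: (rb_add kb).
  exact: (rb_scale kb).
have [d d0 hd] := rb_posdef_lower pb pos.
exists (d / 2) => [|c]; first by rewrite divr_gt0.
pose a y := kr (f y) - 2 * kp (f y) c.
have E y : kr (f y + c) - kp (f y + c) (f y + c) = a y - p y y + (kr c - kp c c).
  rewrite /a /p krD (rb_add kb) !(rb_addr kb) (rb_sym kb c (f y)).
  by move: (kr _) (kr _) (kp _ _) (kp _ _) (kp _ _) => k1 k2 k3 k4 k5; ring.
have aD y z : a (y + z) = a y + a z by rewrite /a fD krD (rb_add kb); move: (kr _) (kr _) (kp _ _) (kp _ _) => k1 k2 k3 k4; ring.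
have aZ r y : a (Complex r 0 *: y) = r * a y by rewrite /a fZ krZ (rb_scale kb); move: (kr _) (kp _ _) => k1 k2; ring.
have [|z hz] := rb_concave_decay pb (K := K - (kr c - kp c c)) aD aZ d0 hd.
  by move=> y; have := hK (f y + c); rewrite E; lra.
by exists z => y; rewrite E; have := hz y; lra.
Qed.

Lemma omlD x y : oml (x + y) = oml x + oml y :> V2.
Proof. by rewrite /oml conjD add_col_mx addr0. Qed.
Lemma omlZ (r : R) x : oml (Complex r 0 *: x) = Complex r 0 *: oml x :> V2.
Proof. by rewrite /oml conjZ scale_col_mx scaler0 /= oppr0. Qed.
Lemma omrD x y : omr (x + y) = omr x + omr y :> V2.
Proof. by rewrite /omr add_col_mx addr0. Qed.
Lemma omrZ (c : C) x : omr (c *: x) = c *: omr x :> V2.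
Proof. by rewrite /omr scale_col_mx scaler0. Qed.

Lemma kphase_decay : exists K : R, exists2 del : R, 0 < del &
  (forall x, exists z, forall s, kphase x s <= K - del * nsq (s - z)) /\
  (forall s, exists z, forall x, kphase x s <= K - del * nsq (x - z)).
Proof.
have [K hK] := kphase_bounded hB posB bddS kcst0.
have hK' o : kr o - kp o o <= K.
  by rewrite (omv_surj o) -(kphaseE Q L A B).
have [d1 d10 h1] := kphase_decay_along omlD omlZ (kp_posl eigm2 hA hB posB bddS kcst0) hK'.
have [d2 d20 h2] := kphase_decay_along omrD (fun r => @omrZ (Complex r 0)) (kp_posr eigm2 hA hB posB bddS kcst0) hK'.
exists (K + 1); exists (Num.min d1 d2); first by rewrite lt_min d10.
have m1 : Num.min d1 d2 <= d1 by rewrite ge_min lexx.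
have m2 : Num.min d1 d2 <= d2 by rewrite ge_min lexx orbT.
split=> [x|s].
  have [z hz] := h1 (omr x); exists z => s.
  rewrite (kphaseE Q L A B) omvE; apply: le_trans (hz s) _.
  by rewrite lerD2l lerN2 ler_wpM2r ?nsq_ge0.
have [z hz] := h2 (oml s); exists z => x.
rewrite (kphaseE Q L A B) omvE [oml s + _]addrC; apply: le_trans (hz x) _.
by rewrite lerD2l lerN2 ler_wpM2r ?nsq_ge0.
Qed.

(** Coefficient of the term of the exponent that mixes [x] and [s]; it is antilinear in [s]. *)
Definition couple (s : V) : V := dsubmx (N *m oml s).
Definition xquad : 'M[C]_n := 2^-1 *: drsubmx N.
Definition xlin : V := dsubmx (evec Q L A B).

(** Isolates [x]: up to an exponential of a quadratic polynomial in [x], integration over [s] is a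
    [laplace] integral, whose holomorphy is known. *)
Lemma kexp_split x s : kernel_exp Q L A B x s =
  (dot x (xquad *m x) + dot xlin x) + (dot x (couple s) + kernel_exp Q L A B 0 s).
Proof.
have o0 : omv 0 s = oml s :> V2 by [].
rewrite /kernel_exp o0 omvE mulmxDr !dotDr !dotDl.
have e1 : dot (oml s) (N *m omr x) = dot x (couple s).
  rewrite (dotS (Nmx_sym Q A B)) /omr -[N *m oml s]vsubmxK dot_col dot0l add0r.
  by [].
have e2 : dot (omr x) (N *m oml s) = dot x (couple s).
  by rewrite -(dotS (Nmx_sym Q A B)) e1.
have e3 : dot (omr x) (N *m omr x) = dot x (drsubmx N *m x).
  rewrite -[in LHS](submxK N) /omr mul_block_col dot_col dot0l !mulmx0 !add0r.
  by [].
have e4 : dot (evec Q L A B) (omr x) = dot xlin x.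
  by rewrite /xlin -[in LHS](vsubmxK (evec Q L A B)) /omr dot_col dot0r add0r.
rewrite e1 e2 e3 e4 /xquad -scalemxAl dotZr.
have t0 := @two_neq0 R.
by field.
Qed.

Lemma l1_oml s : l1 (oml s : V2) = l1 s.
Proof.
rewrite /l1 big_split_ord /= [X in _ + X]big1 => [|i _]; last by rewrite col_mxEd mxE normc0.
by rewrite addr0; apply: eq_bigr => i _; rewrite col_mxEu mxE normc_conj.
Qed.

Lemma couple_le : exists2 K : R, 0 <= K & forall s, l1 (couple s) <= K * l1 s.
Proof.
have [K K0 hK] := l1_mulmx N; exists K => // s.
apply: le_trans (_ : l1 (N *m oml s) <= _); last by rewrite -(l1_oml s).
rewrite /l1 [leRHS]big_split_ord /= -[leLHS]add0r; apply: lerD.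
  by apply: sumr_ge0 => i _; exact: normc_ge0.
by apply: ler_sum => i _; rewrite mxE.
Qed.

End Decay.

(** * Schur's test for nonnegative kernels *)

Section Schur.
Context {R : realType} d1 d2 (T1 : measurableType d1) (T2 : measurableType d2)
  (m1 : {sigma_finite_measure set T1 -> \bar R}) (m2 : {sigma_finite_measure set T2 -> \bar R}).
Variables (k : T1 -> T2 -> R) (c : R).
Hypothesis mk : measurable_fun setT (fun p : T1 * T2 => k p.1 p.2).
Hypothesis k0 : forall x s, 0 <= k x s.
Hypothesis c0 : 0 < c.
Hypothesis k1 : forall x, (\int[m2]_s (k x s)%:E <= c%:E)%E.
Hypothesis k2 : forall s, (\int[m1]_x (k x s)%:E <= c%:E)%E.

Lemma schur_slice (w : T2 -> R) (M : R) x : measurable_fun setT w -> (forall s, `|w s| <= M) ->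
  m2.-integrable setT (fun s => (k x s * w s)%:E).
Proof.
move=> mw wM.
have mkx : measurable_fun setT (k x) by exact: (measurableT_comp mk (pair1_measurable x)).
have ik : m2.-integrable setT (fun s => (k x s)%:E).
  apply/integrableP; split; first exact/measurable_EFinP.
  apply: le_lt_trans (ltry c); apply: le_trans (k1 x).
  rewrite le_eqVlt; apply/orP; left; apply/eqP; apply: eq_integral => s _.
  by rewrite abse_EFin ger0_norm.
have ikM := integrableZl measurableT M ik.
apply: (le_integrable measurableT) ikM.
  by apply/measurable_EFinP; exact: measurable_funM.
move=> s _; rewrite -EFinM !abse_EFin lee_fin !normrM (ger0_norm (k0 _ _)) mulrC.
apply: ler_wpM2r; first exact: k0.
exact: le_trans (wM s) (ler_norm M).
Qed.

(** Integrating [k (w - t)^2 >= 0] at [t = P / c], where [P] is the integral of [k w], avoids square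
    roots; the row bound replaces the integral of [k] by [c]. *)
Lemma schur_cauchy_schwarz (w : T2 -> R) (M : R) x : measurable_fun setT w -> (forall s, `|w s| <= M) ->
  ((Rintegral m2 setT (fun s => k x s * w s) ^+ 2)%:E <= c%:E * \int[m2]_s (k x s * w s ^+ 2)%:E)%E.
Proof.
move=> mw wM; set P := Rintegral _ _ _.
have i1 := schur_slice x mw wM.
have mw2 : measurable_fun setT (fun s => w s ^+ 2) by exact: measurable_funX.
have i2 : m2.-integrable setT (fun s => (k x s * w s ^+ 2)%:E).
  apply: (@schur_slice (fun s => w s ^+ 2) (M ^+ 2)) => // s.
  by rewrite normrX lerXn2r ?nnegrE// (le_trans _ (wM s)).
have i0 : m2.-integrable setT (fun s => (k x s * 1)%:E).
  apply: (@schur_slice (fun=> 1) 1) => [|s]; first exact: measurable_cst.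
  by rewrite normr1.
rewrite -(fineK (integrable_fin_num measurableT i2)) -EFinM lee_fin.
set G := fine _.
have GE : Rintegral m2 setT (fun s => k x s * w s ^+ 2) = G by [].
pose D := Rintegral m2 setT (fun s => k x s * 1).
have Dc : D <= c.
  rewrite -lee_fin /D /Rintegral fineK ?(integrable_fin_num measurableT i0)//.
  by apply: le_trans (k1 x); rewrite le_eqVlt; apply/orP; left; apply/eqP; apply: eq_integral => s _; rewrite mulr1.
pose t := P / c.
have iA := integrableZl measurableT (2 * t) i1.
have iB := integrableD measurableT i2 (integrableZl measurableT (t ^+ 2) i0).
have h : Rintegral m2 setT (fun s => 2 * t * (k x s * w s)) <=
    Rintegral m2 setT (fun s => k x s * w s ^+ 2 + t ^+ 2 * (k x s * 1)).
  apply: (@le_Rintegral _ _ _ _ _ _ _ measurableT) => [||s _].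
  - by apply: eq_integrable iA.
  - by apply: eq_integrable iB.
  - have := mulr_ge0 (k0 x s) (sqr_ge0 (w s - t)).
    rewrite sqrrB; lra.
move: h; rewrite (RintegralZl _ measurableT i1) RintegralD//; last first.
  by have := integrableZl measurableT (t ^+ 2) i0; apply: eq_integrable.
rewrite (RintegralZl _ measurableT i0) -/P -/D GE => h.
have t2 : t ^+ 2 * D <= t ^+ 2 * c by rewrite ler_wpM2l// sqr_ge0.
have tc : t * c = P by rewrite /t divfK// gt_eqF.
have : t * P <= G.
  have := h; have : t ^+ 2 * c = t * P by rewrite expr2 -mulrA tc.
  lra.
by move=> /(ler_wpM2l (ltW c0)); rewrite mulrA (mulrC c) tc expr2.
Qed.

Lemma measurable_schur_sqr (w : T2 -> R) (M : R) : measurable_fun setT w -> (forall s, 0 <= w s) ->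
  (forall s, `|w s| <= M) ->
  measurable_fun setT (fun x => (Rintegral m2 setT (fun s => k x s * w s) ^+ 2)%:E).
Proof.
move=> mw w0 wM.
have mkw : measurable_fun setT (fun p : T1 * T2 => (k p.1 p.2 * w p.2)%:E).
  by apply/measurable_EFinP; apply: measurable_funM mk (measurableT_comp mw measurable_snd).
have kw0 (p : T1 * T2) : (0 <= (k p.1 p.2 * w p.2)%:E)%E by rewrite lee_fin mulr_ge0.
apply/measurable_EFinP; apply: measurable_funX; apply/measurable_EFinP.
have -> : EFin \o (fun x => Rintegral m2 setT (fun s => k x s * w s)) =
    (fun x => \int[m2]_s (k x s * w s)%:E)%E.
  by apply/funext => x; rewrite /= /Rintegral fineK// (integrable_fin_num measurableT (schur_slice x mw wM)).
exact: (@measurable_fun_fubini_tonelli_F _ _ _ _ _ m2 (fun p => (k p.1 p.2 * w p.2)%:E)).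
Qed.

(** The row bound enters through Cauchy-Schwarz and the column bound after Tonelli, each with one
    factor [c]. *)
Lemma schur_test (w : T2 -> R) (M : R) : measurable_fun setT w -> (forall s, 0 <= w s) -> (forall s, `|w s| <= M) ->
  (\int[m1]_x (Rintegral m2 setT (fun s => k x s * w s) ^+ 2)%:E <=
   (c ^+ 2)%:E * \int[m2]_s (w s ^+ 2)%:E)%E.
Proof.
move=> mw w0 wM.
have mw2 : measurable_fun setT (fun s => w s ^+ 2) by exact: measurable_funX.
pose F (p : T1 * T2) := (k p.1 p.2 * w p.2 ^+ 2)%:E.
have mF : measurable_fun setT F.
  apply/measurable_EFinP; apply: measurable_funM; first exact: mk.
  exact: (measurableT_comp mw2 measurable_snd).
have F0 p : (0 <= F p)%E by rewrite lee_fin mulr_ge0 ?k0 ?sqr_ge0.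
have mw2E : measurable_fun setT (fun s => (w s ^+ 2)%:E) by exact/measurable_EFinP.
have mI : measurable_fun setT (fun x => \int[m2]_s F (x, s))%E.
  exact: (@measurable_fun_fubini_tonelli_F _ _ _ _ _ m2 F).
have step1 : (\int[m1]_x (Rintegral m2 setT (fun s => k x s * w s) ^+ 2)%:E <=
   \int[m1]_x (c%:E * \int[m2]_s F (x, s)))%E.
  apply: ge0_le_integral => //.
  - by move=> x _; rewrite lee_fin sqr_ge0.
  - exact: measurable_schur_sqr w0 wM.
  - by apply: measurable_funeM.
  - by move=> x _; exact: schur_cauchy_schwarz mw wM.
apply: le_trans step1 _.
rewrite ge0_integralZl//; last 2 first.
- by move=> x _; apply: integral_ge0.
- by rewrite lee_fin ltW.
rewrite (fubini_tonelli F mF F0) expr2 EFinM -muleA; apply: lee_wpmul2l; first by rewrite lee_fin ltW.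
rewrite -(ge0_integralZl m2 measurableT mw2E); first last.
- by rewrite lee_fin ltW.
- by move=> s _; rewrite lee_fin sqr_ge0.
apply: ge0_le_integral => //.
- by move=> s _; apply: integral_ge0.
- exact: (@measurable_fun_fubini_tonelli_G _ _ _ _ _ m1 F).
- by apply: measurable_funeM.
move=> s _; rewrite /F /=.
have -> : (\int[m1]_x (k x s * w s ^+ 2)%:E = (w s ^+ 2)%:E * \int[m1]_x (k x s)%:E)%E.
  rewrite -ge0_integralZl//.
  - by apply: eq_integral => x _; rewrite mulrC EFinM.
  - apply/measurable_EFinP; exact: (measurableT_comp mk (pair2_measurable s)).
  - by move=> x _; rewrite lee_fin.
  - by rewrite lee_fin sqr_ge0.
by rewrite muleC; apply: lee_wpmul2r; rewrite ?lee_fin ?sqr_ge0.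
Qed.

End Schur.

(** * The Weyl operator after removal of the pluriharmonic part of the weight *)

Section WeylKernel.
Context {R : realType} {n : nat} (X : @cspace R n).
Local Notation mu := (cs_mu X).
Local Notation pt := (@cs_pt R n X).
Local Notation C := R[i].
Local Notation V := 'cV[C]_n.
Variables (Q : 'M[C]_(n + n)) (L : 'rV[C]_(n + n)) (A B : 'M[C]_n).
Hypothesis eigm2 : ~~ eigenvalue (fundmx Q) (-2).
Hypothesis hA : A^T = A.
Hypothesis hB : B^T = cconjmx B.
Hypothesis posB : forall v : V, v != 0 -> 0 < re (((cconjmx v)^T *m B *m v) 0 0).
Hypothesis bddS : exists M : R, forall x : V, Num.sqrt (sqmod (symb Q L (LamPt A B x))) <= M.

Local Notation herm := (hform B).
Local Notation hq := (hsq B).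

Definition untwisted (u : V -> C) (y : V) : C := cexp (- dot y (A *m y)) * u y.
Definition amplitude (u : V -> C) (y : V) : R := Num.sqrt (sqmod (u y)) * expR (- Phi0 A B y).
Definition weyl_kernel (x y : V) : C := cexp (herm (x - y) (x + y)) * symb Q L (LamPt A B (2^-1 *: (x + y))).
Definition wcst : C := (2 : C) ^+ n * \det B / (Complex (2 * pi) 0) ^+ n.

Lemma Phi0E y : Phi0 A B y = re (dot y (A *m y)) + hq y.
Proof. by rewrite /Phi0 /hq /hform /dot !mulmxA. Qed.

Lemma ampE u y : amplitude u y = normc (untwisted u y) * expR (- hq y).
Proof. by rewrite /amplitude /untwisted normcM normc_cexp reN Phi0E opprD expRD normc_sqrt mulrA (mulrC (Num.sqrt _)). Qed.

Lemma amp_ge0 u y : 0 <= amplitude u y.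
Proof. by rewrite mulr_ge0 ?sqrtr_ge0 ?expR_ge0. Qed.

Lemma amp_sqr u y : amplitude u y ^+ 2 = sqmod (u y) * expR (- (2 * Phi0 A B y)).
Proof.
rewrite /amplitude exprMn sqr_sqrtr ?sqmod_ge0//; congr (_ * _).
by rewrite expr2 -expRD; congr expR; ring.
Qed.

(** The numerical factors cancel, and since [A] is symmetric its part telescopes into values at [x]
    and at [y], which the conjugation absorbs. *)
Lemma weyl_phase x y :
  iC R * ((x - y)^T *m ((2 / iC R) *: dPhi0 A B ((1 / 2 : C) *: (x + y)))) 0 0 =
  dot x (A *m x) - dot y (A *m y) + herm (x - y) (x + y).
Proof.
rewrite -/(dot _ _) dotZr mulrA (mulrCA (iC R)) divff ?iC_neq0// mulr1.
have c2 : complex.conjc (1 / 2 : C) = 1 / 2 by rewrite mul1r conjc_inv conjc_nat.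
rewrite /dPhi0 conjZ c2 -!scalemxAr -scalerDr dotZr dotDr.
have -> : dot (x - y) (B^T *m cconjmx (x + y)) = herm (x - y) (x + y).
  by rewrite /hform dot_mulr trmxK dotC.
have -> : dot (x - y) (A *m (x + y)) = dot x (A *m x) - dot y (A *m y).
  have e : dot y (A *m x) = dot x (A *m y) by rewrite dotC dot_mull hA.
  rewrite mulmxDr !dotDr !dotDl !dotNl e.
  by move: (dot _ _) (dot _ _) (dot _ _) => p q r; ring.
by rewrite mulrA mulrCA divff ?two_neq0// mulr1 mul1r.
Qed.

Lemma weyl_integrand u x y :
  (let m := (1 / 2 : C) *: (x + y) in
   let th := (2 / iC R) *: dPhi0 A B m in
   cexp (iC R * ((x - y)^T *m th) 0 0) * symb Q L (col_mx m th) * u y) =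
  cexp (dot x (A *m x)) * (weyl_kernel x y * untwisted u y).
Proof.
rewrite /= weyl_phase cexpD cexpD /weyl_kernel /untwisted -/(LamPt A B _) mul1r; ring.
Qed.

Lemma meas_wker d (Y : measurableType d) (p q : Y -> V) : mxmeas p -> mxmeas q ->
  cmeas (fun t => weyl_kernel (p t) (q t)).
Proof.
move=> mp mq; apply: cmeasM.
  apply: cmeas_cexp; apply: meas_herm; last by apply: mxmeasD; [exact: mp|exact: mq].
  by apply: mxmeasD; [exact: mp|apply: mxmeasN; exact: mq].
have mm : mxmeas (fun t => 2^-1 *: (p t + q t)).
  by apply: mxmeasZ; [exact: cmeas_cst|apply: mxmeasD; [exact: mp|exact: mq]].
exact: (@vcmeas_symb _ _ Q L A B _ _ (fun t => 2^-1 *: (p t + q t)) mm).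
Qed.

Lemma vcmeas_holomorphic (u : V -> C) : holomorphic u -> vcmeas u.
Proof. by move=> hu d Y q mq; apply: cmeas_continuous mq; exact: holomorphic_ccont. Qed.

Lemma holomorphic_untwist u : holomorphic u -> holomorphic (untwisted u).
Proof.
move=> hu; apply: holomorphicM hu.
have -> : (fun y => cexp (- dot y (A *m y))) = (fun y => cexp (dot y ((- A) *m y) + dot 0 y)).
  by apply/funext => y; rewrite dot0l addr0 mulNmx dotNr.
exact: holomorphic_cexp_quadratic.
Qed.

(** For each coordinate [(1 + Re^2)(1 + Im^2) <= (1 + S)^2], whence the exponent [2 n]. With it
    rapid decrease becomes domination by [vhat]. *)
Lemma vhat_pow_ge1 (x : V) : 1 <= vhat x * (1 + \sum_(j < n) sqmod (x j 0)) ^+ (2 * n).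
Proof.
set S := \sum_(j < n) _.
have -> : (1 + S) ^+ (2 * n) = \prod_(j < n) (1 + S) ^+ 2 by rewrite prodr_const card_ord -exprM.
rewrite /vhat -big_split /=; apply: le_trans (_ : \prod_(j < n) 1 <= _); first by rewrite big1_eq.
apply: ler_prod => j _; rewrite ler01 /=.
rewrite /hat mulrC ler_pdivlMr ?mul1r.
  have : sqmod (x j 0) <= S.
    by rewrite /S (bigD1 j)//= lerDl sumr_ge0// => i _; exact: sqmod_ge0.
  rewrite /sqmod; have := sqr_ge0 (re (x j 0)); have := sqr_ge0 (im (x j 0)).
  by move: (_ ^+ 2) (_ ^+ 2) => p q p0 q0 h; nra.
by rewrite mulr_gt0// ltr_pwDl// sqr_ge0.
Qed.

Section Representation.
Variable u : V -> C.
Hypothesis domu : weyl_dom A B u.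
Local Notation v := (untwisted u).

Lemma amp_vhat : exists2 K : R, 0 <= K & forall y, amplitude u y <= K * vhat y.
Proof.
have [_ /(_ (2 * n)%N) [K hK]] := domu; exists K.
  apply: le_trans (hK 0); rewrite mulr_ge0 ?amp_ge0// exprn_ge0// addr_ge0//.
  by apply: sumr_ge0 => j _; exact: sqmod_ge0.
move=> y; have h := ler_wpM2l (amp_ge0 u y) (vhat_pow_ge1 y).
rewrite mulr1 in h; apply: le_trans h _.
by rewrite mulrCA mulrC; apply: ler_wpM2r; [exact: vhat_ge0|exact: hK].
Qed.

Lemma amp_bounded : exists2 K : R, 0 <= K & forall y, amplitude u y <= K.
Proof.
have [_ /(_ 0%N) [K hK]] := domu; exists K => [|y].
  by apply: le_trans (hK 0); rewrite expr0 mulr1 amp_ge0.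
by have := hK y; rewrite expr0 mulr1.
Qed.

Lemma vcmeas_untwist : vcmeas v.
Proof. by apply: vcmeas_holomorphic; apply: holomorphic_untwist; exact: domu.1. Qed.

Lemma normc_untwist y : normc (v y) = expR (hq y) * amplitude u y.
Proof. by rewrite ampE mulrCA -expRD subrr expR0 mulr1. Qed.

(** The weights cancel and leave no decay in [x - y]: enough for convergence of the integral, not
    for an operator bound. *)
Lemma normc_wker x y M : (forall x, normc (symb Q L (LamPt A B x)) <= M) ->
  normc (weyl_kernel x y * v y) <= M * expR (hq x) * amplitude u y.
Proof.
move=> hM; rewrite normcM /weyl_kernel normcM (normc_cexp (herm _ _)) re_hermBD// normc_untwist.
have -> : M * expR (hq x) * amplitude u y = expR (hq x - hq y) * M * (expR (hq y) * amplitude u y).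
  have ab : expR (- hq y) * expR (hq y) = 1 by rewrite -expRD addNr expR0.
  move: ab; rewrite expRD; move: (expR (- hq y)) (expR (hq y)) (expR (hq x)) (amplitude u y) => a b c d ab.
  by ring: ab.
apply: ler_wpM2r; first by rewrite mulr_ge0 ?expR_ge0 ?amp_ge0.
by apply: ler_wpM2l; [exact: expR_ge0|exact: hM].
Qed.

Lemma weylE x : weyl A B (symb Q L) u x =
  wcst * (cexp (dot x (A *m x)) * cint mu setT (fun t => weyl_kernel x (pt t) * v (pt t))).
Proof.
have [M M0 hM] := symb_bound bddS; have [K K0 hK] := amp_vhat.
have mg : vcmeas (fun y => weyl_kernel x y * v y).
  by move=> d Y q mq; apply: cmeasM; [apply: meas_wker => //; exact: mxmeas_cst|exact: vcmeas_untwist].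
have hg y : normc (weyl_kernel x y * v y) <= M * expR (hq x) * K * vhat y.
  apply: le_trans (normc_wker x y hM) _; rewrite -[leRHS]mulrA; apply: ler_wpM2l; last exact: hK.
  by rewrite mulr_ge0 ?expR_ge0.
have ig := cintegrable_vhat X mg hg.
rewrite -(cintZ _ measurableT ig) /weyl; congr (_ * _).
rewrite (_ : (fun y => _) = (fun y => cexp (dot x (A *m x)) * (weyl_kernel x y * v y))); last first.
  by apply/funext => y; exact: weyl_integrand.
apply: (@cintCnE R n X (fun y => cexp (dot x (A *m x)) * (weyl_kernel x y * v y)) (normc (cexp (dot x (A *m x))) * (M * expR (hq x) * K))).
  by move=> d Y q mq; apply: cmeasM; [exact: cmeas_cst|exact: mg].
move=> y; rewrite normcM -[leRHS]mulrA; apply: ler_wpM2l; first exact: normc_ge0.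
exact: hg.
Qed.

End Representation.
End WeylKernel.

Lemma ge0_le_iterated d1 d2 (T1 : measurableType d1) (T2 : measurableType d2) (R : realType)
  (m1 : {sigma_finite_measure set T1 -> \bar R}) (m2 : {sigma_finite_measure set T2 -> \bar R})
  (F G : T1 * T2 -> \bar R) : measurable_fun setT F -> measurable_fun setT G ->
  (forall p, (0 <= F p)%E) -> (forall p, (F p <= G p)%E) ->
  (\int[m1]_x \int[m2]_y F (x, y) <= \int[m1]_x \int[m2]_y G (x, y))%E.
Proof.
move=> mF mG F0 FG; have G0 p : (0 <= G p)%E := le_trans (F0 p) (FG p).
apply: ge0_le_integral => //.
- by move=> x _; apply: integral_ge0.
- exact: (@measurable_fun_fubini_tonelli_F _ _ _ _ _ m2 F).
- exact: (@measurable_fun_fubini_tonelli_F _ _ _ _ _ m2 G).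
move=> x _; apply: ge0_le_integral => //.
- exact: (measurableT_comp mF (pair1_measurable x)).
- exact: (measurableT_comp mG (pair1_measurable x)).
Qed.

(** * Representation of the Weyl operator by the Gaussian kernel *)

Section WeylBound.
Context {R : realType} {n : nat} (X : @cspace R n).
Local Notation mu := (cs_mu X).
Local Notation pt := (@cs_pt R n X).
Local Notation C := R[i].
Local Notation V := 'cV[C]_n.
Variables (Q : 'M[C]_(n + n)) (L : 'rV[C]_(n + n)) (A B : 'M[C]_n).
Hypothesis eigm2 : ~~ eigenvalue (fundmx Q) (-2).
Hypothesis hA : A^T = A.
Hypothesis hB : B^T = cconjmx B.
Hypothesis posB : forall v : V, v != 0 -> 0 < re (((cconjmx v)^T *m B *m v) 0 0).
Hypothesis bddS : exists M : R, forall x : V, Num.sqrt (sqmod (symb Q L (LamPt A B x))) <= M.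

Local Notation herm := (hform B).
Local Notation hq := (hsq B).
Local Notation kexp := (kernel_exp Q L A B).
Local Notation kcst := (kernel_cst X Q L A B).
Local Notation wker := (weyl_kernel Q L A B).
Local Notation amp := (amplitude A B).
Local Notation untwist := (untwisted A).

Lemma mxmeas_pt1 : mxmeas (fun p : cs_T X * cs_T X => pt p.1).
Proof.
have mpt := mxmeas_pt X.
by move=> i j; split; [exact: (measurableT_comp (mpt i j).1 measurable_fst)|exact: (measurableT_comp (mpt i j).2 measurable_fst)].
Qed.

Lemma mxmeas_pt2 : mxmeas (fun p : cs_T X * cs_T X => pt p.2).
Proof.
have mpt := mxmeas_pt X.
by move=> i j; split; [exact: (measurableT_comp (mpt i j).1 measurable_snd)|exact: (measurableT_comp (mpt i j).2 measurable_snd)].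
Qed.

Lemma meas_gauss_vhat (del c : R) : measurable_fun setT
  (fun p : cs_T X * cs_T X => (c * (expR (- (del * nsq (pt p.1 - pt p.2))) * vhat (pt p.2)))%:E).
Proof.
apply/measurable_EFinP; apply: measurable_funM; first exact: measurable_cst.
apply: measurable_funM; last exact: meas_vhat mxmeas_pt2.
apply: measurableT_comp => //; apply: measurableT_comp => //.
apply: measurable_funM; first exact: measurable_cst.
by apply: meas_nsq; apply: mxmeasD; [exact: mxmeas_pt1|apply: mxmeasN; exact: mxmeas_pt2].
Qed.

(** The density against which [exp (2 h(y,s))] reproduces [untwisted u], up to the factor [cB]. *)
Definition twisted (u : V -> C) (s : V) : C := cexp (- (2 * herm s s)) * untwist u s.

Lemma normc_dual u s : normc (twisted u s) = expR (- hq s) * amp u s.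
Proof.
rewrite /twisted normcM normc_cexp reN re2M (normc_untwist A B) mulrA -expRD; congr (expR _ * _).
by rewrite -/(hq s); ring.
Qed.

Section Dom.
Variable u : V -> C.
Hypothesis domu : weyl_dom A B u.

Lemma vcmeas_dual : vcmeas (twisted u).
Proof.
move=> d Y q mq; apply: cmeasM; last exact: (vcmeas_untwist domu mq).
apply: cmeas_cexp; apply: cmeasN; apply: cmeasM; first exact: cmeas_cst.
by apply: meas_herm.
Qed.

Lemma untwist_reproducing y :
  cint mu setT (fun t => cexp (2 * herm y (pt t)) * twisted u (pt t)) = untwist u y * cB X B.
Proof.
have [K K0 hK] := amp_bounded domu.
have hu := holomorphic_untwist A domu.1.
rewrite -(@reproducing R n X B hB posB (untwist u) K y (vcmeas_untwist domu)).
- by apply: eq_cint => t _; rewrite /twisted mulrA -cexpD.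
- by move=> x w tau; exact: holomorphic_line.
- by move=> s; rewrite (normc_untwist A B) mulrC; apply: ler_wpM2r; [exact: expR_ge0|exact: hK].
Qed.

Lemma cintegrable_dual y : cintegrable mu setT (fun t => cexp (2 * herm y (pt t)) * twisted u (pt t)).
Proof.
have [K K0 hK] := amp_vhat domu; have [del d0 hdel] := hq_lower hB posB.
apply: (@cintegrable_vhat R n X (fun s => cexp (2 * herm y s) * twisted u s) (expR (hq y) * K)).
  move=> d Y q mq; apply: cmeasM; last exact: vcmeas_dual.
  apply: cmeas_cexp; apply: cmeasM; first exact: cmeas_cst.
  by apply: meas_herm; [exact: mxmeas_cst|exact: mq].
move=> s; rewrite normcM normc_cexp re2M normc_dual mulrA -expRD -mulrA.
apply: ler_pM; rewrite ?expR_ge0 ?amp_ge0//.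
rewrite ler_expR; have := hqB hB y s; have := hdel (y - s).
have := mulr_ge0 (ltW d0) (nsq_ge0 (y - s)).
by move: (hq _) (hq _) (hq _) (re _) (_ * _) => a b c e f; lra.
Qed.

Lemma kern_untwist x y s :
  wker x y * (cexp (2 * herm y s) * twisted u s) = kern_integrand Q L A B x s y * twisted u s.
Proof. by rewrite mulrA. Qed.

Lemma normc_kern_dual x y s M : (forall x, normc (symb Q L (LamPt A B x)) <= M) ->
  normc (kern_integrand Q L A B x s y * twisted u s) <=
  M * expR (hq x) * (expR (- hq (y - s)) * amp u s).
Proof.
move=> hM; rewrite normcM normc_dual.
apply: le_trans (ler_wpM2r _ (normc_kern hB x s y hM)) _.
  by rewrite mulr_ge0 ?expR_ge0 ?amp_ge0.
rewrite expRD; have ab : expR (- hq s) * expR (hq s) = 1 by rewrite -expRD addNr expR0.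
move: ab; move: (expR (- hq s)) (expR (hq s)) (expR (hq x)) (amp u s) (expR (- hq (y - s))) => a b c d e ab.
by rewrite le_eqVlt; apply/orP; left; apply/eqP; ring: ab.
Qed.

(** After Tonelli the Gaussian integral does not depend on its centre, which leaves a constant times
    the integral of [vhat]. *)
Lemma gauss_double_lty (del c : R) : 0 < del -> 0 <= c ->
  (\int[mu]_t \int[mu]_t' (c * (expR (- (del * nsq (pt t - pt t'))) * vhat (pt t')))%:E < +oo)%E.
Proof.
move=> d0 c0.
pose F (p : cs_T X * cs_T X) := (c * (expR (- (del * nsq (pt p.1 - pt p.2))) * vhat (pt p.2)))%:E.
have mF : measurable_fun setT F := meas_gauss_vhat del c.
have F0 p : (0 <= F p)%E by rewrite lee_fin !mulr_ge0 ?expR_ge0 ?vhat_ge0.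
have -> := @fubini_tonelli _ _ _ _ R mu mu F mF F0.
have ig := integrable_gauss X 0 d0.
pose J := Rintegral mu setT (fun t => expR (- (del * nsq (pt t - 0)))).
have hJ : (\int[mu]_t (expR (- (del * nsq (pt t - 0))))%:E = J%:E)%E.
  by rewrite /J /Rintegral (fineK (integrable_fin_num measurableT ig)).
have E t' : (\int[mu]_t F (t, t') = (c * J)%:E * (vhat (pt t'))%:E)%E.
  transitivity (\int[mu]_t ((c * vhat (pt t'))%:E * (expR (- (del * nsq (pt t - pt t'))))%:E))%E.
    by apply: eq_integral => t _; rewrite /F /= -EFinM; congr EFin; ring.
  rewrite (integralZl measurableT (integrable_gauss X (pt t') d0)) gauss_integral_shift.
  rewrite -(gauss_integral_shift X del 0) hJ -!EFinM.
  by congr EFin; ring.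
under eq_integral do rewrite E.
rewrite (integralZl measurableT (integrable_vhat X)).
by rewrite -(fineK (integrable_fin_num measurableT (integrable_vhat X))) -EFinM ltry.
Qed.

Lemma cintegrable_kern x s : cintegrable mu setT (fun t => kern_integrand Q L A B x s (pt t)).
Proof.
have [M M0 hM] := symb_bound bddS; have [del d0 hdel] := hq_lower hB posB.
apply: (@cintegrable_gauss R n X (kern_integrand Q L A B x s) (M * expR (hq x + hq s)) del s d0).
  exact: vcmeas_kern.
move=> y; apply: le_trans (normc_kern hB x s y hM) _; apply: ler_wpM2l; first by rewrite mulr_ge0 ?expR_ge0.
by rewrite ler_expR lerN2.
Qed.

Lemma kernel_representation x :
  cint mu setT (fun t => wker x (pt t) * untwist u (pt t)) * cB X B =
  cint mu setT (fun t => kcst * cexp (kexp x (pt t)) * twisted u (pt t)).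
Proof.
have [M M0 hM] := symb_bound bddS; have [K K0 hK] := amp_vhat domu.
have [del d0 hdel] := hq_lower hB posB.
have ig : cintegrable mu setT (fun t => wker x (pt t) * untwist u (pt t)).
  apply: (@cintegrable_vhat R n X (fun y => wker x y * untwist u y) (M * expR (hq x) * K)).
    move=> d Y q mq; apply: cmeasM; last exact: (vcmeas_untwist domu mq).
    by apply: meas_wker; [exact: mxmeas_cst|exact: mq].
  move=> y; apply: le_trans (normc_wker hB u x y hM) _; rewrite -[leRHS]mulrA.
  by apply: ler_wpM2l; [rewrite mulr_ge0 ?expR_ge0|exact: hK].
pose f t t' := kern_integrand Q L A B x (pt t') (pt t) * twisted u (pt t').
have mf : cmeas (fun p : cs_T X * cs_T X => f p.1 p.2).
  apply: cmeasM; last exact: (vcmeas_dual mxmeas_pt2).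
  apply: cmeasM; first by apply: meas_wker; [exact: mxmeas_cst|exact: mxmeas_pt1].
  by apply: cmeas_cexp; apply: cmeasM; [exact: cmeas_cst|apply: meas_herm; [exact: mxmeas_pt1|exact: mxmeas_pt2]].
have ge y : expR (- hq y) <= expR (- (del * nsq y)) by rewrite ler_expR lerN2.
have c0 : 0 <= M * expR (hq x) by rewrite mulr_ge0 ?expR_ge0.
(* The Gaussian in [y - s] comes from [normc_kern] and [vhat] from the rapid decrease of [u];
   together they make the double integral absolutely convergent. *)
have hf t t' : normc (f t t') <= M * expR (hq x) * K * (expR (- (del * nsq (pt t - pt t'))) * vhat (pt t')).
  apply: le_trans (normc_kern_dual x _ _ hM) _; rewrite -[leRHS]mulrA; apply: ler_wpM2l => //.
  rewrite [leRHS]mulrCA; apply: ler_pM; [exact: expR_ge0|exact: amp_ge0|exact: ge|exact: hK].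
rewrite mulrC -(cintZ _ measurableT ig).
transitivity (cint mu setT (fun t => cint mu setT (f t))).
  apply: eq_cint => t _; rewrite mulrCA [cB X B * _]mulrC -untwist_reproducing.
  by rewrite -(cintZ _ measurableT (cintegrable_dual _)); apply: eq_cint => t' _; rewrite kern_untwist.
(* The inner integral is now over [y] at fixed [s], where [kernel_eq] applies. *)
rewrite (cfubini mf).
- apply: eq_cint => t' _; rewrite -(kernel_eq X hB posB bddS) mulrC.
  rewrite -(cintZ _ measurableT (cintegrable_kern x (pt t'))); apply: eq_cint => t _.
  by rewrite /f mulrC.
- have cc : 0 <= M * expR (hq x) * K by rewrite mulr_ge0.
  apply: le_lt_trans (gauss_double_lty d0 cc).
  have mn := cmeas_normc_EFin mf.
  have mG := meas_gauss_vhat del (M * expR (hq x) * K).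
  have n0 (p : cs_T X * cs_T X) : (0 <= (normc (f p.1 p.2))%:E)%E by rewrite lee_fin normc_ge0.
  have nG (p : cs_T X * cs_T X) := hf p.1 p.2.
  exact: (ge0_le_iterated mu mu mn mG n0 nG).
- move=> t; have := cintegrableZ (wker x (pt t)) measurableT (cintegrable_dual (pt t)).
  by apply: eq_cintegrable => // t' _; rewrite kern_untwist.
- move=> t'; have := cintegrableZ (twisted u (pt t')) measurableT (cintegrable_kern x (pt t')).
  by apply: eq_cintegrable => // t _; rewrite /f mulrC.
Qed.

End Dom.
End WeylBound.

(** * Holomorphy of the image and integrals of the reduced kernel *)

Section WeylBounded.
Context {R : realType} {n : nat} (X : @cspace R n).
Local Notation mu := (cs_mu X).
Local Notation pt := (@cs_pt R n X).
Local Notation C := R[i].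
Local Notation V := 'cV[C]_n.
Variables (Q : 'M[C]_(n + n)) (L : 'rV[C]_(n + n)) (A B : 'M[C]_n).
Hypothesis eigm2 : ~~ eigenvalue (fundmx Q) (-2).
Hypothesis hA : A^T = A.
Hypothesis hB : B^T = cconjmx B.
Hypothesis posB : forall v : V, v != 0 -> 0 < re (((cconjmx v)^T *m B *m v) 0 0).
Hypothesis bddS : exists M : R, forall x : V, Num.sqrt (sqmod (symb Q L (LamPt A B x))) <= M.

Local Notation hq := (hsq B).
Local Notation kexp := (kernel_exp Q L A B).
Local Notation kphase := (kernel_phase Q L A B).
Local Notation kcst := (kernel_cst X Q L A B).
Local Notation wker := (weyl_kernel Q L A B).
Local Notation amp := (amplitude A B).
Local Notation untwist := (untwisted A).
Local Notation dual := (twisted A B).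
Local Notation W := (weyl A B (symb Q L)).
Local Notation Na := (Nmx Q A B).

Lemma meas_amp u d (Y : measurableType d) (q : Y -> V) : vcmeas u -> mxmeas q ->
  measurable_fun setT (fun y => amp u (q y)).
Proof.
move=> mv mq.
rewrite (_ : (fun y => _) = (fun y => normc (untwist u (q y)) * expR (- hq (q y)))); last first.
  by apply/funext => y; rewrite ampE.
apply: measurable_funM.
  apply: cmeas_normc; apply: cmeasM; last exact: (mv _ _ _ mq).
  apply: cmeas_cexp; apply: cmeasN; apply: meas_dot; first exact: mq.
  by apply: mxmeasM; [exact: mxmeas_cst|exact: mq].
apply: measurableT_comp => //; apply: measurableT_comp => //.
exact: (meas_herm B mq mq).1.
Qed.

Lemma wnorm2E (u : V -> C) : vcmeas u ->
  wnorm2 A B u = (\int[mu]_t (amp u (pt t) ^+ 2)%:E)%E.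
Proof.
move=> mu'; rewrite /wnorm2 (_ : (fun x => _) = (fun x => (amp u x ^+ 2)%:E)); last first.
  by apply/funext => x; rewrite amp_sqr.
apply: (intCnE X (F := fun x => (amp u x ^+ 2)%:E)) => [x|d Y q mq]; first by rewrite lee_fin sqr_ge0.
apply/measurable_EFinP; apply: measurable_funX; exact: meas_amp.
Qed.

(** The representation makes [cB] times the integral vanish, and [cB] is nonzero. *)
Lemma weyl_kcst0 u x : weyl_dom A B u -> kcst = 0 -> W u x = 0.
Proof.
move=> domu k0; rewrite (weylE X hA hB bddS domu).
have := kernel_representation X hB posB bddS domu x.
have -> : cint mu setT (fun t => kcst * cexp (kexp x (pt t)) * dual u (pt t)) = 0.
  rewrite (@eq_cint _ _ _ mu setT _ (fun=> 0)) => [|t _]; last by rewrite k0 !mul0r.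
  by apply: complex_ext; rewrite /= /Rintegral integral0.
move=> /eqP; rewrite mulf_eq0 (negbTE (cB_neq0 X hB posB)) orbF => /eqP ->.
by rewrite !mulr0.
Qed.

Lemma meas_kexp d (Y : measurableType d) (p q : Y -> V) : mxmeas p -> mxmeas q ->
  cmeas (fun t => kexp (p t) (q t)).
Proof.
move=> mp mq; have mo : mxmeas (fun t => omv (p t) (q t)).
  by apply: mxmeas_col; [exact: mxmeas_conj|exact: mp].
apply: cmeasD; last by apply: meas_dot; [exact: mxmeas_cst|exact: mo].
apply: cmeasM; first exact: cmeas_cst.
by apply: meas_dot; [exact: mo|apply: mxmeasM; [exact: mxmeas_cst|exact: mo]].
Qed.

Lemma meas_kphase d (Y : measurableType d) (p q : Y -> V) : mxmeas p -> mxmeas q ->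
  measurable_fun setT (fun t => kphase (p t) (q t)).
Proof.
move=> mp mq; apply: measurable_funB; last exact: (meas_herm B mq mq).1.
apply: measurable_funB; last exact: (meas_herm B mp mp).1.
exact: (meas_kexp mp mq).1.
Qed.

Section Nondegenerate.
Hypothesis kcst0 : kcst != 0.

Lemma normc_kernel_dual u x s :
  normc (cexp (kexp x s) * dual u s) = expR (hq x) * (expR (kphase x s) * amp u s).
Proof.
rewrite normcM normc_cexp normc_dual; move: (amp u s) => w.
rewrite !mulrA -!expRD; congr (expR _ * _).
by rewrite /kernel_phase; move: (re _) (hq x) (hq s) => a b c; ring.
Qed.

Lemma cintegrable_kernel_dual u x : weyl_dom A B u ->
  cintegrable mu setT (fun t => cexp (kexp x (pt t)) * dual u (pt t)).
Proof.
move=> domu; have [M M0 hM] := amp_bounded domu.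
have [K [del d0 [h1 _]]] := kphase_decay eigm2 hA hB posB bddS kcst0.
have [z hz] := h1 x.
apply: (@cintegrable_gauss R n X (fun s => cexp (kexp x s) * dual u s) (expR (hq x) * (expR K * M)) del z d0).
  move=> d Y q mq; apply: cmeasM; last exact: (vcmeas_dual domu mq).
  by apply: cmeas_cexp; apply: meas_kexp; [exact: mxmeas_cst|exact: mq].
move=> s; rewrite normc_kernel_dual -[leRHS]mulrA; apply: ler_wpM2l; first exact: expR_ge0.
rewrite mulrAC; apply: ler_pM; [exact: expR_ge0|exact: amp_ge0| |exact: hM].
by rewrite -expRD ler_expR; exact: hz.
Qed.

Lemma weyl_kernelE u x : weyl_dom A B u ->
  W u x = wcst B * kcst / cB X B *
    (cexp (dot x (A *m x)) * cint mu setT (fun t => cexp (kexp x (pt t)) * dual u (pt t))).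
Proof.
move=> domu; rewrite (weylE X hA hB bddS domu).
have b0 := cB_neq0 X hB posB.
have h := kernel_representation X hB posB bddS domu x.
have -> : cint mu setT (fun t => wker x (pt t) * untwist u (pt t)) =
    kcst / cB X B * cint mu setT (fun t => cexp (kexp x (pt t)) * dual u (pt t)).
  apply: (mulIf b0); rewrite h mulrAC divfK// -(cintZ _ measurableT (cintegrable_kernel_dual x domu)).
  by apply: eq_cint => t _; rewrite mulrA.
by rewrite -!mulrA (mulrCA (cexp _)) (mulrCA (cexp _)).
Qed.

(** Decay in [s] at [x = 0], recentred at the origin as [laplace] requires; the recentring halves
    the rate. *)
Lemma kexp0_gauss u : weyl_dom A B u -> exists K : R, exists2 del : R, 0 < del &
  forall s, normc (cexp (kexp 0 s) * dual u s) <= K * expR (- (del * nsq s)).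
Proof.
move=> domu; have [M M0 hM] := amp_bounded domu.
have [K [del d0 [h1 _]]] := kphase_decay eigm2 hA hB posB bddS kcst0.
have [z hz] := h1 0.
exists (expR K * expR (del * nsq z) * M); exists (del / 2) => [|s]; first by rewrite divr_gt0.
rewrite normc_kernel_dual (_ : hq 0 = 0) ?expR0 ?mul1r; last by rewrite /hsq /hform mulmx0 dot0r.
have e1 : expR (kphase 0 s) <= expR K * (expR (del * nsq z) * expR (- (del / 2 * nsq s))).
  apply: le_trans (_ : expR (K - del * nsq (s - z)) <= _); first by rewrite ler_expR.
  by rewrite expRD ler_wpM2l ?expR_ge0// gauss_shift_le// ltW.
apply: le_trans (ler_pM (expR_ge0 _) (amp_ge0 _ _ _ _) e1 (hM s)) _.
by rewrite le_eqVlt; apply/orP; left; apply/eqP; ring.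
Qed.

(** By [kexp_split] the image is a constant times two exponentials of quadratic polynomials times a
    [laplace] integral. *)
Lemma weyl_holomorphic u : weyl_dom A B u -> holomorphic (W u).
Proof.
move=> domu; have [K [del d0 hK]] := kexp0_gauss domu.
have [Lc Lc0 hL] := couple_le Q A B.
have mL i : vcmeas (fun s => couple Q A B s i 0).
  move=> d Y q mq.
  have mo : mxmeas (fun y => Na *m oml (q y)).
    apply: mxmeasM; first exact: mxmeas_cst.
    by apply: mxmeas_col; [exact: mxmeas_conj|exact: mxmeas_cst].
  by apply: cmeas_ext (mo (rshift n i) 0) => t; rewrite /couple [RHS]mxE.
have mw : vcmeas (fun s => cexp (kexp 0 s) * dual u s).
  move=> d Y q mq; apply: cmeasM; last exact: (vcmeas_dual domu mq).
  by apply: cmeas_cexp; apply: meas_kexp; [exact: mxmeas_cst|exact: mq].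
have -> : W u = (fun x => wcst B * kcst / cB X B * (cexp (dot x (A *m x) + dot 0 x) *
   (cexp (dot x (xquad Q A B *m x) + dot (xlin Q L A B) x) *
    laplace X (couple Q A B) (fun s => cexp (kexp 0 s) * dual u s) x))).
  apply/funext => x; rewrite (weyl_kernelE x domu) dot0l addr0 /laplace.
  rewrite -(cintZ _ measurableT (cintegrable_laplace X mL hL mw d0 hK x)).
  congr (_ * (_ * _)); apply: eq_cint => t _.
  by rewrite kexp_split !cexpD !mulrA.
apply: holomorphicM; first exact: holomorphic_cst.
apply: holomorphicM; first exact: holomorphic_cexp_quadratic.
apply: holomorphicM; first exact: holomorphic_cexp_quadratic.
exact: (laplace_holomorphic X mL hL mw d0 hK).
Qed.

Lemma kphase_integral_le : exists2 c : R, 0 < c &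
  (forall x, (\int[mu]_t (expR (kphase x (pt t)))%:E <= c%:E)%E) /\
  (forall s, (\int[mu]_t (expR (kphase (pt t) s))%:E <= c%:E)%E).
Proof.
have [K [del d0 [h1 h2]]] := kphase_decay eigm2 hA hB posB bddS kcst0.
have ig := integrable_gauss X 0 d0.
pose J := Rintegral mu setT (fun t => expR (- (del * nsq (pt t - 0)))).
have J0 : 0 <= J by apply: Rintegral_ge0 => t _; exact: expR_ge0.
have hJ z : (\int[mu]_t (expR (- (del * nsq (pt t - z))))%:E = J%:E)%E.
  rewrite gauss_integral_shift -(gauss_integral_shift X del 0).
  by rewrite /J /Rintegral (fineK (integrable_fin_num measurableT ig)).
have key (f : cs_T X -> R) z : measurable_fun setT f ->
    (forall t, f t <= K - del * nsq (pt t - z)) ->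
    (\int[mu]_t (expR (f t))%:E <= (expR K * J + 1)%:E)%E.
  move=> mf hf.
  apply: le_trans (_ : (\int[mu]_t ((expR K)%:E * (expR (- (del * nsq (pt t - z))))%:E) <= _))%E.
    apply: ge0_le_integral => //.
    - by apply/measurable_EFinP; apply: measurableT_comp.
    - by apply: measurable_funeM; exact: measurable_int (integrable_gauss X z d0).
    - by move=> t _; rewrite -EFinM lee_fin -expRD ler_expR.
  rewrite (integralZl measurableT (integrable_gauss X z d0)) hJ -EFinM lee_fin; lra.
(* [J] is only known to be nonnegative; the added 1 makes the constant positive. *)
exists (expR K * J + 1); first by rewrite ltr_wpDl// mulr_ge0 ?expR_ge0.
split=> [x|s].
  have [z hz] := h1 x; apply: (key _ z) => [|t]; last exact: hz.
  by apply: meas_kphase; [exact: mxmeas_cst|exact: mxmeas_pt].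
have [z hz] := h2 s; apply: (key _ z) => [|t]; last exact: hz.
by apply: meas_kphase; [exact: mxmeas_pt|exact: mxmeas_cst].
Qed.

End Nondegenerate.
End WeylBounded.

(** * The weighted norm estimate *)

Section WeylEstimate.
Context {R : realType} {n : nat} (X : @cspace R n).
Local Notation mu := (cs_mu X).
Local Notation pt := (@cs_pt R n X).
Local Notation C := R[i].
Local Notation V := 'cV[C]_n.
Variables (Q : 'M[C]_(n + n)) (L : 'rV[C]_(n + n)) (A B : 'M[C]_n).
Hypothesis eigm2 : ~~ eigenvalue (fundmx Q) (-2).
Hypothesis hA : A^T = A.
Hypothesis hB : B^T = cconjmx B.
Hypothesis posB : forall v : V, v != 0 -> 0 < re (((cconjmx v)^T *m B *m v) 0 0).
Hypothesis bddS : exists M : R, forall x : V, Num.sqrt (sqmod (symb Q L (LamPt A B x))) <= M.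
Local Notation hq := (hsq B).
Local Notation kexp := (kernel_exp Q L A B).
Local Notation kphase := (kernel_phase Q L A B).
Local Notation kcst := (kernel_cst X Q L A B).
Local Notation amp := (amplitude A B).
Local Notation dual := (twisted A B).
Local Notation W := (weyl A B (symb Q L)).
Hypothesis kcst0 : kcst != 0.

Lemma integrable_kphase_amp u x : weyl_dom A B u ->
  mu.-integrable setT (fun t => (expR (kphase x (pt t)) * amp u (pt t))%:E).
Proof.
move=> domu; have [M M0 hM] := amp_bounded domu.
have [c c0 [k1 _]] := kphase_integral_le eigm2 hA hB posB bddS kcst0.
have mk : measurable_fun setT (fun p : unit * cs_T X => expR (kphase x (pt p.2))).
  apply: measurableT_comp => //; apply: meas_kphase; first exact: mxmeas_cst.
  have mpt := mxmeas_pt X.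
  by move=> i j; split; [exact: (measurableT_comp (mpt i j).1 measurable_snd)|exact: (measurableT_comp (mpt i j).2 measurable_snd)].
have ma := meas_amp A B (vcmeas_holomorphic domu.1) (mxmeas_pt X).
have aM t : `|amp u (pt t)| <= M by rewrite ger0_norm ?amp_ge0.
exact: (@schur_slice R _ _ unit _ mu (fun _ t => expR (kphase x (pt t))) c mk (fun _ t => expR_ge0 _) (fun _ => k1 x) (fun t => amp u (pt t)) M tt ma aM).
Qed.

(** In modulus [exp (x^T A x)] and [exp (h(x,x))] cancel against [exp (- Phi0)], leaving the
    nonnegative kernel [exp kernel_phase] acting on the amplitude of [u]. The 2 is the constant of
    [normc_cint]. *)
Lemma amp_weyl_le u x : weyl_dom A B u ->
  amp (W u) x <= 2 * normc (wcst B * kcst / cB X B) *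
    Rintegral mu setT (fun t => expR (kphase x (pt t)) * amp u (pt t)).
Proof.
move=> domu; set P := Rintegral _ _ _.
have ik := cintegrable_kernel_dual eigm2 hA hB posB bddS kcst0 x domu.
have iR := integrable_kphase_amp x domu.
have iH : mu.-integrable setT (EFin \o (fun t => expR (hq x) * (expR (kphase x (pt t)) * amp u (pt t)))).
  by have := integrableZl measurableT (expR (hq x)) iR; apply: eq_integrable.
have hI : normc (cint mu setT (fun t => cexp (kexp x (pt t)) * dual u (pt t))) <= 2 * (expR (hq x) * P).
  rewrite -(RintegralZl _ measurableT iR); apply: (normc_cint measurableT ik iH) => t _.
  by rewrite normc_kernel_dual.
rewrite ampE /untwisted (weyl_kernelE eigm2 hA hB posB bddS kcst0 x domu).
move: (wcst B * kcst / cB X B) => c; rewrite !normcM !normc_cexp reN.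
move: hI; move: (normc (cint _ _ _)) => I hI.
have e1 : expR (- re (dot x (A *m x))) * expR (re (dot x (A *m x))) = 1 by rewrite -expRD addNr expR0.
have e2 : expR (hq x) * expR (- hq x) = 1 by rewrite -expRD subrr expR0.
have h0 := expR_ge0 (- hq x); have c0 := normc_ge0 c.
move: e1 e2 hI h0 c0.
move: (expR (- re _)) (expR (re _)) (expR (hq x)) (expR (- hq x)) (normc c) => a b d e c' e1 e2 hI h0 c0.
have -> : a * (c' * (b * I)) * e = c' * e * I by ring: e1.
have -> : 2 * c' * P = c' * e * (2 * (d * P)) by ring: e2.
by apply: ler_wpM2l => //; rewrite mulr_ge0.
Qed.

Lemma weyl_estimate : exists K : R, forall u, weyl_dom A B u ->
  (wnorm2 A B (W u) <= K%:E * wnorm2 A B u)%E.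
Proof.
have [c c0 [k1 k2]] := kphase_integral_le eigm2 hA hB posB bddS kcst0.
pose k t t' := expR (kphase (pt t) (pt t')).
have mk : measurable_fun setT (fun p : cs_T X * cs_T X => k p.1 p.2).
  by apply: measurableT_comp => //; apply: meas_kphase; [exact: mxmeas_pt1|exact: mxmeas_pt2].
have kge0 t t' : 0 <= k t t' by exact: expR_ge0.
pose C0 := 2 * normc (wcst B * kcst / cB X B).
have C00 : 0 <= C0 by rewrite mulr_ge0 ?normc_ge0.
(* [C0 ^+ 2] comes from the pointwise bound and [c ^+ 2] from Schur's test. *)
exists (C0 ^+ 2 * c ^+ 2) => u domu.
have [M M0 hM] := amp_bounded domu.
have vu := vcmeas_holomorphic domu.1.
have vW := vcmeas_holomorphic (weyl_holomorphic eigm2 hA hB posB bddS kcst0 domu).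
rewrite (wnorm2E X A B vu) (wnorm2E X A B vW).
have ma := meas_amp A B vu (mxmeas_pt X).
have w0 t : 0 <= amp u (pt t) by exact: amp_ge0.
have wM t : `|amp u (pt t)| <= M by rewrite ger0_norm ?amp_ge0.
have sch := schur_test mk kge0 c0 (fun t => k1 (pt t)) (fun t => k2 (pt t)) ma w0 wM.
rewrite EFinM -muleA; apply: le_trans (lee_wpmul2l _ sch); last by rewrite lee_fin sqr_ge0.
have P0 t : 0 <= Rintegral mu setT (fun t' => k t t' * amp u (pt t')).
  by apply: Rintegral_ge0 => t' _; rewrite mulr_ge0.
have mP := measurable_schur_sqr mk kge0 (fun t => k1 (pt t)) ma w0 wM.
rewrite -ge0_integralZl//; last 2 first.
- by move=> t _; rewrite lee_fin sqr_ge0.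
- by rewrite lee_fin sqr_ge0.
apply: ge0_le_integral => //.
- by move=> t _; rewrite lee_fin sqr_ge0.
- by apply/measurable_EFinP; apply: measurable_funX; exact: meas_amp vW (mxmeas_pt X).
- by apply: measurable_funeM.
move=> t _; rewrite -EFinM lee_fin -exprMn lerXn2r ?nnegrE ?amp_ge0 ?(mulr_ge0 C00)//.
exact: amp_weyl_le.
Qed.

End WeylEstimate.

Theorem theorem2p1 (R : realType) (n : nat)
  (Q : 'M[R[i]]_(n + n)) (L : 'rV[R[i]]_(n + n)) (A B : 'M[R[i]]_n) :
  ~~ eigenvalue (fundmx Q) 2 ->
  ~~ eigenvalue (fundmx Q) (-2) ->
  A^T = A ->
  B^T = cconjmx B ->
  (forall v : 'cV[R[i]]_n, v != 0 ->
     0 < complex.Re (((cconjmx v)^T *m B *m v) 0 0)) ->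
  (exists M : R, forall x : 'cV[R[i]]_n,
     Num.sqrt (sqmod (symb Q L (LamPt A B x))) <= M) ->
  exists K : R, forall u : 'cV[R[i]]_n -> R[i],
    weyl_dom A B u ->
    holomorphic (weyl A B (symb Q L) u) /\
    (wnorm2 A B (weyl A B (symb Q L) u) <= K%:E * wnorm2 A B u)%E.
Proof.
move=> _ eigm2 hA hB posB bddS; have [X] := @cspace_ex R n.
have [k0|k0] := eqVneq (kernel_cst X Q L A B) 0; last first.
  have [K hK] := weyl_estimate eigm2 hA hB posB bddS k0.
  exists K => u domu; split; last exact: hK.
  exact: (weyl_holomorphic eigm2 hA hB posB bddS k0).
(* With [kernel_cst] zero the operator vanishes on its whole domain. *)
exists 0 => u domu.
have -> : weyl A B (symb Q L) u = (fun=> 0).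
  by apply/funext => x; exact: (weyl_kcst0 hA hB posB bddS x domu k0).
split; first exact: holomorphic_cst.
rewrite (wnorm2E X A B (vcmeas_holomorphic (@holomorphic_cst R n 0))) mul0e.
rewrite (eq_integral (fun=> 0%E)) ?integral0// => t _.
by rewrite amp_sqr /sqmod /= expr0n /= addr0 mul0r.
Qed.
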